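(* Let $X$ be a linear Brownian motion with drift parameter $\mu\in\mathbb R$ and scale $\sigma>0$, and let $\sigma_n$ be an estimator of $\sigma$ such that $n^{1/4}(\sigma-\sigma_n)\to0$ in probability as $n\to\infty$. Then for any $x\in\mathbb R$ and $T>0$, $$n^{1/4}\sup_{t\le T}\big|\widehat L_t(x)-\widetilde L_t(x)\big|\to0,\qquad n^{3/4}\sup_{t\le T}\big|\widehat O_t(x)-\widetilde O_t(x)\big|\to0$$ in probability as $n\to\infty$.
   Context: $X_t=\mu t+\sigma B_t$ with $B$ a standard Brownian motion. Local time: $L_t(x)=\lim_{\epsilon\downarrow0}\frac1{2\epsilon}\int_0^t1_{(x-\epsilon,x+\epsilon)}(X_s)\,\mathrm ds$; occupation time: $O_t(x)=\int_0^t1_{(x,\infty)}(X_s)\,\mathrm ds$. $\mathbb E^0$ is expectation under which $X$ is a standard Brownian motion, and $g(x,z)=\mathbb E^0[L_1(x)\mid X_1=z]$, $G(x,z)=\mathbb E^0[O_1(x)\mid X_1=z]$. With $\Delta_i^nX=X_{i/n}-X_{(i-1)/n}$, the conditional mean estimators are $$\widehat L_t(x)=\mathbb E[L_t(x)\mid(X_{i/n})_{i\ge1}]=\frac1{\sigma\sqrt n}\sum_{i=1}^{\lfloor nt\rfloor}g\Big(\tfrac{\sqrt n}{\sigma}(x-X_{\frac{i-1}n}),\tfrac{\sqrt n}\sigma\Delta_i^nX\Big)+O_{\mathbb P}(n^{-1/2}),$$ $$\widehat O_t(x)=\mathbb E[O_t(x)\mid(X_{i/n})_{i\ge1}]=\frac1n\sum_{i=1}^{\lfloor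 nt\rfloor}G\Big(\tfrac{\sqrt n}{\sigma}(x-X_{\frac{i-1}n}),\tfrac{\sqrt n}\sigma\Delta_i^nX\Big)+O_{\mathbb P}(n^{-1}),$$ where the lower order terms are the conditional expectations of the local/occupation time accumulated on the incomplete interval $[\lfloor nt\rfloor/n,t]$ given the observations (explicit functions of $\sigma$, $t$ and the two neighbouring observations; zero when $nt$ is an integer). The plug-in estimators $\widetilde L_t(x)$, $\widetilde O_t(x)$ are obtained by replacing $\sigma$ by $\sigma_n$ in these expressions: $$\widetilde L_t(x)=\frac1{\sigma_n\sqrt n}\sum_{i=1}^{\lfloor nt\rfloor}g\Big(\tfrac{\sqrt n}{\sigma_n}(x-X_{\frac{i-1}n}),\tfrac{\sqrt n}{\sigma_n}\Delta_i^nX\Big)+O_{\mathbb P}(n^{-1/2}),$$ $$\widetilde O_t(x)=\frac1n\sum_{i=1}^{\lfloor nt\rfloor}G\Big(\tfrac{\sqrt n}{\sigma_n}(x-X_{\frac{i-1}n}),\tfrac{\sqrt n}{\sigma_n}\Delta_i^nX\Big)+O_{\mathbb P}(n^{-1}).$$ Estimators $\sigma_n$ take values in $(0,\infty)$. *)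

(* Defs.v *)
(* MathComp-Analysis *)
From mathcomp Require Import all_boot all_order all_algebra.
From mathcomp Require Import all_classical all_reals all_analysis.

Set Implicit Arguments.
Unset Strict Implicit.
Unset Printing Implicit Defensive.

Import Order.TTheory GRing.Theory Num.Theory.
Import numFieldNormedType.Exports.

Local Open Scope classical_set_scope.
Local Open Scope ring_scope.

(* Processes are functions X : R -> T -> R; only the times t >= 0 matter. *)

(* Independence of increments is the product rule along every finite grid
   t 0 <= ... <= t k (subfamilies are covered by taking some A i := setT).
   The second parameter of normal_prob is the standard deviation. *)
Definition standard_brownian (R : realType) (d : measure_display)
    (T : measurableType d) (P : probability T R) (B : R -> T -> R) : Prop :=
  [/\ forall t, 0 <= t -> measurable_fun setT (B t),
      forall w, B 0 w = 0,
      forall w, {within `[0, +oo[, continuous (fun t => B t w)},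
      forall (k : nat) (t : nat -> R) (A : nat -> set R),
        0 <= t 0%N -> {homo t : i j / (i <= j)%N >-> i <= j} ->
        (forall i, measurable (A i)) ->
        P (\bigcap_(i in `I_k) [set w | A i (B (t i.+1) w - B (t i) w)]) =
        (\prod_(i < k) P [set w | A i (B (t i.+1) w - B (t i) w)%R])%E
    & forall (s t : R) (A : set R), 0 <= s -> s < t -> measurable A ->
        P [set w | A (B t w - B s w)] = normal_prob 0 (Num.sqrt (t - s)) A].

Definition linear_brownian (R : realType) (T : Type) (mu sigma : R)
    (B : R -> T -> R) : R -> T -> R :=
  fun t w => mu * t + sigma * B t w.

(* The limit defining the local time at x exists only almost surely, so the
   local time is a random field that equals this limit off a null set (which
   may depend on t and x). *)
Definition is_local_time (R : realType) (d : measure_display)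
    (T : measurableType d) (P : probability T R)
    (X : R -> T -> R) (L : R -> R -> T -> R) : Prop :=
  forall t x : R, 0 <= t ->
    measurable_fun setT (L t x) /\
    {ae P, forall w,
      (2 * e)^-1 * (\int[lebesgue_measure]_(s in `[0, t])
                      \1_(`]x - e, x + e[%classic : set R) (X s w))
        @[e --> 0^'+] --> L t x w}.

Definition occupation_time (R : realType) (T : Type) (X : R -> T -> R)
    (t x : R) (w : T) : R :=
  \int[lebesgue_measure]_(s in `[0, t]) \1_(`]x, +oo[%classic : set R) (X s w).

Definition sigma_of (R : realType) (T I : Type) (X : I -> T -> R)
    : set (set T) :=
  <<s [set A | exists i U, measurable U /\ A = X i @^-1` U] >>.

Definition is_cond_exp (R : realType) (d : measure_display)
    (T : measurableType d) (P : probability T R) (F : set (set T))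
    (Y Z : T -> R) : Prop :=
  [/\ P.-integrable setT (EFin \o Y),
      P.-integrable setT (EFin \o Z),
      forall U : set R, measurable U -> F (Z @^-1` U)
    & forall A, F A ->
        (\int[P]_(w in A) (Z w)%:E = \int[P]_(w in A) (Y w)%:E)%E].

(* h s x z = E[Y s x | W 1 = z] for 0 <= s <= 1. The conditional expectation
   determines h s x only up to a Lebesgue-null set of z; the version intended is
   the continuous one, which is unique as W 1 has full support. Pinning it down
   matters because h is later evaluated at points rescaled by an estimator. *)
Definition is_cond_mean_at_1 (R : realType) (d : measure_display)
    (T : measurableType d) (P : probability T R) (W : R -> T -> R)
    (Y : R -> R -> T -> R) (h : R -> R -> R -> R) : Prop :=
  forall s x : R, 0 <= s <= 1 ->
    continuous (h s x) /\
    is_cond_exp P (sigma_of (fun _ : unit => W 1)) (Y s x)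
      (fun w => h s x (W 1 w)).

Definition observations (R : realType) (T : Type) (X : R -> T -> R) (n : nat)
    : set (set T) :=
  sigma_of (fun i : nat => X (i.+1%:R / n%:R)).

(* Z t is E[Y t | (X_{i/n})_{i >= 1}] for every t >= 0. The almost surely
   continuous version of this process is taken, so that suprema over t do not
   depend on the choice of versions. *)
Definition is_cond_mean_process (R : realType) (d : measure_display)
    (T : measurableType d) (P : probability T R) (X : R -> T -> R) (n : nat)
    (Y Z : R -> T -> R) : Prop :=
  (forall t, 0 <= t -> is_cond_exp P (observations X n) (Y t) (Z t)) /\
  {ae P, forall w, {within `[0, +oo[, continuous (fun t => Z t w)}}.

(* \sum_{i <= floor(nt)} h 1 (sqrt n / c (x - X_{(i-1)/n})) (sqrt n / c Delta_i X)
   plus the contribution of the incomplete interval [k/n, t], k = floor(nt).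
   By Brownian scaling the latter is given by h at the elapsed fraction nt - k
   of the interval; it vanishes when nt is an integer. *)
Definition increment_sum (R : realType) (T : Type)
    (h : R -> R -> R -> R) (X : R -> T -> R) (n : nat) (c x t : R) (w : T) : R :=
  let term s (i : nat) :=
    h s (Num.sqrt n%:R / c * (x - X (i%:R / n%:R) w))
        (Num.sqrt n%:R / c * (X (i.+1%:R / n%:R) w - X (i%:R / n%:R) w)) in
  let k := Num.truncn (n%:R * t) in
  \sum_(i < k) term 1 i + term (n%:R * t - k%:R) k.

Definition plugin_local_time (R : realType) (T : Type) (g : R -> R -> R -> R)
    (X : R -> T -> R) (sigma_ : nat -> T -> R) (n : nat) (x t : R) (w : T) : R :=
  (sigma_ n w * Num.sqrt n%:R)^-1 * increment_sum g X n (sigma_ n w) x t w.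

Definition plugin_occupation_time (R : realType) (T : Type)
    (G : R -> R -> R -> R) (X : R -> T -> R) (sigma_ : nat -> T -> R) (n : nat)
    (x t : R) (w : T) : R :=
  n%:R^-1 * increment_sum G X n (sigma_ n w) x t w.

(* Convergence to 0 in probability of nonnegative extended-real functions,
   through the outer probability mu_ext P, which is P on measurable events:
   no measurability of the suprema over t needs to be assumed. *)
Definition cvg0_in_probability (R : realType) (d : measure_display)
    (T : measurableType d) (P : probability T R) (Z : nat -> T -> \bar R)
    : Prop :=
  forall e : R, 0 < e ->
    mu_ext P [set w | (e%:E < Z n w)%E] @[n --> \oo] --> 0%E.

Definition sup_dist (R : realType) (tmax : R) (f g : R -> R) : \bar R :=
  ereal_sup [set `|f t - g t|%:E | t in `[0, tmax]].

(* Main.v *)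
Require Import Defs.
From HB Require Import structures.
From mathcomp Require Import all_boot all_order all_algebra.
From mathcomp Require Import all_classical all_reals all_analysis.
From mathcomp Require Import measurable_realfun.
From mathcomp Require Import ring lra.

(** Write X_k for the observation at time k/n and put k = floor(ns), r = ns - k.
Given the observations, X at time s is a point of a Brownian bridge, hence
normal with mean X_k + r (X_(k+1) - X_k) and standard deviation
sigma / (sqrt n * kap r), where kap r = 1 / sqrt (r (1 - r)) ([bridge]).  The
conditional mean of the occupation time above x is therefore the time integral
of the upper tail of this law at x, and that of the local time at x is the time
integral of its density at x.  Both integrands have the form [bdens], with p
false and H the Gaussian tail, or p true and H the Gaussian density; the form
also makes sense with any scale c in place of sigma, and [bmean] is its time
integral.  For the local time the tail formula is applied to small intervals
around x and the limit is taken under both integrals, the passage on the left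
being justified by a second moment bound ([local_time_bridge_mean]).

The continuous versions singled out by the definitions make these identities
pathwise.  Almost surely, for all times at once, the conditional mean estimator
is [bmean] at scale sigma ([cond_mean_process_eq]).  The functions g and G are
the case n = 1 without drift, so they equal [kern] everywhere
([cond_mean_at_1_kern]), and the plug-in estimator is [bmean] at scale sigma_n.

It remains to compare two scales.  By Gaussian decay, changing sigma into c
changes H (u / sigma) by at most a constant times |sigma - c| / (1 + u^2)
([scale_dist]).  Averaged over one cell of the grid, the change is at most a
constant times |sigma - c| times the [cell_bound]

    sqrt n (1 + n (X_(k+1) - X_k)^2) / (1 + n (x - X_k)^2),

up to the factor sqrt n gained when p is false ([bmean_dist]).  The numerator is
independent of the denominator, and its mean is sqrt n times a constant.  The
normal density of X_k being O(sqrt (n / k)), the inverse of the denominator has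
mean O(k^(-1/2)).  So the average over the cells up to time tmax of these
quantities, [cell_sum], has bounded mean ([cell_sum_mean]), hence is bounded in
probability.  The scaled supremum is at most a constant times
n^(1/4) |sigma - sigma_n| times this average, and tends to 0 in probability
([plugin_error_limit]). *)

Import Order.TTheory GRing.Theory Num.Theory.
Import numFieldNormedType.Exports.

Set Implicit Arguments.
Unset Strict Implicit.
Unset Printing Implicit Defensive.

Local Open Scope classical_set_scope.
Local Open Scope ring_scope.

(** * Integration against affine images, densities and independent variables *)

Lemma eq_leW d (T : porderType d) (x y : T) : x = y -> (x <= y)%O.
Proof. by move=> ->. Qed.

Lemma invr_norm_ge0 (R : realType) (a : R) : 0 <= `|a|^-1. Proof. by rewrite invr_ge0. Qed.

Section affine.
Context {R : realType}.
Notation lam := (@lebesgue_measure R).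

(** By uniqueness of the Lebesgue measure, it is enough to compare the two sides
on half-open intervals. *)
Lemma lebesgue_measure_affine (a b : R) (A : set R) : a != 0 -> measurable A ->
  lam ((fun x => a * x + b) @^-1` A) = ((`|a|^-1)%R%:E * lam A)%E.
Proof.
move=> a0 mA.
have mh : measurable_fun setT (fun x : R => a * x + b).
  exact: measurable_funD.
pose k : {nonneg R} := NngNum (normr_ge0 a).
suff H : lam A = (`|a|%R%:E * lam ((fun x => (a * x + b)%R) @^-1` A))%E.
  rewrite H muleA -EFinM mulVf ?normr_eq0// mul1e//.
pose m' := mscale k (pushforward lam (fun x : R => a * x + b : measurableTypeR R)).
transitivity (m' mh A); last by [].
apply: lebesgue_measure_unique mA => _ [[p q] _ <-].
rewrite /m' /mscale /pushforward.
have [pq|qp] := ltP p q; last first.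
  by rewrite set_itv_ge ?preimage_set0 ?measure0 ?mule0// bnd_simp -leNgt.
move: a0; rewrite neq_lt => /orP[a0|a0].
  have E : (fun x : R => a * x + b) @^-1` `]p, q]%classic
      = `[(q - b) / a, (p - b) / a[%classic.
    apply/seteqP; split => x /=; rewrite !in_itv/= => /andP[H1 H2].
      by rewrite ler_ndivrMr// ltr_ndivlMr//; lra.
    by move: H1 H2; rewrite ler_ndivrMr// ltr_ndivlMr// => H1 H2; lra.
  transitivity (`|a|%R%:E * lam `[((q - b) / a)%R, ((p - b) / a)%R[%classic)%E; last first.
    by congr (_ * lam _)%E; exact/esym/E.
  rewrite !lebesgue_measure_itv/= !lte_fin pq.
  rewrite ltr_nM2r ?invr_lt0// ltrD2r pq -!EFinB -EFinM ltr0_norm//.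
  by congr EFin; field; rewrite lt_eqF.
have E : (fun x : R => a * x + b) @^-1` `]p, q]%classic
    = `](p - b) / a, (q - b) / a]%classic.
  apply/seteqP; split => x /=; rewrite !in_itv/= => /andP[H1 H2].
    by rewrite ltr_pdivrMr// ler_pdivlMr//; lra.
  by move: H1 H2; rewrite ltr_pdivrMr// ler_pdivlMr// => H1 H2; lra.
transitivity (`|a|%R%:E * lam `]((p - b) / a)%R, ((q - b) / a)%R]%classic)%E; last first.
  by congr (_ * lam _)%E; exact/esym/E.
rewrite !lebesgue_measure_itv/= !lte_fin pq.
rewrite ltr_pM2r ?invr_gt0// ltrD2r pq -!EFinB -EFinM gtr0_norm//.
by congr EFin; field; rewrite gt_eqF.
Qed.

Lemma ge0_integral_affine (a b : R) (D : set R) (f : R -> \bar R) : a != 0 ->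
  measurable D -> measurable_fun D f -> (forall x, D x -> 0 <= f x)%E ->
  (\int[lam]_(x in (fun x => (a * x + b)%R) @^-1` D) f (a * x + b)%R =
   (`|a|^-1)%R%:E * \int[lam]_(x in D) f x)%E.
Proof.
move=> a0 mD mf f0.
have mh : measurable_fun setT (fun x : R => a * x + b).
  exact: measurable_funD.
pose k : {nonneg R} := NngNum (invr_norm_ge0 a).
have := @ge0_integral_pushforward _ _ (measurableTypeR R) (measurableTypeR R) R _ mh lam D f mD mf.
move=> <-; last by move=> x; rewrite inE; exact: f0.
rewrite -(@ge0_integral_mscale _ (measurableTypeR R) R lam D mD k f mf f0).
apply: eq_measure_integral => A mA _.
exact: (lebesgue_measure_affine b a0 mA).
Qed.

End affine.

Lemma integral_prob_cst d (T : measurableType d) (R : realType)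
  (P : probability T R) (k : \bar R) : (\int[P]_w k = k)%E.
Proof.
rewrite integral_cst// [X in (_ * X)%E](_ : _ = 1%E) ?mule1//.
exact: (@probability_setT _ _ _ P).
Qed.

Section density.
Context d (T : measurableType d) (R : realType).
Variables (nu mu : {measure set T -> \bar R}) (h : T -> R).
Hypotheses (mh : measurable_fun setT h) (h0 : forall x, 0 <= h x).
Hypothesis nuE : forall A, measurable A -> nu A = (\int[mu]_(x in A) (h x)%:E)%E.
Import HBNNSimple.

(** Monotone convergence along simple functions reduces the claim to indicators,
for which it is [nuE]. *)
Lemma ge0_integral_density (f : T -> \bar R) :
  measurable_fun setT f -> (forall x, 0 <= f x)%E ->
  (\int[nu]_x f x = \int[mu]_x (f x * (h x)%:E))%E.
Proof.
move=> mf f0; pose g := nnsfun_approx measurableT mf.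
have mhE : measurable_fun setT (EFin \o h) by exact/measurable_EFinP.
have gf x : (EFin \o g ^~ x) n @[n --> \oo] --> f x by exact: cvg_nnsfun_approx.
transitivity (limn (fun n => \int[nu]_x (g n x)%:E)%E).
  rewrite -monotone_convergence//.
  - by apply: eq_integral => x _; apply/esym/cvg_lim => //; exact: gf.
  - by move=> n; exact/measurable_EFinP.
  - by move=> n x _; rewrite lee_fin.
  - by move=> x _ a b ab; rewrite lee_fin; exact/lefP/nd_nnsfun_approx.
transitivity (limn (fun n => \int[mu]_x ((g n x)%:E * (h x)%:E))%E); last first.
  rewrite -monotone_convergence//.
  - apply: eq_integral => x _; apply/cvg_lim => //.
    by apply: cvgeZr => //; exact: gf.
  - by move=> n; apply: emeasurable_funM => //; exact/measurable_EFinP.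
  - by move=> n x _; rewrite mule_ge0// lee_fin.
  - move=> x _ a b ab; apply: lee_wpmul2r; rewrite lee_fin//.
    exact/lefP/nd_nnsfun_approx.
congr (limn _); apply/funext => n.
under eq_integral do rewrite fimfunE -fsumEFin//.
rewrite [LHS]ge0_integral_fsum//; last 2 first.
  - by move=> r; exact/measurable_EFinP/measurableT_comp.
  - by move=> m x _; rewrite EFinM nnfun_muleindic_ge0.
under [RHS]eq_integral.
  move=> x xD; rewrite fimfunE -fsumEFin// ge0_mule_fsuml; last first.
    by move=> r; rewrite EFinM nnfun_muleindic_ge0.
  over.
rewrite [RHS]ge0_integral_fsum//; last 2 first.
  - move=> r; apply: emeasurable_funM => //.
    by apply/measurable_EFinP; apply/measurableT_comp => //.
  - move=> m x _; rewrite mule_ge0 ?lee_fin//; try exact: nnfun_muleindic_ge0.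
apply: eq_fsbigr => r; rewrite inE => -[x _ gx].
have mE : measurable (g n @^-1` [set r]) by exact: measurable_sfunP.
have r0 : 0 <= r by rewrite -gx.
under [RHS]eq_integral do rewrite EFinM -muleA.
rewrite integralZl_indic_nnsfun//.
rewrite [RHS]ge0_integralZl//; last 2 first.
  by apply: emeasurable_funM => //; exact/measurable_EFinP.
  by move=> y _; rewrite mule_ge0// lee_fin.
congr (_ * _)%E; rewrite integral_indic// setIT nuE//.
rewrite integral_mkcond; apply: eq_integral => y _.
by rewrite patchE indicE; case: ifPn => _; rewrite ?mul1e// mul0e.
Qed.
End density.

Section freeze.
Context d (T : measurableType d) (R : realType) (P : probability T R).
Variable (G : set (set T)).
Hypothesis Gm : <<s G >> `<=` measurable.

Let mP : set (g_sigma_algebraType G) -> \bar R := P.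
Let mP0 : mP set0 = 0%E. Proof. exact: measure0. Qed.
Let mP_ge0 A : (0 <= mP A)%E. Proof. exact: measure_ge0. Qed.
Let mP_sigma_additive : semi_sigma_additive mP.
Proof.
move=> F mF tF mUF; apply: (@measure_semi_sigma_additive _ _ _ P) => //.
  by move=> i; apply: Gm; exact: mF.
exact: Gm.
Qed.
HB.instance Definition _ := isMeasure.Build _ _ _ mP mP0 mP_ge0 mP_sigma_additive.
Let mP_setT : mP setT = 1%E. Proof. exact: probability_setT. Qed.
HB.instance Definition _ := Measure_isProbability.Build _ _ _ mP mP_setT.

Lemma measurable_id_sub : measurable_fun setT (id : T -> g_sigma_algebraType G).
Proof. by move=> _ A mA; rewrite setTI; exact: Gm. Qed.

(** If [D] is independent of the sub-sigma-algebra generated by [G], the pair of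
the sample point, seen through [G], and [D] has a product law, and the claim is
Tonelli's theorem.  Conditioning on [G] thus amounts to integrating [D] out with
the rest frozen.  Having the sample point itself as first component lets [f]
depend on any number of [G]-measurable variables. *)
Lemma freezing (D : T -> R) (nu : probability (measurableTypeR R) R)
   (f : g_sigma_algebraType G * measurableTypeR R -> \bar R) :
  measurable_fun setT D ->
  (forall E C, <<s G >> E -> measurable C ->
     P (E `&` D @^-1` C) = (P E * nu C)%E) ->
  measurable_fun setT f -> (forall z, 0 <= f z)%E ->
  (\int[P]_w f (w, D w) = \int[P]_w \int[nu]_v f (w, v))%E.
Proof.
move=> mD ind mf f0.
pose phi (w : T) : g_sigma_algebraType G * measurableTypeR R := (w, D w).
have mphi : measurable_fun setT phi.
  by apply: measurable_fun_pair => //; exact: measurable_id_sub.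
transitivity (\int[mP \x nu]_z f z)%E.
  transitivity (\int[pushforward P phi]_z f z)%E.
    by rewrite ge0_integral_pushforward//.
  apply: eq_measure_integral => A mA _.
  apply/esym/product_measure_unique => //.
rewrite fubini_tonelli1//.
have := @ge0_integral_pushforward _ _ T (g_sigma_algebraType G) R id
  measurable_id_sub P setT (fubini_F nu f) measurableT
  (measurable_fun_fubini_tonelli_F f mf f0) _.
rewrite preimage_setT => <-; last by move=> w _; exact: integral_ge0.
apply: eq_measure_integral => [|A mA _]; first exact: measurable_id_sub.
by [].
Qed.
End freeze.

(** * The Gaussian density and its upper tail *)

Section gauss.
Context {R : realType}.
Notation lam := (@lebesgue_measure R).
Implicit Types (m v x u : R).

Definition gphi u : R := normal_pdf 0 1 u.

Lemma gphiE u : gphi u = (Num.sqrt (pi *+ 2))^-1 * expR (- (u ^+ 2 / 2)).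
Proof.
rewrite /gphi normal_pdfE ?oner_neq0// /normal_peak /normal_fun expr1n mul1r.
by rewrite subr0 mulNr.
Qed.

Lemma normal_pdf_scale m v x : 0 < v ->
  normal_pdf m v x = v^-1 * gphi (v^-1 * (x - m)).
Proof.
move=> v0; rewrite gphiE normal_pdfE ?gt_eqF// /normal_peak /normal_fun.
rewrite -mulrnAr sqrtrM ?sqr_ge0// sqrtr_sqr gtr0_norm// invfM mulrA.
congr (_ * expR _); rewrite -mulr_natl; field; rewrite gt_eqF//.
Qed.

Lemma normal_prob_scale m v U : 0 < v -> measurable U ->
  normal_prob m v U = normal_prob 0 1 ((fun u => v * u + m) @^-1` U).
Proof.
move=> v0 mU; rewrite /normal_prob.
have := @ge0_integral_affine R v m U (EFin \o normal_pdf m v) _ mU _ _.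
move=> /(_ _)/= H.
transitivity (v%:E * \int[lam]_(x in (fun x => (v * x + m)%R) @^-1` U)
    (normal_pdf m v (v * x + m))%:E)%E.
  rewrite H ?gt_eqF//.
  - by rewrite muleA -EFinM gtr0_norm// divff ?mul1e// gt_eqF.
  - by apply/measurable_EFinP/measurable_funTS; exact: measurable_normal_pdf.
  - by move=> x _; rewrite lee_fin normal_pdf_ge0.
have mh : measurable_fun setT (fun u : R => v * u + m) by exact: measurable_funD.
have mhU : measurable ((fun u : R => v * u + m) @^-1` U).
  by rewrite -[X in measurable X]setTI; exact: mh.
rewrite -ge0_integralZl_EFin ?ltW//; last 2 first.
  - by move=> x _; rewrite lee_fin normal_pdf_ge0.
  - apply/measurable_EFinP/measurable_funTS/measurableT_comp => //.
    exact: measurable_normal_pdf.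
apply: eq_integral => x _; rewrite -EFinM normal_pdf_scale//.
congr EFin; rewrite mulrA divff ?gt_eqF// mul1r addrK mulKf ?gt_eqF//.
Qed.

Lemma gphi_ge0 u : 0 <= gphi u. Proof. exact: normal_pdf_ge0. Qed.

Lemma gphi_le_expR u : gphi u <= expR (- (u ^+ 2 / 2)).
Proof.
have p2 := pi_ge2 R; have p0 : 0 < pi *+ 2 :> R by lra.
rewrite gphiE ler_piMl ?expR_ge0// invf_le1 ?sqrtr_gt0//.
by rewrite -[leLHS]sqrtr1 ler_sqrt//; lra.
Qed.

Lemma gphi_le1 u : gphi u <= 1.
Proof.
apply: le_trans (gphi_le_expR u) _; rewrite -expR0 ler_expR.
by rewrite oppr_le0 mulr_ge0// sqr_ge0.
Qed.

(** The fourth power leaves room for the factor |u| of the derivative in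
[gphi_lip] and for u^2 in [normal_second_moment]. *)
Lemma gphi_decay u : gphi u <= 8 ^+ 4 / (1 + u ^+ 2) ^+ 4.
Proof.
apply: le_trans (gphi_le_expR u) _.
have u0 : 0 <= u ^+ 2 by exact: sqr_ge0.
rewrite expRN -[leRHS]invrK lef_pV2 ?posrE ?expR_gt0//; last first.
  by rewrite invr_gt0 divr_gt0 ?exprn_gt0 ?ltr_pwDl.
rewrite invf_div (_ : u ^+ 2 / 2 = (u ^+ 2 / 8) *+ 4); last by rewrite -mulr_natl; field.
rewrite -(mulr_natl (_ / 8)) expRM_natl.
rewrite -expr_div_n; apply: lerXn2r; rewrite ?nnegrE ?expR_ge0//; first lra.
by apply: le_trans (expR_ge1Dx _); lra.
Qed.

Lemma continuous_gphi : continuous gphi.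
Proof. by apply: continuous_normal_pdf; rewrite oner_neq0. Qed.

Lemma measurable_gphi : measurable_fun setT gphi.
Proof. exact: measurable_normal_pdf. Qed.

Lemma gphi_is_derive u : is_derive u 1 gphi (- u * gphi u).
Proof.
have -> : gphi = (fun u => (Num.sqrt (pi *+ 2))^-1 * expR (- (u ^+ 2 / 2))).
  by apply/funext => w; exact: gphiE.
set c := (Num.sqrt _)^-1; apply: is_derive_eq.
rewrite /GRing.scale/= !mulr1; by field.
Qed.

Definition away m a b := forall v, a <= v <= b -> m <= `|v|.

(** The mean value theorem: the derivative -u * gphi u is controlled by
[gphi_decay], one power of 1 + u^2 absorbing |u|. *)
Lemma gphi_lip m a b : 0 <= m -> a <= b -> away m a b ->
  `|gphi a - gphi b| <= 8 ^+ 4 * (b - a) / (1 + m ^+ 2) ^+ 2.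
Proof.
move=> m0; rewrite le_eqVlt => /predU1P[<- _|ab maway].
  by rewrite !subrr normr0 mulr0 mul0r.
have [|c /[!in_itv]/= /andP[ac cb] E] := @MVT R gphi (fun u => - u * gphi u) a b ab
  (fun x _ => gphi_is_derive x).
  by apply: continuous_subspaceT => x; exact: continuous_gphi.
rewrite distrC E !normrM normrN (gtr0_norm (_ : 0 < b - a)) ?subr_gt0//.
rewrite -mulrA mulrCA mulrA [leRHS]mulrAC ler_pM2r ?subr_gt0//.
rewrite (ger0_norm (gphi_ge0 _)).
have c2 : `|c| ^+ 2 = c ^+ 2 by rewrite -normrX ger0_norm// sqr_ge0.
have cm : m ^+ 2 <= c ^+ 2.
  by rewrite -c2 lerXn2r ?nnegrE ?maway// ltW// ltW.
have c0 : 0 <= `|c| by [].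
have Hc : `|c| <= 1 + c ^+ 2 by rewrite -c2; nra.
have Hd := gphi_decay c.
set w := c ^+ 2 in c2 cm Hc Hd *.
have w0 : 0 <= w by exact: sqr_ge0.
apply: (@le_trans _ _ ((1 + w) * (8 ^+ 4 / (1 + w) ^+ 4))).
  by rewrite mulrC; apply: ler_pM => //; exact: gphi_ge0.
have -> : (1 + w) * (8 ^+ 4 / (1 + w) ^+ 4) = 8 ^+ 4 / (1 + w) ^+ 3.
  by field; lra.
rewrite ler_pM2l// lef_pV2 ?posrE ?exprn_gt0//; try by nra.
Qed.

Definition Ph u : R := fine (normal_prob 0 1 `]u, +oo[%classic).

Lemma PhE u : (Ph u)%:E = normal_prob 0 1 `]u, +oo[%classic.
Proof. by rewrite /Ph fineK// fin_num_measure. Qed.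

Lemma Ph_ge0 u : 0 <= Ph u.
Proof. by rewrite -lee_fin PhE. Qed.

Lemma Ph_le1 u : Ph u <= 1.
Proof. by rewrite -lee_fin PhE probability_le1. Qed.

End gauss.

Section gauss2.
Context {R : realType}.
Notation lam := (@lebesgue_measure R).
Implicit Types (m v x u : R).

Lemma PhB a b : a <= b ->
  (Ph a - Ph b)%:E = (\int[lam]_(x in `]a, b]) (gphi x)%:E)%E.
Proof.
move=> ab; rewrite EFinB !PhE.
have -> : `]a, +oo[%classic = `]a, b]%classic `|` `]b, +oo[%classic.
  by apply: itv_bndbnd_setU; rewrite bnd_simp.
rewrite measureU//; last first.
  by rewrite -subset0 => x/= []; rewrite !in_itv/= => /andP[_ xb]; rewrite andbT ltNge xb.
by rewrite addeK// fin_num_measure.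
Qed.

Lemma PhB_bounds a b lo hi : a <= b ->
  (forall v, a <= v <= b -> lo <= gphi v <= hi) ->
  lo * (b - a) <= Ph a - Ph b <= hi * (b - a).
Proof.
move=> ab H; rewrite -!lee_fin PhB//.
have E k : (k * (b - a))%:E = (\int[lam]_(x in `]a, b]) k%:E)%E.
  rewrite integral_cst//= lebesgue_measure_itv/= lte_fin.
  have [ab'|] := ltP a b; first by rewrite -EFinB -EFinM.
  by move=> ba; rewrite mule0 (le_anti (introT andP (conj ab ba))) subrr mulr0.
have mg : measurable_fun `]a, b]%classic (EFin \o @gphi R).
  by apply/measurable_EFinP/measurable_funTS; exact: measurable_gphi.
have ig : lam.-integrable `]a, b]%classic (EFin \o @gphi R).
  by apply: integrableS (integrable_normal_pdf 0 1) => //.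
have ik k : lam.-integrable `]a, b]%classic (EFin \o cst k).
  have /(integrableS _ _ _) : lam.-integrable `[a, b]%classic (EFin \o cst k).
    apply: continuous_compact_integrable; first exact: segment_compact.
    by apply: continuous_subspaceT => x; exact: cst_continuous.
  by apply => //; apply: subset_itv; rewrite bnd_simp.
have Hb x : x \in `]a, b]%classic -> lo <= gphi x <= hi.
  by rewrite inE/= in_itv/= => /andP[ax xb]; apply: H; rewrite ltW.
rewrite !E; apply/andP; split.
  apply: le_integral => //; first exact: (ik lo).
  by move=> x xab; rewrite lee_fin; case/andP: (Hb x xab).
apply: le_integral => //; first exact: (ik hi).
by move=> x xab; rewrite lee_fin; case/andP: (Hb x xab).
Qed.

(** The increment of the tail is an integral of [gphi], bounded by [gphi_decay]. *)
Lemma Ph_lip m a b : 0 <= m -> a <= b -> away m a b ->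
  `|Ph a - Ph b| <= 8 ^+ 4 * (b - a) / (1 + m ^+ 2) ^+ 2.
Proof.
move=> m0 ab maway.
have H v : a <= v <= b -> 0 <= gphi v <= 8 ^+ 4 / (1 + m ^+ 2) ^+ 2.
  move=> vab; rewrite gphi_ge0/=; apply: le_trans (gphi_decay v) _.
  have v2 : `|v| ^+ 2 = v ^+ 2 by rewrite -normrX ger0_norm// sqr_ge0.
  have mv : m ^+ 2 <= v ^+ 2 by rewrite -v2 lerXn2r ?nnegrE// maway.
  have m2 : 0 <= m ^+ 2 by exact: sqr_ge0.
  rewrite ler_pM2l ?exprn_gt0// lef_pV2 ?posrE ?exprn_gt0 ?ltr_pwDl ?sqr_ge0//.
  apply: (@le_trans _ _ ((1 + v ^+ 2) ^+ 2)); last by apply: ler_weXn2l => //; lra.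
  by rewrite lerXn2r ?nnegrE; nra.
have /andP[H1 H2] := PhB_bounds ab H.
by rewrite ger0_norm; [rewrite mulrAC|rewrite mul0r in H1].
Qed.

Lemma normal_prob_ray m v x : 0 < v ->
  normal_prob m v `]x, +oo[%classic = (Ph (v^-1 * (x - m)))%:E.
Proof.
move=> v0; rewrite normal_prob_scale// PhE; congr (normal_prob 0 1 _).
by apply/seteqP; split => u /=;
  rewrite !in_itv/= !andbT (mulrC v^-1) ltr_pdivrMr// => ?; lra.
Qed.

Lemma normal_prob_itv m v x y : 0 < v -> y <= x ->
  normal_prob m v `]y, x[%classic =
  (Ph (v^-1 * (y - m)) - Ph (v^-1 * (x - m)))%:E.
Proof.
move=> v0 yx; rewrite normal_prob_scale// PhB; last first.
  by rewrite ler_pM2l ?invr_gt0// lerD2r.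
rewrite -integral_itv_bndo_bndc; last first.
  by apply/measurable_EFinP/measurable_funTS; exact: measurable_gphi.
congr (normal_prob 0 1 _).
by apply/seteqP; split => u /=;
  rewrite !in_itv/= !(mulrC v^-1) ltr_pdivrMr// ltr_pdivlMr// => ?; lra.
Qed.

Lemma normal_integral m v (f : measurableTypeR R -> \bar R) :
  measurable_fun setT f -> (forall x, 0 <= f x)%E ->
  (\int[normal_prob m v]_x f x = \int[lam]_x (f x * (normal_pdf m v x)%:E))%E.
Proof.
move=> mf f0; apply: ge0_integral_density => //.
- exact: measurable_normal_pdf.
- by move=> x; exact: normal_pdf_ge0.
Qed.

Lemma measurable_normal_pdf_pair d (T : measurableType d) (m x : T -> R) v :
  0 < v -> measurable_fun setT m -> measurable_fun setT x ->
  measurable_fun setT (fun w => normal_pdf (m w) v (x w)).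
Proof.
move=> v0 mm mx.
under eq_fun do rewrite normal_pdf_scale//.
apply: measurable_funM => //; apply: measurableT_comp; first exact: measurable_gphi.
by apply: measurable_funM => //; exact: measurable_funB.
Qed.

(** Completing the square.  For independent centered U and V, with standard
deviations [al] and [be], the joint density of U and U + V factors into the
density of U + V times the conditional density of U given U + V. *)
Lemma normal_pdf_mul (al be de z u : R) : 0 < al -> 0 < be -> 0 < de ->
  de ^+ 2 = al ^+ 2 + be ^+ 2 ->
  normal_pdf 0 be (z - u) * normal_pdf 0 al u =
  normal_pdf (al ^+ 2 / de ^+ 2 * z) (al * be / de) u * normal_pdf 0 de z.
Proof.
move=> a0 b0 d0 dE.
rewrite !normal_pdf_scale ?divr_gt0 ?mulr_gt0// !gphiE !subr0.
rewrite mulrACA [RHS]mulrACA; congr (_ * _).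
  by field; rewrite !gt_eqF.
rewrite mulrACA [RHS]mulrACA -!expRD; congr (_ * expR _).
have d20 : de ^+ 2 != 0 by rewrite gt_eqF// exprn_gt0.
rewrite !exprMn !exprVn !exprMn !exprVn dE in d20 *.
field; rewrite d20 !gt_eqF//.
Qed.

(** The disintegration of [normal_pdf_mul] under the integral sign: sampling U and
V amounts to sampling Z = U + V first and then U given Z. *)
Lemma gauss_rotation (al be de : R) (F : measurableTypeR R * measurableTypeR R -> \bar R) :
  0 < al -> 0 < be -> 0 < de -> de ^+ 2 = al ^+ 2 + be ^+ 2 ->
  measurable_fun setT F -> (forall z, 0 <= F z)%E ->
  (\int[normal_prob 0 al]_u \int[normal_prob 0 be]_v F ((u + v)%R, u) =
   \int[normal_prob 0 de]_z
     \int[normal_prob (al ^+ 2 / de ^+ 2 * z) (al * be / de)]_u F (z, u))%E.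
Proof.
move=> a0 b0 d0 dE mF F0.
have ga0 : 0 < al * be / de by rewrite divr_gt0 ?mulr_gt0.
have mFu u : measurable_fun setT (fun v : measurableTypeR R => F ((u + v)%R, u)).
  apply: measurableT_comp => //; apply: measurable_fun_pair => //.
  exact: measurable_funD.
pose K (x : measurableTypeR R * measurableTypeR R) : \bar R :=
  (F (x.2, x.1) * (normal_pdf 0 be (x.2 - x.1) * normal_pdf 0 al x.1)%:E)%E.
have mK : measurable_fun setT K.
  apply: emeasurable_funM.
    by apply: measurableT_comp => //; exact: measurable_fun_pair.
  apply/measurable_EFinP/measurable_funM.
    by apply: measurable_normal_pdf_pair => //; exact: measurable_funB.
  by apply: measurable_normal_pdf_pair.
have K0 y : (0 <= K y)%E.
  by rewrite mule_ge0// lee_fin mulr_ge0// normal_pdf_ge0.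
transitivity (\int[lam]_u \int[lam]_z K (u, z))%E.
  rewrite normal_integral; last 2 first.
  - have : measurable_fun setT (fun x : measurableTypeR R * measurableTypeR R
      => F ((x.1 + x.2)%R, x.1)).
      apply: measurableT_comp => //; apply: measurable_fun_pair => //.
      exact: measurable_funD.
    by move=> /(measurable_fun_fubini_tonelli_F (m2 := normal_prob 0 be)); apply.
  - by move=> u; exact: integral_ge0.
  apply: eq_integral => u _.
  rewrite normal_integral//.
  rewrite -ge0_integralZr//; last 3 first.
  - apply: emeasurable_funM => //; apply/measurable_EFinP; exact: measurable_normal_pdf.
  - by move=> v _; rewrite mule_ge0// lee_fin normal_pdf_ge0.
  - by rewrite lee_fin normal_pdf_ge0.
  have := @ge0_integral_affine R 1 u setT (fun z => K (u, z)) (oner_neq0 _) measurableT.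
  rewrite preimage_setT normr1 invr1 mul1e => <-//; last first.
    by apply: measurable_funTS; apply: measurableT_comp => //; exact: measurable_fun_pair.
  apply: eq_integral => v _; rewrite /K/= mul1r addrC addrK EFinM muleA.
  by [].
rewrite fubini_tonelli//.
rewrite normal_integral; last 2 first.
- have : measurable_fun setT (fun x : measurableTypeR R * measurableTypeR R =>
      (F x * (normal_pdf (al ^+ 2 / de ^+ 2 * x.1) (al * be / de) x.2)%:E)%E).
    apply: emeasurable_funM => //; apply/measurable_EFinP.
    by apply: measurable_normal_pdf_pair => //; exact: measurable_funM.
  move=> /(measurable_fun_fubini_tonelli_F (m2 := lam)) H.
  apply: eq_measurable_fun (H _) => [z _|y].
    rewrite /fubini_F/= normal_integral//; exact: measurableT_comp.
  by rewrite mule_ge0// lee_fin normal_pdf_ge0.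
- by move=> z; exact: integral_ge0.
apply: eq_integral => z _.
have mFz : measurable_fun setT (fun u => F (z, u)) by exact: measurableT_comp.
rewrite normal_integral// -ge0_integralZr//; last 3 first.
- apply: emeasurable_funM => //; apply/measurable_EFinP; exact: measurable_normal_pdf.
- by move=> v _; rewrite mule_ge0// lee_fin normal_pdf_ge0.
- by rewrite lee_fin normal_pdf_ge0.
by apply: eq_integral => u _; rewrite /K/= -muleA -EFinM (normal_pdf_mul _ _ _ _ _ dE).
Qed.

End gauss2.

Section tame.
Context {R : realType}.
Implicit Types (H : R -> R).

(** What the comparison of two scales uses of the Gaussian density (p true) and of
its tail (p false): increments that decay away from the origin, and, where H is
multiplied by the inverse of the scale, decay of H itself. *)
Definition tame (p : bool) H (K : R) : Prop :=
  (forall m a b, 0 <= m -> a <= b -> away m a b ->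
     `|H a - H b| <= K * (b - a) / (1 + m ^+ 2) ^+ 2) /\
  (p -> forall a, H a <= K / (1 + a ^+ 2)).

Lemma tame_lip p H K a b : tame p H K -> `|H a - H b| <= K * `|a - b|.
Proof.
move=> [tH _]; wlog ab : a b / a <= b.
  move=> W; have [|/ltW] := leP a b; first exact: W.
  by move=> /W; rewrite distrC (distrC b).
have aw : away 0 a b by move=> v _.
have := tH 0 a b (lexx 0) ab aw.
by rewrite expr0n addr0 expr1n divr1 (distrC a b) (ger0_norm (_ : 0 <= b - a)) ?subr_ge0.
Qed.

Lemma Ph01 (u : R) : 0 <= Ph u <= 1. Proof. by rewrite Ph_ge0 Ph_le1. Qed.
Lemma gphi01 (u : R) : 0 <= gphi u <= 1. Proof. by rewrite gphi_ge0 gphi_le1. Qed.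

Lemma tame_gphi : tame true (@gphi R) (8 ^+ 4).
Proof.
split; first by move=> m a b; exact: gphi_lip.
move=> _ a; apply: le_trans (gphi_decay a) _.
have a2 : 0 <= a ^+ 2 by exact: sqr_ge0.
apply: ler_wpM2l; first exact: exprn_ge0.
have p1 : 1 <= 1 + a ^+ 2 by rewrite lerDl.
have p0 : 0 < 1 + a ^+ 2 by exact: lt_le_trans p1.
by rewrite lef_pV2 ?posrE ?exprn_gt0// ler_eXnr.
Qed.

Lemma tame_Ph : tame false (@Ph R) (8 ^+ 4).
Proof. by split => // m a b; exact: Ph_lip. Qed.

Lemma continuous_Ph : continuous (@Ph R).
Proof.
have K0 : 0 < 8 ^+ 4 :> R by rewrite exprn_gt0.
move=> z; apply/cvgrPdist_le => e e0.
near=> y; apply: le_trans (tame_lip z y tame_Ph) _.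
rewrite -ler_pdivlMl//; near: y.
by apply: cvgr_dist_le; [exact: cvg_id|rewrite mulr_gt0// invr_gt0].
Unshelve. all: by end_near.
Qed.

Lemma measurable_Ph : measurable_fun setT (@Ph R).
Proof. by apply: continuous_measurable_fun; exact: continuous_Ph. Qed.

End tame.

(** * Independence of the increments of Brownian motion *)

Lemma normal_prob_affine (R : realType) (m v a c : R) (U : set R) :
  0 < v -> 0 < a -> measurable U ->
  normal_prob (a * m + c) (a * v) U = normal_prob m v [set u | U (a * u + c)].
Proof.
move=> v0 a0 mU.
have mh : measurable_fun setT (fun u : R => a * u + c) by exact: measurable_funD.
have mU' : measurable [set u | U (a * u + c)].
  by rewrite -[X in measurable X]setTI; exact: (mh measurableT U mU).
rewrite (normal_prob_scale _ (mulr_gt0 a0 v0) mU) (normal_prob_scale _ v0 mU').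
congr (normal_prob 0 1 _); apply/seteqP; split => u /=;
  by rewrite (_ : a * (v * u + m) + c = a * v * u + (a * m + c))//; ring.
Qed.

Section grid.
Context d (T : measurableType d) (R : realType) (P : probability T R).
Variables (B : R -> T -> R) (hB : standard_brownian P B).

Definition incr (t : nat -> R) (i : nat) (w : T) : R := B (t i.+1) w - B (t i) w.

(** Events described by finitely many increments, none of index in [M].  The bound
[N] keeps the description finite; as [A] is trivial beyond it, [N] can be
enlarged, which puts two such events on the same footing. *)
Definition cylinder (t : nat -> R) (M : set nat) : set (set T) :=
  [set E | exists N (A : nat -> set R),
    [/\ forall i, measurable (A i), forall i, M i -> A i = setT,
        forall i, (N <= i)%N -> A i = setT &
        E = \bigcap_(i in `I_N) [set w | A i (incr t i w)]]].

Variable t : nat -> R.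
Hypotheses (t0 : 0 <= t 0%N) (tle : {homo t : i j / (i <= j)%N >-> i <= j}).

Let t_ge0 i : 0 <= t i. Proof. by apply: le_trans t0 (tle _). Qed.

Lemma measurable_incr i : measurable_fun setT (incr t i).
Proof. by case: hB => mB _ _ _ _; apply: measurable_funB; exact: mB. Qed.

Lemma cylinder_pad N N' (A : nat -> set R) : (N <= N')%N ->
  (forall i, (N <= i)%N -> A i = setT) ->
  \bigcap_(i in `I_N) [set w | A i (incr t i w)] =
  \bigcap_(i in `I_N') [set w | A i (incr t i w)].
Proof.
move=> NN' AT; apply/seteqP; split => w H i /= iN.
  by have [iN2|/AT ->//] := ltnP i N; exact: H.
by apply: H => /=; exact: leq_trans iN NN'.
Qed.

Lemma cylinder_setI M : setI_closed (cylinder t M).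
Proof.
move=> _ _ [N [A [mA MA NA ->]]] [N' [A' [mA' MA' NA' ->]]].
exists (maxn N N'), (fun i => A i `&` A' i); split.
- by move=> i; exact: measurableI.
- by move=> i Mi; rewrite MA// MA'// setTI.
- by move=> i; rewrite geq_max => /andP[? ?]; rewrite NA// NA'// setTI.
rewrite (cylinder_pad (leq_maxl N N') NA) (cylinder_pad (leq_maxr N N') NA').
by rewrite -bigcapI.
Qed.

Lemma cylinder_measurable M : cylinder t M `<=` measurable.
Proof.
move=> _ [N [A [mA _ _ ->]]]; apply: fin_bigcap_measurable => // i _.
by rewrite -[X in measurable X]setTI; exact: (measurable_incr i measurableT (mA i)).
Qed.

Lemma scylinder_measurable M : <<s cylinder t M >> `<=` measurable.
Proof.
apply: smallest_sub; [exact: sigma_algebra_measurable|exact: cylinder_measurable].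
Qed.

Lemma cylinder_sub M M' : M `<=` M' -> cylinder t M' `<=` cylinder t M.
Proof.
move=> MM' E [N [A [mA MA NA EE]]]; exists N, A; split=> // i Mi.
by apply: MA; exact: MM'.
Qed.

Lemma measurable_incr_cylinder M i : ~ M i ->
  measurable_fun setT (incr t i : g_sigma_algebraType (cylinder t M) -> R).
Proof.
move=> Mi _ U mU; rewrite setTI; apply: sub_sigma_algebra.
exists i.+1, (fun l => if l == i then U else setT); split.
- by move=> l; case: ifP.
- by move=> l Ml; case: ifPn => // /eqP li; rewrite li in Ml.
- by move=> l il; rewrite gtn_eqF.
apply/seteqP; split => w /=.
  by move=> H l _ /=; case: ifPn => // /eqP ->.
by move=> /(_ i); rewrite /= eqxx; apply.
Qed.

(** Both sides are finite measures in [E], and cylinders form a pi-system.  On a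
cylinder the claim compares the product rule for the increments with and without
the constraint [C] in position [m]. *)
Lemma cylinder_indep m E C : <<s cylinder t [set m] >> E -> measurable C ->
  P (E `&` incr t m @^-1` C) = (P E * P (incr t m @^-1` C))%E.
Proof.
move=> sE mC.
have mD : measurable (incr t m @^-1` C).
  by rewrite -[X in measurable X]setTI; exact: (measurable_incr m measurableT mC).
set D := incr t m @^-1` C.
pose k : {nonneg R} := NngNum (fine_ge0 (measure_ge0 P D)).
have kE : (k%:num%:E = P D)%E by rewrite /= fineK// fin_num_measure.
rewrite muleC -kE.
apply: (@g_sigma_algebra_measure_unique _ _ _ (cylinder t [set m]) _ (fun=> setT) _ _
  (mrestr P mD) (mscale k P)) => //.
- exact: cylinder_measurable.
- by move=> _; exists 0%N, (fun=> setT); split => //; apply/seteqP; split.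
- by apply/seteqP; split => // x _; exists 0%N.
- exact: cylinder_setI.
- move=> _ [N [A [mA MA NA ->]]].
  transitivity (P (\bigcap_(i in `I_N) [set w | A i (incr t i w)]) * P D)%E;
    last by rewrite muleC -kE.
  rewrite /mrestr.
  rewrite (cylinder_pad (leq_maxl N m.+1) NA).
  set N' := maxn N m.+1.
  have mN' : (m < N')%N by rewrite leq_max ltnSn orbT.
  pose A' i := if i == m then C else A i.
  have AA' : \bigcap_(i in `I_N') [set w | A i (incr t i w)] `&` D =
            \bigcap_(i in `I_N') [set w | A' i (incr t i w)].
    apply/seteqP; split => w /=.
      by move=> [H Dw] i /= iN; rewrite /A'; case: ifPn => [/eqP ->//|_]; exact: H.
    move=> H; split => [i /= iN|].
      have [->|im] := eqVneq i m; first by rewrite MA.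
      by have := H i iN; rewrite /A'/= (negbTE im).
    by have := H m mN'; rewrite /A'/= eqxx.
  transitivity (P (\bigcap_(i in `I_N') [set w | A' i (incr t i w)])).
    by congr (P _); exact: AA'.
  case: hB => _ _ _ prodB _.
  have mA' i : measurable (A' i) by rewrite /A'; case: ifP.
  rewrite (prodB N' t A t0 tle mA) (prodB N' t A' t0 tle mA').
  rewrite (bigD1 (Ordinal mN'))//= [in RHS](bigD1 (Ordinal mN'))//=.
  rewrite {1}/A' eqxx (MA m erefl).
  have -> : P [set w | [set: R] (B (t m.+1) w - B (t m) w)] = 1%E.
    by rewrite -[RHS](probability_setT P); congr (P _); apply/seteqP.
  rewrite mul1e muleC; congr (_ * _)%E.
  apply: eq_bigr => i im; rewrite /A'.
  by rewrite -val_eqE/= in im; rewrite (negbTE im).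
- move=> _; apply: (@le_lt_trans _ _ 1%E); last exact: ltry.
  by apply: probability_le1; exact: measurableI.
Qed.

End grid.

(** * The bridge between two observations *)

Section bridge.
Context d (T : measurableType d) (R : realType) (P : probability T R).
Variables (B : R -> T -> R) (hB : standard_brownian P B).
Variables (n j : nat) (s : R).
Hypothesis n0 : (0 < n)%N.
Hypothesis js : j%:R / n%:R < s < j.+1%:R / n%:R.

(** The observation grid with the time [s] inserted between j/n and (j+1)/n. *)
Definition refined_grid (i : nat) : R :=
  if (i <= j)%N then i%:R / n%:R else if i == j.+1 then s else i.-1%:R / n%:R.
Local Notation t := refined_grid.

Let nR0 : 0 < n%:R :> R. Proof. by rewrite ltr0n. Qed.

Lemma refined_grid0 : t 0%N = 0.
Proof. by rewrite /t leq0n mul0r. Qed.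

Lemma refined_grid_homo : {homo t : i k / (i <= k)%N >-> i <= k}.
Proof.
case/andP: js => js1 js2.
apply: homo_leq => [x|x y z|i]; [exact: lexx|exact: le_trans|].
have Hle (a b : nat) : (a <= b)%N -> a%:R / n%:R <= b%:R / n%:R :> R.
  by move=> ab; rewrite ler_pM2r ?invr_gt0// ler_nat.
rewrite /t; case: (ltngtP i j) => [ij|ij|->].
- by apply: Hle.
- rewrite eqSS (gtn_eqF ij).
  case: eqP => [->|_]; first by rewrite /= (le_trans (ltW js2)).
  by apply: Hle; case: (i) ij.
- by rewrite eqxx ltW.
Qed.

Let t_ge0 : 0 <= t 0%N. Proof. by rewrite refined_grid0. Qed.

Lemma refined_gridj : t j = j%:R / n%:R. Proof. by rewrite /t leqnn. Qed.
Lemma refined_gridj1 : t j.+1 = s. Proof. by rewrite /t ltnn eqxx. Qed.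
Lemma refined_gridj2 : t j.+2 = j.+1%:R / n%:R.
Proof. by rewrite /t ltnNge leqnSn/= eqSS gtn_eqF. Qed.

(** The two increments into which [s] splits the increment over the cell. *)
Definition cell_ends : set nat := [set i | i = j \/ i = j.+1].
Local Notation S2 := (cylinder B t cell_ends).
Local Notation T2 := (g_sigma_algebraType S2).

Lemma cell_id_measurable M : M `<=` cell_ends ->
  measurable_fun setT (id : g_sigma_algebraType (cylinder B t M) -> T2).
Proof.
move=> MC _ A mA; rewrite setTI preimage_id.
by apply: sub_sigma_algebra2 mA; exact: cylinder_sub.
Qed.

Lemma cell_id_measurableT : measurable_fun setT (id : T -> T2).
Proof.
move=> _ A mA; rewrite setTI preimage_id.
exact: (scylinder_measurable hB t_ge0 refined_grid_homo mA).
Qed.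

Local Notation al := (Num.sqrt (s - j%:R / n%:R)).
Local Notation be := (Num.sqrt (j.+1%:R / n%:R - s)).
Local Notation D1 := (incr B t j).
Local Notation D2 := (incr B t j.+1).

(** [freezing] applied twice: first to the second half of the cell, everything
else being frozen, then to the first half. *)
Lemma two_increments (Psi : T2 * measurableTypeR R * measurableTypeR R -> \bar R) :
  measurable_fun setT Psi -> (forall z, 0 <= Psi z)%E ->
  (\int[P]_w Psi (w, D1 w, D2 w) =
   \int[P]_w \int[normal_prob 0 al]_u \int[normal_prob 0 be]_v Psi (w, u, v))%E.
Proof.
move=> mPsi Psi0.
have t0 := t_ge0; have th := refined_grid_homo.
have [js1 js2] := andP js.
case: (hB) => _ _ _ _ lawB.
have s0 : 0 <= s by rewrite (le_trans _ (ltW js1))// divr_ge0.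
pose Ga := cylinder B t [set j.+1]; pose Gb := cylinder B t [set j].
have ida : measurable_fun setT (id : g_sigma_algebraType Ga -> T2).
  by apply: cell_id_measurable => i ->; right.
have idb : measurable_fun setT (id : g_sigma_algebraType Gb -> T2).
  by apply: cell_id_measurable => i ->; left.
pose fa (z : g_sigma_algebraType Ga * measurableTypeR R) :=
  Psi ((z.1 : T2), D1 z.1, z.2).
have mfa : measurable_fun setT fa.
  apply: measurableT_comp => //; apply: measurable_fun_pair => //.
  apply: measurable_fun_pair.
    exact: (measurableT_comp ida (@measurable_fst _ _ _ _)).
  have m1 : measurable_fun setT (D1 : g_sigma_algebraType Ga -> R).
    by apply: measurable_incr_cylinder => /= /eqP; rewrite ltn_eqF.
  exact: (measurableT_comp m1 (@measurable_fst _ _ _ _)).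
rewrite (@freezing _ _ _ P Ga _ D2 (normal_prob 0 be) fa _ _ mfa); last 4 first.
- exact: (scylinder_measurable hB t0 th).
- exact: (measurable_incr hB t0 th).
- move=> E C sE mC; rewrite (cylinder_indep hB t0 th sE mC); congr (_ * _)%E.
  by rewrite /incr refined_gridj2 refined_gridj1; apply: lawB.
- by move=> z; exact: Psi0.
pose fb (z : g_sigma_algebraType Gb * measurableTypeR R) :=
  (\int[normal_prob 0 be]_v Psi ((z.1 : T2), z.2, v))%E.
have mfb : measurable_fun setT fb.
  have := measurable_fun_fubini_tonelli_F (m2 := normal_prob 0 be) Psi mPsi Psi0.
  move=> mF; apply: (measurableT_comp mF).
  apply: measurable_fun_pair => //.
  exact: (measurableT_comp idb (@measurable_fst _ _ _ _)).
rewrite -[LHS]/(\int[P]_w fb (w, D1 w))%E.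
have Gbm : <<s Gb >> `<=` measurable by exact: (scylinder_measurable hB t0 th).
have mD1 : measurable_fun setT D1 by exact: (measurable_incr hB t0 th).
have ind1 E C : <<s Gb >> E -> measurable C ->
    P (E `&` D1 @^-1` C) = (P E * normal_prob 0 al C)%E.
  move=> sE mC; rewrite (cylinder_indep hB t0 th sE mC); congr (_ * _)%E.
  by rewrite /incr refined_gridj refined_gridj1; apply: lawB => //; rewrite divr_ge0.
have fb0 z : (0 <= fb z)%E by exact: integral_ge0.
exact: (@freezing _ _ _ P Gb Gbm D1 (normal_prob 0 al) fb mD1 ind1 mfb fb0).
Qed.

Local Notation r := (n%:R * s - j%:R).
Local Notation ga := (Num.sqrt (r * (1 - r)) / Num.sqrt n%:R).
Local Notation Delta w := (B (j.+1%:R / n%:R) w - B (j%:R / n%:R) w).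

Lemma cell_r : 0 < r < 1.
Proof.
case/andP: js; rewrite ltr_pdivrMr// ltr_pdivlMr// -natr1 => H1 H2; lra.
Qed.

Let sqr_al : al ^+ 2 = s - j%:R / n%:R.
Proof. by rewrite sqr_sqrtr// subr_ge0 ltW//; case/andP: js. Qed.
Let sqr_be : be ^+ 2 = j.+1%:R / n%:R - s.
Proof. by rewrite sqr_sqrtr// subr_ge0 ltW//; case/andP: js. Qed.

(** The two halves of the cell are independent normal variables, so
[gauss_rotation] gives the law of the first half given the whole increment. *)
Lemma increments_bridge (Phi : T2 * measurableTypeR R * measurableTypeR R -> \bar R) :
  measurable_fun setT Phi -> (forall z, 0 <= Phi z)%E ->
  (\int[P]_w Phi (w, Delta w, D1 w) =
   \int[P]_w \int[normal_prob (r * Delta w) ga]_u Phi (w, Delta w, u))%E.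
Proof.
move=> mPhi Phi0; have [js1 js2] := andP js; have /andP[r0 r1] := cell_r.
have al0 : 0 < al by rewrite sqrtr_gt0 subr_gt0.
have be0 : 0 < be by rewrite sqrtr_gt0 subr_gt0.
pose de : R := (Num.sqrt n%:R)^-1.
have sn0 : 0 < Num.sqrt n%:R :> R by rewrite sqrtr_gt0.
have de0 : 0 < de by rewrite invr_gt0.
have de2 : de ^+ 2 = n%:R^-1 by rewrite exprVn sqr_sqrtr// ler0n.
(* al, be and de are the standard deviations of the two halves and of the
   whole increment; their ratios are the coefficients of the bridge. *)
have deE : de ^+ 2 = al ^+ 2 + be ^+ 2.
  by rewrite de2 sqr_al sqr_be -natr1; field; rewrite gt_eqF.
have rE : al ^+ 2 / de ^+ 2 = r.
  by rewrite sqr_al de2; field; rewrite gt_eqF.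
have gaE : al * be / de = ga.
  rewrite -sqrtrM ?subr_ge0 ?ltW//.
  have -> : (s - j%:R / n%:R) * (j.+1%:R / n%:R - s) = (r * (1 - r)) / (n%:R ^+ 2).
    by rewrite -natr1; field; rewrite gt_eqF.
  rewrite sqrtrM; last by apply: mulr_ge0; [exact: ltW|rewrite subr_ge0 ltW].
  rewrite -exprVn sqrtr_sqr ger0_norm ?invr_ge0 ?ler0n// -mulrA; congr (_ * _).
  rewrite /de invrK -[X in X^-1 * _](@sqr_sqrtr R) ?ler0n//.
  by field; rewrite gt_eqF.
have ga0 : 0 < ga by rewrite -gaE divr_gt0// mulr_gt0.
have DD w : Delta w = D1 w + D2 w.
  rewrite /incr refined_gridj refined_gridj1 refined_gridj2; ring.
pose Phi' (x : T2 * measurableTypeR R) : \bar R :=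
  (\int[normal_prob (r * x.2) ga]_u Phi (x, u))%E.
have mPhi' : measurable_fun setT Phi'.
  have : measurable_fun setT (fun z : T2 * measurableTypeR R * measurableTypeR R =>
      (Phi z * (normal_pdf (r * z.1.2) ga z.2)%:E)%E).
    apply: emeasurable_funM => //; apply/measurable_EFinP.
    apply: measurable_normal_pdf_pair => //; apply: measurable_funM => //.
    by apply: measurableT_comp.
  move=> /(measurable_fun_fubini_tonelli_F (m2 := @lebesgue_measure R)) H.
  apply: eq_measurable_fun (H _) => [z _|y].
    by rewrite /fubini_F/= /Phi' normal_integral//; exact: measurableT_comp.
  by rewrite mule_ge0// lee_fin normal_pdf_ge0.
have Phi'0 x : (0 <= Phi' x)%E by exact: integral_ge0.
have mshift : measurable_fun setT (fun z : T2 * measurableTypeR R * measurableTypeR R =>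
    (z.1.1, (z.1.2 + z.2)%R : measurableTypeR R)).
  apply: measurable_fun_pair; first exact: measurableT_comp.
  by apply: measurable_funD => //; exact: measurableT_comp.
have mshift2 : measurable_fun setT (fun z : T2 * measurableTypeR R * measurableTypeR R =>
    (z.1.1, (z.1.2 + z.2)%R : measurableTypeR R, z.1.2)).
  by apply: measurable_fun_pair => //; exact: measurableT_comp.
have mpair1 (w : T2) : measurable_fun setT
    (fun y : measurableTypeR R * measurableTypeR R => (w, y.1)).
  by apply: measurable_fun_pair.
have mpair2 (w : T2) : measurable_fun setT
    (fun y : measurableTypeR R * measurableTypeR R => (w, y.1, y.2)).
  by apply: measurable_fun_pair.
transitivity (\int[P]_w \int[normal_prob 0 de]_z Phi' (w, z))%E.
  under eq_integral do rewrite DD.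
  have m1 := measurableT_comp mPhi mshift2.
  refine (etrans (two_increments m1 (fun z => Phi0 _)) _).
  apply: eq_integral => w _ /=.
  have := @gauss_rotation R al be de (fun y => Phi (w, y.1, y.2)) al0 be0 de0 deE.
  rewrite /= rE gaE; apply => //.
  exact: (measurableT_comp mPhi (mpair2 w)).
under [RHS]eq_integral do rewrite DD.
rewrite -[RHS]/(\int[P]_w Phi' (w, (D1 w + D2 w)%R))%E.
have m1 := measurableT_comp mPhi' mshift.
refine (etrans _ (esym (two_increments m1 (fun z => Phi'0 _)))).
apply: eq_integral => w _ /=.
have H := gauss_rotation al0 be0 de0 deE (measurableT_comp mPhi' (mpair1 w))
  (fun y => Phi'0 _).
refine (etrans _ (esym H)).
apply: eq_integral => z _; apply/esym.
exact (integral_prob_cst (normal_prob (al ^+ 2 / de ^+ 2 * z) (al * be / de)) (Phi' (w, z))).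
Qed.

End bridge.

Section bridge_obs.
Context d (T : measurableType d) (R : realType) (P : probability T R).
Variables (B : R -> T -> R) (hB : standard_brownian P B).
Variables (mu sigma : R) (sigma0 : 0 < sigma).
Local Notation X := (linear_brownian mu sigma B).
Variables (n j : nat) (s : R).
Hypothesis n0 : (0 < n)%N.
Hypothesis js : j%:R / n%:R < s < j.+1%:R / n%:R.

Local Notation t := (refined_grid n j s).
Local Notation T2 := (g_sigma_algebraType (cylinder B t (cell_ends j))).
Local Notation r := (n%:R * s - j%:R).
Local Notation Delta w := (B (j.+1%:R / n%:R) w - B (j%:R / n%:R) w).
Local Notation D1 := (incr B t j).

Lemma refined_grid_gt k : (j < k)%N -> t k.+1 = k%:R / n%:R.
Proof. by move=> jk; rewrite /refined_grid ltnNge (ltnW jk)/= eqSS gtn_eqF. Qed.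

(** By induction on k, passing the cell without adding its increment. *)
Lemma grid_off_cell_measurable k : measurable_fun setT
  ((fun w => B (k%:R / n%:R) w - (if (j < k)%N then Delta w else 0)) : T2 -> R).
Proof.
have [_ B0 _ _ _] := hB.
elim: k => [|k IH].
  under eq_fun do rewrite mul0r B0 subr0; exact: measurable_cst.
have [kj|jk|kj] := ltngtP k j.
- have -> : (fun w : T2 => B (k.+1%:R / n%:R) w - (if (j < k.+1)%N then Delta w else 0)) =
    (fun w => (B (k%:R / n%:R) w - (if (j < k)%N then Delta w else 0)) + incr B t k w).
    apply/funext => w; rewrite ltnS leqNgt kj (ltnNge j k) (ltnW kj)/= !subr0.
    by rewrite /incr /refined_grid (ltnW kj) kj; ring.
  apply: measurable_funD => //; apply: measurable_incr_cylinder.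
  by case=> kE; move: kj; rewrite kE ?ltnn// ltnNge leqnSn.
- have -> : (fun w : T2 => B (k.+1%:R / n%:R) w - (if (j < k.+1)%N then Delta w else 0)) =
    (fun w => (B (k%:R / n%:R) w - (if (j < k)%N then Delta w else 0)) + incr B t k.+1 w).
    apply/funext => w; rewrite ltnS (ltnW jk) jk.
    by rewrite /incr !refined_grid_gt// ?ltnS ?(ltnW jk)//; ring.
  apply: measurable_funD => //; apply: measurable_incr_cylinder.
  case=> kE; move: jk; first by rewrite -kE ltnNge leqnSn.
  by case: kE => ->; rewrite ltnn.
- subst k; have -> : (fun w : T2 => B (j.+1%:R / n%:R) w - (if (j < j.+1)%N then Delta w else 0)) =
    (fun w => (B (j%:R / n%:R) w - (if (j < j)%N then Delta w else 0))).
    by apply/funext => w; rewrite ltnSn ltnn; ring.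
  exact: IH.
Qed.

(** An observable event sees the two halves of the cell only through their sum, so
that [increments_bridge] applies to its indicator. *)
Lemma observations_factor A : observations X n A ->
  exists2 A' : set (T2 * measurableTypeR R), measurable A' &
    A = (fun w => (w : T2, Delta w)) @^-1` A'.
Proof.
pose phi w : T2 * measurableTypeR R := (w : T2, Delta w).
suff : observations X n `<=` preimage_set_system setT phi measurable.
  by move=> H /H [A' mA' <-]; exists A' => //; rewrite setTI.
apply: smallest_sub.
  by apply: sigma_algebra_preimage; exact: sigma_algebra_measurable.
move=> _ [i [U [mU ->]]].
pose f (z : T2 * measurableTypeR R) : R := mu * (i.+1%:R / n%:R) + sigma *
  ((B (i.+1%:R / n%:R) z.1 - (if (j < i.+1)%N then Delta z.1 else 0)) +
   (if (j < i.+1)%N then z.2 else 0)).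
have mf : measurable_fun setT f.
  apply: measurable_funD => //; apply: measurable_funM => //.
  apply: measurable_funD.
    exact: (measurableT_comp (grid_off_cell_measurable i.+1) (@measurable_fst _ _ _ _)).
  case: (j < i.+1)%N; [exact: measurable_snd|exact: measurable_cst].
exists (f @^-1` U); first by rewrite -[X in measurable X]setTI; exact: mf.
rewrite setTI; apply/seteqP; split => w /=;
  by rewrite /f /linear_brownian/=; case: ifP => _; rewrite ?subr0 ?addr0 ?subrK.
Qed.

(** The observations outside the cell are frozen by [observations_factor], and
[increments_bridge] gives the law of the first half of the cell. *)
Lemma bridge A U : observations X n A -> measurable U ->
  P (A `&` [set w | U (X s w)]) =
  (\int[P]_(w in A) normal_prob
     (X (j%:R / n%:R) w + r * (X (j.+1%:R / n%:R) w - X (j%:R / n%:R) w))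
     (sigma / Num.sqrt n%:R * Num.sqrt (r * (1 - r))) U)%E.
Proof.
move=> /observations_factor[A' mA' AE] mU.
have /andP[r0 r1] := cell_r n0 js.
have [js1 js2] := andP js.
have nR0 : 0 < n%:R :> R by rewrite ltr0n.
have s0 : 0 <= s by rewrite (le_trans _ (ltW js1))// divr_ge0.
have [mB B0 _ _ _] := hB.
have mA : measurable A.
  rewrite AE -[X in measurable X]setTI.
  suff : measurable_fun setT (fun w : T => (w : T2, Delta w)) by apply.
  apply: measurable_fun_pair; first exact: (cell_id_measurableT hB n0 js).
  by apply: measurable_funB; apply: mB; rewrite divr_ge0.
have mXs : measurable [set w | U (X s w)].
  rewrite -[X in measurable X]setTI.
  suff : measurable_fun setT (X s) by apply.
  by apply: measurable_funD => //; apply: measurable_funM => //; exact: mB.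
(* the part of X s that is frozen with the cell *)
pose c w := mu * s + sigma * B (j%:R / n%:R) w.
have mc : measurable_fun setT (c : T2 -> R).
  apply: measurable_funD => //; apply: measurable_funM => //.
  by have := grid_off_cell_measurable j; rewrite ltnn; under eq_fun do rewrite subr0.
pose Phi (z : T2 * measurableTypeR R * measurableTypeR R) : \bar R :=
  (\1_A' z.1 * \1_U (sigma * z.2 + c z.1.1))%:E.
have mPhi : measurable_fun setT Phi.
  have m1 : measurable_fun setT (\1_A' : _ -> R) by exact: measurable_indic.
  have m2 : measurable_fun setT (\1_U : _ -> R) by exact: measurable_indic.
  apply/measurable_EFinP/measurable_funM.
    exact: (measurableT_comp m1 (@measurable_fst _ _ _ _)).
  apply: (measurableT_comp m2).
  apply: measurable_funD; first exact: measurable_funM.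
  apply: (measurableT_comp mc).
  exact: (measurableT_comp (@measurable_fst _ _ _ _) (@measurable_fst _ _ _ _)).
have Phi0 z : (0 <= Phi z)%E by rewrite lee_fin mulr_ge0.
have H := increments_bridge hB n0 js mPhi Phi0.
transitivity (\int[P]_w Phi (w : T2, Delta w, D1 w))%E.
  transitivity (\int[P]_w (\1_(A `&` [set w | U (X s w)]) w)%:E)%E.
    by rewrite integral_indic ?setIT//; exact: measurableI.
  apply: eq_integral => w _; rewrite /Phi/= indicI/=; congr ((_ * _)%:E).
    by rewrite AE !indicE.
  have XE : sigma * D1 w + c w = X s w.
    by rewrite /incr refined_gridj refined_gridj1 /c /linear_brownian; ring.
  by rewrite XE !indicE; congr (nat_of_bool _)%:R; apply/idP/idP; rewrite !inE.
refine (etrans H _).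
rewrite [RHS]integral_mkcond; apply: eq_integral => w _; rewrite patchE.
have ga0 : 0 < Num.sqrt (r * (1 - r)) / Num.sqrt n%:R.
  by apply: divr_gt0; rewrite sqrtr_gt0 ?ltr0n//; apply: mulr_gt0 => //; rewrite subr_gt0.
have -> : X (j%:R / n%:R) w + r * (X (j.+1%:R / n%:R) w - X (j%:R / n%:R) w) =
    sigma * (r * Delta w) + c w.
  rewrite /c /linear_brownian -natr1; field; rewrite gt_eqF//.
have -> : sigma / Num.sqrt n%:R * Num.sqrt (r * (1 - r)) =
    sigma * (Num.sqrt (r * (1 - r)) / Num.sqrt n%:R) by rewrite -mulrA (mulrC _^-1).
rewrite normal_prob_affine//.
set m := r * Delta w; set v := Num.sqrt (r * (1 - r)) / Num.sqrt n%:R.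
have mV : measurable [set u | U (sigma * u + c w)].
  rewrite -[X in measurable X]setTI.
  suff : measurable_fun setT (fun u => sigma * u + c w) by apply.
  exact: measurable_funD.
transitivity (\int[normal_prob m v]_u ((\1_A' ((w : T2), Delta w))%:E *
    (\1_[set u | U (sigma * u + c w)] u)%:E))%E.
  by apply: eq_integral => u _; rewrite -EFinM.
rewrite ge0_integralZl//; last by apply/measurable_EFinP; exact: measurable_indic.
rewrite integral_indic// setIT AE; case: ifPn.
  by rewrite inE/= => wA; rewrite indicE mem_set// mul1e.
by rewrite notin_setE/= => wA; rewrite indicE memNset// mul0e.
Qed.

End bridge_obs.

(** * Integrability of the inverse standard deviation of the bridge *)

Section isq.
Context {R : realType}.
Notation lam := (@lebesgue_measure R).

Lemma measurable_inv : measurable_fun [set: R] (fun x : R => x^-1).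
Proof.
rewrite -(setvU [set 0]) measurable_funU//; last exact: measurableC.
split; last exact: measurable_fun_set1.
apply: open_continuous_measurable_fun.
  by rewrite openC; exact: closed_eq.
by move=> x; rewrite inE/= => /eqP x0; exact: inv_continuous.
Qed.

Lemma measurable_sqrt : measurable_fun [set: R] (@Num.sqrt R).
Proof. by apply: continuous_measurable_fun; exact: sqrt_continuous. Qed.

(** Vanishes for y <= 0, as [Num.sqrt] does. *)
Definition isq (y : R) : R := (Num.sqrt y)^-1.

Lemma isq_ge0 y : 0 <= isq y. Proof. by rewrite invr_ge0 sqrtr_ge0. Qed.

Lemma measurable_isq : measurable_fun [set: R] isq.
Proof. exact: (measurableT_comp measurable_inv measurable_sqrt). Qed.

Lemma integral_isq01 : (\int[lam]_(x in `[0%R, 1%R]) (isq x)%:E <= 2%:E)%E.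
Proof.
have mi D : measurable_fun D (EFin \o isq).
  by apply/measurable_EFinP/measurable_funTS; exact: measurable_isq.
rewrite -integral_itv_obnd_cbnd; last exact: mi.
pose F m : set R := `[m.+1%:R^-1, 1]%classic.
have FE : `]0, 1]%classic = \bigcup_m F m.
  apply/seteqP; split => x /=; rewrite in_itv/=.
    move=> /andP[x0 x1]; exists (Num.truncn x^-1) => //.
    rewrite /F/= in_itv/= x1 andbT invf_ple ?posrE//.
    by apply/ltW/truncnS_gt.
  by case=> m _ /=; rewrite /F/= in_itv/= => /andP[mx ->]; rewrite (lt_le_trans _ mx).
rewrite FE.
have /cvg_lim <- // : (\int[lam]_(x in F m) (isq x)%:E)%E @[m --> \oo] -->
    (\int[lam]_(x in \bigcup_m F m) (isq x)%:E)%E.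
  apply: ge0_nondecreasing_set_cvg_integral => //.
  - move=> m p mp; apply/subsetPset => x; rewrite /F/= !in_itv/= => /andP[mx ->].
    by rewrite andbT (le_trans _ mx)// lef_pV2 ?posrE// ler_nat.
  - by move=> i; exact: measurable_itv.
  - by move=> i; exact: mi.
  - by move=> i x _; rewrite lee_fin isq_ge0.
have bound m : (\int[lam]_(x in F m) (isq x)%:E <= 2%:E)%E.
  have [m0|m1] := ltP (m.+1%:R^-1 : R) 1; last first.
    rewrite /F; move: m1; rewrite le_eqVlt => /predU1P[<-|m1].
      by rewrite set_itv1 integral_set1.
    by rewrite set_itv_ge ?integral_set0// bnd_simp -ltNge.
  have mp : 0 < (m.+1%:R^-1 : R) by [].
  rewrite (@continuous_FTC2 _ isq (fun x => 2 * Num.sqrt x) _ _ m0).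
  - rewrite -EFinB lee_fin sqrtr1 mulr1 gerBl mulr_ge0// sqrtr_ge0.
  - apply: continuous_in_subspaceT => x; rewrite inE/= in_itv/= => /andP[mx _].
    have x0 : 0 < x by exact: lt_le_trans mx.
    apply: (@continuous_comp _ _ _ (@Num.sqrt R)).
      exact: sqrt_continuous.
    by apply: inv_continuous; rewrite gt_eqF// sqrtr_gt0.
  - have cF : continuous (fun x : R => 2 * Num.sqrt x).
      by move=> x; apply: cvgM; [exact: cvg_cst|exact: sqrt_continuous].
    split.
    + move=> x; rewrite in_itv/= => /andP[mx _].
      have x0 : 0 < x by exact: lt_trans mx.
      by apply: derivableM => //; apply: ex_derive; exact: is_derive1_sqrt.
    + by apply: cvg_at_right_filter; exact: cF.
    + by apply: cvg_at_left_filter; exact: cF.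
  - move=> x; rewrite in_itv/= => /andP[mx _].
    have x0 : 0 < x by exact: lt_trans mx.
    have D := is_derive1_sqrt x0.
    have E : is_derive x 1 (fun y : R => 2 * Num.sqrt y) (isq x).
      apply: is_derive_eq; rewrite /GRing.scale/= /isq.
      by rewrite invfM mulrA divff ?mul1r.
    by rewrite derive1E (@derive_val _ _ _ _ _ _ _ E).
apply: lime_le.
  apply: ereal_nondecreasing_is_cvgn => m p mp; apply: ge0_subset_integral => //.
  - exact: measurable_itv.
  - exact: measurable_itv.
  - exact: mi.
  - by move=> x _; rewrite lee_fin isq_ge0.
  - move=> x; rewrite /F/= !in_itv/= => /andP[mx ->].
    by rewrite andbT (le_trans _ mx)// lef_pV2 ?posrE// ler_nat.
by apply: nearW.
Qed.

(** The bound does not depend on [b]: where the integrand exceeds 1 its argument is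
in ]0, 1], which contributes at most 2, and the rest contributes at most t. *)
Lemma integral_isq (a b t : R) : `|a| = 1 -> 0 <= t ->
  (\int[lam]_(s in `[0%R, t]) (isq (a * s + b))%:E <= (2 + t)%:E)%E.
Proof.
move=> a1 t0.
have a0 : a != 0 by rewrite -normr_gt0 a1.
pose g y : R := isq y * \1_(`[0, 1]%classic : set R) y.
have mg : measurable_fun setT g.
  by apply: measurable_funM; [exact: measurable_isq|exact: measurable_indic].
have g0 y : 0 <= g y by rewrite mulr_ge0 ?isq_ge0.
have mab : measurable_fun setT (fun s : R => a * s + b) by exact: measurable_funD.
have H y : isq y <= 1 + g y.
  rewrite /g indicE; case: (boolP (y \in _)) => /=; last first.
    rewrite mulr0 addr0 notin_setE/= in_itv/= => /negP; rewrite negb_and -!ltNge => /orP[] y1.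
      by rewrite /isq ler0_sqrtr ?ltW// invr0.
    rewrite /isq invf_le1 ?sqrtr_gt0 ?(lt_trans _ y1)//.
    by rewrite -[leLHS]sqrtr1 ler_sqrt ?ltW// (lt_trans _ y1).
  by rewrite mulr1 lerDr.
apply: (@le_trans _ _ (\int[lam]_(s in `[0%R, t]) (1%:E + (g (a * s + b))%:E))%E).
  apply: ge0_le_integral => //.
  - by move=> s _; rewrite lee_fin isq_ge0.
  - apply/measurable_EFinP/measurable_funTS.
    exact: (measurableT_comp measurable_isq mab).
  - apply: emeasurable_funD => //; apply/measurable_EFinP/measurable_funTS.
    exact: (measurableT_comp mg mab).
  - by move=> s _; rewrite -EFinD lee_fin H.
rewrite ge0_integralD//; last 2 first.
- by move=> s _; rewrite lee_fin.
- by apply/measurable_EFinP/measurable_funTS; exact: (measurableT_comp mg mab).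
rewrite EFinD addeC; apply: leeD; last first.
  apply: (@le_trans _ _ (1%:E * lam `[0%R, t]%classic)%E).
    by rewrite -integral_cst.
  by rewrite mul1e lebesgue_measure_itv/= lte_fin; case: ifP => _; rewrite ?oppr0 ?adde0 ?lee_fin.
apply: (@le_trans _ _ (\int[lam]_s (g (a * s + b))%:E)%E).
  apply: ge0_subset_integral => //.
  - by apply/measurable_EFinP; exact: (measurableT_comp mg mab).
  - by move=> s _; rewrite lee_fin.
have := @ge0_integral_affine R a b setT (EFin \o g) a0 measurableT.
rewrite preimage_setT a1 invr1 mul1e => ->//; last 2 first.
- exact/measurable_EFinP.
- by move=> s _; rewrite lee_fin.
apply: le_trans integral_isq01.
rewrite [leRHS]integral_mkcond; apply: eq_leW.
apply: eq_integral => y _; rewrite patchE /g/= indicE.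
by case: (y \in _); rewrite /= ?mulr1 ?mulr0.
Qed.

(** The inverse of the standard deviation at time r of the standard bridge over
[0, 1]; it vanishes outside ]0, 1[. *)
Definition kap (r : R) : R := (Num.sqrt (r * (1 - r)))^-1.

Lemma kap_ge0 r : 0 <= kap r. Proof. by rewrite invr_ge0 sqrtr_ge0. Qed.

Lemma measurable_kap : measurable_fun [set: R] kap.
Proof.
apply: (measurableT_comp measurable_inv); apply: (measurableT_comp measurable_sqrt).
by apply: measurable_funM => //; exact: measurable_funB.
Qed.

(** On ]0, 1[ this says that sqrt r + sqrt (1 - r) is at least 1. *)
Lemma kap_le_isq r : kap r <= isq r + isq (1 - r).
Proof.
have [/andP[r0 r1]|r01] := boolP (0 < r < 1); last first.
  rewrite /kap ler0_sqrtr ?invr0 ?addr_ge0 ?isq_ge0//.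
  by move: r01; rewrite negb_and -!leNgt => /orP[] ?; nra.
rewrite /kap /isq sqrtrM; last exact: ltW.
set a := Num.sqrt r; set b := Num.sqrt (1 - r).
have a0 : 0 < a by rewrite sqrtr_gt0.
have b0 : 0 < b by rewrite sqrtr_gt0 subr_gt0.
have a2 : a ^+ 2 = r by rewrite sqr_sqrtr// ltW.
have b2 : b ^+ 2 = 1 - r by rewrite sqr_sqrtr// subr_ge0 ltW.
have a1 : a <= 1 by rewrite -sqrtr1 ler_sqrt// ltW.
have b1 : b <= 1 by rewrite -sqrtr1 ler_sqrt//; lra.
have -> : a^-1 + b^-1 = (a * b)^-1 * (a + b) by field; rewrite !gt_eqF.
rewrite -[leLHS]mulr1 ler_wpM2l ?invr_ge0 ?mulr_ge0 ?(ltW a0) ?(ltW b0)//.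
nra.
Qed.

Lemma kap_ge1 r : 0 < r < 1 -> 1 <= kap r.
Proof.
move=> /andP[r0 r1]; rewrite /kap invf_ge1 ?sqrtr_gt0 ?mulr_gt0 ?subr_gt0//.
by rewrite -[leRHS]sqrtr1 ler_sqrt//; nra.
Qed.

Lemma integral_kap : (\int[lam]_(r in `[0%R, 1%R]) (kap r)%:E <= 6%:E)%E.
Proof.
have mi D : measurable_fun D (EFin \o isq).
  by apply/measurable_EFinP/measurable_funTS; exact: measurable_isq.
have mi' (D : set R) : measurable_fun D (fun r => (isq (1 - r))%:E).
  apply/measurable_EFinP/measurable_funTS.
  by apply: (measurableT_comp measurable_isq); exact: measurable_funB.
apply: (@le_trans _ _ (\int[lam]_(r in `[0%R, 1%R]) ((isq r)%:E + (isq (1 - r))%:E))%E).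
  apply: ge0_le_integral => //.
  - by move=> s _; rewrite lee_fin kap_ge0.
  - by apply/measurable_EFinP/measurable_funTS; exact: measurable_kap.
  - by apply: emeasurable_funD; [exact: mi|exact: mi'].
  - by move=> s _; rewrite -EFinD lee_fin kap_le_isq.
rewrite ge0_integralD//; last 4 first.
- by move=> s _; rewrite lee_fin isq_ge0.
- exact: mi.
- by move=> s _; rewrite lee_fin isq_ge0.
- exact: mi'.
rewrite (_ : 6 = (2 + 1) + (2 + 1)); last by ring.
rewrite EFinD; apply: leeD.
  apply: (le_trans _ (@integral_isq 1 0 1 (normr1 _) ler01)).
  apply: eq_leW.
  by apply: eq_integral => s _; rewrite mul1r addr0.
apply: (le_trans _ (@integral_isq (-1) 1 1 (normrN1 _) ler01)).
apply: eq_leW.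
by apply: eq_integral => s _; rewrite mulN1r addrC.
Qed.

End isq.

(** * Time integrals over the cells of the observation grid *)

Section cells.
Context {R : realType}.
Notation lam := (@lebesgue_measure R).

Definition cell (n : nat) (s : R) : nat := Num.truncn (n%:R * s).
Definition frac (n : nat) (s : R) : R := n%:R * s - (cell n s)%:R.

Lemma frac_itv n s : 0 <= s -> 0 <= frac n s < 1.
Proof.
move=> s0; have /andP[H1 H2] : (cell n s)%:R <= n%:R * s < (cell n s).+1%:R.
  by apply: truncn_itv; rewrite mulr_ge0.
by rewrite /frac subr_ge0 H1/= ltrBlDl natr1.
Qed.

Lemma cellP n k s : (0 < n)%N -> k%:R / n%:R <= s < k.+1%:R / n%:R ->
  cell n s = k /\ frac n s = n%:R * s - k%:R.
Proof.
move=> n0 /andP[H1 H2]; have nR0 : 0 < n%:R :> R by rewrite ltr0n.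
suff E : cell n s = k by rewrite /frac E.
apply: truncn_def; rewrite mulrC -ler_pdivrMr// H1/=.
by rewrite -ltr_pdivlMr.
Qed.

Lemma measurable_cell_set n k : measurable [set s : R | cell n s = k].
Proof.
have mn : measurable_fun setT (fun s : R => n%:R * s) by exact: measurable_funM.
have H (U : set R) : measurable U -> measurable ((fun s : R => n%:R * s) @^-1` U).
  by move=> mU; rewrite -[X in measurable X]setTI; exact: mn.
case: k => [|k].
  rewrite (_ : [set _ | _] = (fun s : R => n%:R * s) @^-1` `]-oo, 1[%classic).
    exact: H.
  apply/seteqP; split => s /=; rewrite in_itv/= /cell.
    by move=> E; have := truncnS_gt (n%:R * s); rewrite E.
  by move=> E; apply/truncn0Pn; rewrite -ltNge.
rewrite (_ : [set _ | _] = (fun s : R => n%:R * s) @^-1` `[k.+1%:R, k.+2%:R[%classic).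
  exact: H.
apply/seteqP; split => s /=; rewrite in_itv/= /cell.
  move=> E; have := truncnS_gt (n%:R * s); rewrite E => ->; rewrite andbT.
  by rewrite -truncn_gt_nat E.
exact: truncn_def.
Qed.

Lemma measurable_cell d (T : measurableType d) d' (T' : measurableType d')
    (n : nat) (Y : nat -> T -> T') : (forall k, measurable_fun setT (Y k)) ->
  measurable_fun setT (fun z : T * measurableTypeR R => Y (cell n z.2) z.1).
Proof.
move=> mY.
pose E k : set (T * measurableTypeR R) := snd @^-1` [set s | cell n s = k].
have mE k : measurable (E k).
  rewrite -[X in measurable X]setTI.
  by apply: measurable_snd => //; exact: measurable_cell_set.
have -> : [set: T * measurableTypeR R] = \bigcup_k E k.
  by apply/seteqP; split => // z _; exists (cell n z.2).
apply/measurable_fun_bigcup => // k.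
apply: (eq_measurable_fun (fun z => Y k z.1)).
  by move=> z; rewrite inE/= /E/= => ->.
by apply: measurable_funTS; exact: (measurableT_comp (mY k) (@measurable_fst _ _ _ _)).
Qed.

Lemma measurable_cellR n : measurable_fun [set: R] (fun s => (cell n s)%:R : R).
Proof.
exact: (measurableT_comp (measurable_cell n (fun k => @measurable_cst _ _ R R setT k%:R))
  (pair1_measurable (0 : R))).
Qed.

Lemma measurable_frac n : measurable_fun [set: R] (frac n).
Proof. by apply: measurable_funB; [exact: measurable_funM|exact: measurable_cellR]. Qed.

Section decomposition.
Variables (n : nat) (f : nat -> R -> \bar R).
Hypothesis n0 : (0 < n)%N.
Hypothesis mf : forall k, measurable_fun setT (f k).
Hypothesis f0 : forall k r, (0 <= f k r)%E.

Local Notation F := (fun s => f (cell n s) (frac n s)).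

Lemma measurable_cells D : measurable_fun D F.
Proof.
apply: measurable_funTS.
have -> : [set: R] = \bigcup_k [set s | cell n s = k].
  by apply/seteqP; split => // s _; exists (cell n s).
apply/measurable_fun_bigcup => k; first exact: measurable_cell_set.
apply: (eq_measurable_fun (fun s => f k (frac n s))).
  by move=> s; rewrite inE/= => ->.
by apply: measurable_funTS; exact: (measurableT_comp (mf k) (measurable_frac n)).
Qed.

Let nR0 : 0 < n%:R :> R. Proof. by rewrite ltr0n. Qed.

Lemma integral_one_cell k (u : R) : 0 <= u <= 1 ->
  (\int[lam]_(s in `[(k%:R / n%:R)%R, ((k%:R + u) / n%:R)%R[) F s =
   n%:R^-1%:E * \int[lam]_(r in `[0%R, u]) f k r)%E.
Proof.
move=> /andP[u0 u1].
rewrite -integral_itv_bndo_bndc; last by apply: measurable_funTS; exact: mf.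
have := @ge0_integral_affine R n%:R (- k%:R) `[0, u[%classic (f k) _ _ _ _.
rewrite gtr0_norm// => <-//; last 2 first.
- by rewrite gt_eqF.
- by apply: measurable_funTS; exact: mf.
have -> : (fun x : R => n%:R * x - k%:R) @^-1` `[0, u[%classic =
    `[(k%:R / n%:R)%R, ((k%:R + u) / n%:R)%R[%classic.
  apply/seteqP; split => s /=; rewrite !in_itv/= ler_pdivrMr// ltr_pdivlMr//.
    by move=> /andP[? ?]; apply/andP; split; lra.
  by move=> /andP[? ?]; apply/andP; split; lra.
apply: eq_integral => s; rewrite inE/= in_itv/= => /andP[H1 H2].
have [|-> ->//] := @cellP n k s n0.
rewrite H1/= (lt_le_trans H2)// ler_pM2r ?invr_gt0//.
by rewrite -natr1 lerD2l.
Qed.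

Lemma integral_cells_aux k (u : R) : 0 <= u <= 1 ->
  (\int[lam]_(s in `[0%R, ((k%:R + u) / n%:R)%R[) F s =
   n%:R^-1%:E * (\sum_(i < k) \int[lam]_(r in `[0%R, 1%R]) f i r +
     \int[lam]_(r in `[0%R, u]) f k r))%E.
Proof.
elim: k u => [|k IH] u u01.
  rewrite big_ord0 add0e -integral_one_cell//.
  by rewrite mul0r.
have u0 : 0 <= u by case/andP: u01.
have E : `[0%R, ((k.+1%:R + u) / n%:R)%R[%classic =
    `[0%R, ((k%:R + 1) / n%:R)%R[%classic `|`
    `[(k.+1%:R / n%:R)%R, ((k.+1%:R + u) / n%:R)%R[%classic.
  rewrite natr1; apply: itv_bndbnd_setU; rewrite bnd_simp.
    by rewrite divr_ge0.
  by rewrite ler_pM2r ?invr_gt0// lerDl.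
rewrite E ge0_integral_setU//; last 2 first.
- exact: measurable_cells.
- apply/disj_set2P; rewrite -subset0 => s/= []; rewrite !in_itv/= natr1.
  by move=> /andP[_ H1] /andP[H2 _]; move: (lt_le_trans H1 H2); rewrite ltxx.
rewrite IH ?ler01 ?lexx// integral_one_cell// big_ord_recr/=.
have i0 i (D : set R) : (0 <= \int[lam]_(r in D) f i r)%E.
  by apply: integral_ge0 => r _.
rewrite -ge0_muleDr//.
by rewrite adde_ge0 ?sume_ge0.
Qed.

(** [frac] rescales each cell to [0, 1[, by the substitution r = n s - k. *)
Lemma integral_cells (t : R) : 0 <= t ->
  (\int[lam]_(s in `[0%R, t]) F s =
   n%:R^-1%:E * (\sum_(i < cell n t) \int[lam]_(r in `[0%R, 1%R]) f i r +
     \int[lam]_(r in `[0%R, frac n t]) f (cell n t) r))%E.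
Proof.
move=> t0; rewrite -integral_itv_bndo_bndc; last exact: measurable_cells.
have /andP[H1 H2] := frac_itv n t0.
rewrite -integral_cells_aux; last by rewrite H1 ltW.
congr (integral lam _ _); congr [set` Interval _ (BLeft _)].
by rewrite /frac addrC subrK mulrAC divff ?mul1r// gt_eqF.
Qed.

Lemma integral_cells_le (t : R) : 0 <= t ->
  (\int[lam]_(s in `[0%R, t]) F s <=
   n%:R^-1%:E * \sum_(i < (cell n t).+1) \int[lam]_(r in `[0%R, 1%R]) f i r)%E.
Proof.
move=> t0; rewrite integral_cells// big_ord_recr/=; apply: lee_wpmul2l.
  by rewrite lee_fin invr_ge0.
apply: leeD => //; apply: ge0_subset_integral => //.
  by apply: measurable_funTS; exact: mf.
have /andP[H1 H2] := frac_itv n t0.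
by apply: subset_itvl; rewrite bnd_simp ltW.
Qed.

End decomposition.
End cells.

Section kernels.
Context {R : realType}.
Notation lam := (@lebesgue_measure R).
Variables (p : bool) (H : R -> R).

(** The common form of g (p true, H the Gaussian density) and G (p false, H the
Gaussian tail): the density, or the upper tail, at [a] of a standard bridge from
0 to [z] over [0, 1], integrated over the time up to [s]. *)
Definition kern (s a z : R) : R :=
  \int[lam]_(r in `[0, s]) (kap r ^+ p * H (kap r * (a - r * z))).

(** The density (p true) or the upper tail (p false) at [x] of the process at time
[s] given the observations [Y], when its scale is taken to be [c]. *)
Definition bdens (T : Type) (n : nat) (c x : R) (Y : nat -> T -> R) (s : R)
    (w : T) : R :=
  let k := cell n s in let r := frac n s in
  (Num.sqrt n%:R / c * kap r) ^+ p *
  H (Num.sqrt n%:R / c * kap r * (x - Y k w - r * (Y k.+1 w - Y k w))).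

Hypotheses (mH : measurable_fun setT H) (H01 : forall u, 0 <= H u <= 1).

Let H_ge0 u : 0 <= H u. Proof. by case/andP: (H01 u). Qed.
Let H_le1 u : H u <= 1. Proof. by case/andP: (H01 u). Qed.

Lemma exprb_le (y : R) : 0 <= y -> y ^+ p <= 1 + y.
Proof. by move=> y0; case: p; rewrite ?expr0 ?expr1 ?lerDr ?lerDl. Qed.

Lemma measurable_exprb d (T : measurableType d) (f : T -> R) :
  measurable_fun setT f -> measurable_fun setT (fun w => f w ^+ p).
Proof. by move=> mf; apply: measurable_funX. Qed.

Lemma measurable_kern_integrand (b a z : R) :
  measurable_fun setT (fun r => (b * kap r) ^+ p * H (b * kap r * (a - r * z))).
Proof.
have mk : measurable_fun setT (fun r : R => b * kap r).
  by apply: measurable_funM => //; exact: measurable_kap.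
apply: measurable_funM; first exact: measurable_exprb.
apply: (measurableT_comp mH); apply: measurable_funM => //.
by apply: measurable_funB => //; exact: measurable_funM.
Qed.

Lemma integral_kap1 : (\int[lam]_(r in `[0%R, 1%R]) (1 + kap r)%:E <= 7%:E)%E.
Proof.
under eq_integral do rewrite EFinD.
rewrite ge0_integralD//; last 2 first.
- by move=> r _; rewrite lee_fin kap_ge0.
- by apply/measurable_EFinP/measurable_funTS; exact: measurable_kap.
rewrite (_ : 7 = 1 + 6); last by ring.
rewrite EFinD; apply: leeD; last exact: integral_kap.
rewrite (_ : \int[lam]_(x in _) _ = 1%:E * lam `[0%R, 1%R]%classic)%E; last first.
  by rewrite -integral_cst.
by rewrite mul1e lebesgue_measure_itv/= lte_fin ltr01 oppr0 adde0.
Qed.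

(** The integrand is at most 1 + kap, hence the integral is finite. *)
Lemma kernE (s a z : R) : s <= 1 -> (kern s a z)%:E =
  (\int[lam]_(r in `[0%R, s]) (kap r ^+ p * H (kap r * (a - r * z)))%:E)%E.
Proof.
move=> s1; rewrite /kern /Rintegral fineK//.
have m1 := measurable_kern_integrand 1 a z.
have m2 : measurable_fun setT (fun r => kap r ^+ p * H (kap r * (a - r * z))).
  by apply: eq_measurable_fun m1 => r _; rewrite mul1r.
have g0 r : (0 <= (kap r ^+ p * H (kap r * (a - r * z)))%:E)%E.
  by rewrite lee_fin mulr_ge0 ?exprn_ge0 ?kap_ge0.
rewrite ge0_fin_numE; last exact: integral_ge0.
apply: (@le_lt_trans _ _ 7%:E); last exact: ltry.
apply: le_trans integral_kap1.
apply: (@le_trans _ _ (\int[lam]_(r in `[0%R, s]) (1 + kap r)%:E)%E).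
  apply: ge0_le_integral => //.
  - exact/measurable_EFinP/measurable_funTS.
  - apply/measurable_EFinP/measurable_funTS; apply: measurable_funD => //.
    exact: measurable_kap.
  - move=> r _; rewrite lee_fin (le_trans _ (exprb_le (kap_ge0 r)))//.
    by rewrite ler_piMr ?exprn_ge0 ?kap_ge0.
apply: ge0_subset_integral => //.
- apply/measurable_EFinP/measurable_funTS; apply: measurable_funD => //.
  exact: measurable_kap.
- by move=> r _; rewrite lee_fin addr_ge0 ?kap_ge0.
- by apply: subset_itvl; rewrite bnd_simp.
Qed.

(** Cell by cell, Brownian scaling turns the bridge over a cell into the standard
one, which produces the arguments of [increment_sum]. *)
Lemma integral_bdens (T : Type) (X : R -> T -> R) n c x t w :
  (0 < n)%N -> 0 < c -> 0 <= t ->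
  (\int[lam]_(s in `[0%R, t])
     (bdens n c x (fun k => X (k%:R / n%:R)) s w)%:E =
   (n%:R^-1 * (Num.sqrt n%:R / c) ^+ p * increment_sum kern X n c x t w)%:E)%E.
Proof.
move=> n0 c0 t0.
set b := Num.sqrt n%:R / c.
have b0 : 0 <= b by rewrite divr_ge0 ?sqrtr_ge0// ltW.
pose Xk k := X (k%:R / n%:R) w.
pose f k r : \bar R :=
  ((b * kap r) ^+ p * H (b * kap r * (x - Xk k - r * (Xk k.+1 - Xk k))))%:E.
have mf k : measurable_fun setT (f k).
  by apply/measurable_EFinP; exact: measurable_kern_integrand.
have f0 k r : (0 <= f k r)%E.
  rewrite lee_fin; apply: mulr_ge0 => //; apply: exprn_ge0.
  by apply: mulr_ge0 => //; exact: kap_ge0.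
have H1 := integral_cells n0 mf f0 t0.
refine (etrans H1 _).
have E k u : u <= 1 -> (\int[lam]_(r in `[0%R, u]) f k r =
    (b ^+ p * kern u (b * (x - Xk k)) (b * (Xk k.+1 - Xk k)))%:E)%E.
  move=> u1; rewrite EFinM kernE// -ge0_integralZl//; last 3 first.
  - apply/measurable_EFinP/measurable_funTS.
    apply: eq_measurable_fun (measurable_kern_integrand 1 _ _) => r _.
    by rewrite mul1r.
  - by move=> r _; rewrite lee_fin mulr_ge0 ?exprn_ge0 ?kap_ge0.
  - by rewrite lee_fin exprn_ge0.
  apply: eq_integral => r _; rewrite /f -EFinM exprMn mulrA; congr (_ * H _)%:E.
  by ring.
have /andP[_ /ltW fr1] := frac_itv n t0.
rewrite E//; under eq_bigr do rewrite E//.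
rewrite sumEFin -EFinD -EFinM; congr EFin; rewrite -mulrA; congr (_ * _).
by rewrite -mulr_sumr -mulrDr.
Qed.

Lemma bdens_ge0 (T : Type) n c x (Y : nat -> T -> R) s w : 0 <= c ->
  0 <= bdens n c x Y s w.
Proof.
move=> c0; rewrite mulr_ge0// exprn_ge0// mulr_ge0 ?kap_ge0//.
by rewrite divr_ge0// sqrtr_ge0.
Qed.

Lemma measurable_bdens d (T : measurableType d) n c x (Y : nat -> T -> R) :
  (forall k, measurable_fun setT (Y k)) ->
  measurable_fun setT (fun z : T * measurableTypeR R => bdens n c x Y z.2 z.1).
Proof.
move=> mY.
have mr : measurable_fun setT (fun z : T * measurableTypeR R => frac n z.2).
  exact: (measurableT_comp (measurable_frac n) (@measurable_snd _ _ _ _)).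
have mk : measurable_fun setT (fun z : T * measurableTypeR R =>
    Num.sqrt n%:R / c * kap (frac n z.2)).
  by apply: measurable_funM => //; exact: (measurableT_comp measurable_kap mr).
have m1 := measurable_cell n mY.
have m2 := measurable_cell n (fun k => mY k.+1).
apply: measurable_funM; first exact: measurable_exprb.
apply: (measurableT_comp mH); apply: measurable_funM => //.
apply: measurable_funB; first exact: measurable_funB.
by apply: measurable_funM => //; exact: measurable_funB.
Qed.

End kernels.

(** * The conditional mean of the occupation time *)

Lemma fubini_tonelli_in d1 d2 (T1 : measurableType d1) (T2 : measurableType d2)
    (R : realType) (m1 : {sigma_finite_measure set T1 -> \bar R})
    (m2 : {sigma_finite_measure set T2 -> \bar R}) (A : set T1) (I : set T2)
    (f : T1 * T2 -> \bar R) :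
  measurable A -> measurable I -> measurable_fun setT f -> (forall z, 0 <= f z)%E ->
  (\int[m1]_(x in A) \int[m2]_(y in I) f (x, y) =
   \int[m2]_(y in I) \int[m1]_(x in A) f (x, y))%E.
Proof.
move=> mA mI mf f0.
pose g := f \_ (A `*` I).
have mg : measurable_fun setT g.
  apply/(measurable_restrictT f); first exact: measurableX.
  exact: measurable_funTS.
have g0 z : (0 <= g z)%E by rewrite /g patchE; case: ifP.
transitivity (\int[m1]_x \int[m2]_y g (x, y))%E.
  rewrite integral_mkcond; apply: eq_integral => x _; rewrite patchE.
  case: ifPn => xA.
    rewrite integral_mkcond; apply: eq_integral => y _.
    rewrite /g !patchE; congr (if _ then _ else _).
    by apply/idP/idP; rewrite !inE/=; [split => //; rewrite inE in xA|case].
  rewrite integral0_eq// => y _; rewrite /g patchE ifF//.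
  by apply: contraNF xA; rewrite !inE => -[].
refine (etrans (fubini_tonelli g mg g0) _); apply/esym.
rewrite integral_mkcond; apply: eq_integral => y _; rewrite patchE.
case: ifPn => yI.
  rewrite integral_mkcond; apply: eq_integral => x _.
  rewrite /g !patchE; congr (if _ then _ else _).
  by apply/idP/idP; rewrite !inE/=; [split => //; rewrite inE in yI|case].
rewrite integral0_eq// => x _; rewrite /g patchE ifF//.
by apply: contraNF yI; rewrite !inE => -[].
Qed.

Lemma measurable_integral_in d1 d2 (T1 : measurableType d1) (T2 : measurableType d2)
    (R : realType) (m2 : {sigma_finite_measure set T2 -> \bar R}) (I : set T2)
    (f : T1 * T2 -> \bar R) :
  measurable I -> measurable_fun setT f -> (forall z, 0 <= f z)%E ->
  measurable_fun setT (fun x => \int[m2]_(y in I) f (x, y))%E.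
Proof.
move=> mI mf f0; pose g := f \_ (setT `*` I).
have mg : measurable_fun setT g.
  apply/(measurable_restrictT f); first exact: measurableX.
  exact: measurable_funTS.
have g0 z : (0 <= g z)%E by rewrite /g patchE; case: ifP.
have := measurable_fun_fubini_tonelli_F (m2 := m2) g mg g0.
apply: eq_measurable_fun => x _; rewrite /fubini_F [RHS]integral_mkcond.
apply: eq_integral => y _; rewrite /g !patchE; congr (if _ then _ else _).
by apply/idP/idP; rewrite !inE/=; [case|].
Qed.

Section occupation.
Context d (T : measurableType d) (R : realType) (P : probability T R).
Notation lam := (@lebesgue_measure R).

(** The conditional mean of [Y] is the time integral of [bdens] at the true scale.
Equality of integrals over observable events expresses this for nonnegative
[Y], integrable or not. *)
Definition is_bridge_mean (X : R -> T -> R) (sigma : R) (p : bool) (H : R -> R)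
    (Y : R -> R -> T -> R) : Prop :=
  forall (n : nat) (t x : R) (A : set T), (0 < n)%N -> 0 <= t ->
    observations X n A ->
  (\int[P]_(w in A) (Y t x w)%:E =
   \int[P]_(w in A) \int[lam]_(s in `[0%R, t])
     (bdens p H n sigma x (fun k => X (k%:R / n%:R)%R) s w)%:E)%E.

Variables (B : R -> T -> R) (hB : standard_brownian P B).
Variables (mu sigma : R) (sigma0 : 0 < sigma).
Local Notation X := (linear_brownian mu sigma B).

Lemma measurable_X s : 0 <= s -> measurable_fun setT (X s).
Proof.
move=> s0; have [mB _ _ _ _] := hB.
by apply: measurable_funD => //; apply: measurable_funM => //; exact: mB.
Qed.

Lemma observations_measurable n : observations X n `<=` measurable.
Proof.
apply: smallest_sub; first exact: sigma_algebra_measurable.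
move=> _ [i [V [mV ->]]]; rewrite -[X in measurable X]setTI.
by apply: measurable_X => //; rewrite divr_ge0.
Qed.

Lemma continuous_X w t : 0 < t -> {for t, continuous (X ^~ w)}.
Proof.
move=> t0; have [_ _ /(_ w) cB _ _] := hB.
move/continuous_within_itvcyP : cB => [cB _].
apply: cvgD; first by apply: cvgM; [exact: cvg_cst|exact: cvg_id].
by apply: cvgM; [exact: cvg_cst|apply: cB; rewrite in_itv/= andbT].
Qed.

(** Joint measurability by approximating continuous paths along finer and finer
grids; freezing the process at time 0 for negative times makes this a statement
on the whole line. *)
Lemma measurable_path : measurable_fun setT
  (fun z : T * measurableTypeR R => X (Num.max z.2 0) z.1).
Proof.
(* the value at the last point of the grid of mesh 1/(m+1) *)
pose h (m : nat) (z : T * measurableTypeR R) : R :=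
  X ((cell m.+1 z.2)%:R / m.+1%:R) z.1.
apply: (@measurable_fun_cvg _ _ _ setT h) => //.
  move=> m; apply: (@measurable_cell R _ T _ _ m.+1 (fun k => X (k%:R / m.+1%:R))) => k.
  by apply: measurable_X; rewrite divr_ge0.
move=> [w t] _ /=; have [t0|t0] := leP t 0.
  rewrite /h/=; apply: cvg_near_cst; apply: nearW => m.
  suff -> : cell m.+1 t = 0%N by rewrite mul0r.
  apply/truncn0Pn; rewrite -ltNge (@le_lt_trans _ _ 0)//.
  by rewrite mulr_ge0_le0.
apply: (@cvg_comp _ _ _ (fun m => (cell m.+1 t)%:R / m.+1%:R : R) (X ^~ w) _ (nbhs t));
  last exact: continuous_X.
apply/cvgrPdist_le => e e0; near=> m.
have m0 : 0 < m.+1%:R :> R by [].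
have /andP[H1 H2] := frac_itv m.+1 (ltW t0).
have E : t - (cell m.+1 t)%:R / m.+1%:R = frac m.+1 t / m.+1%:R.
  by rewrite /frac; field; rewrite gt_eqF.
rewrite /= E ger0_norm ?divr_ge0//.
apply: (@le_trans _ _ (m.+1%:R^-1)); first by rewrite ler_piMl ?invr_ge0// ltW.
near: m; apply: filterS (near_infty_natSinv_lt (PosNum e0)) => k; exact: ltW.
Unshelve. all: by end_near. Qed.

Lemma grid_null n : (0 < n)%N -> lam.-negligible [set s : R | 0 <= s /\ frac n s = 0].
Proof.
move=> n0; have nR0 : 0 < n%:R :> R by rewrite ltr0n.
pose G := range (fun k : nat => k%:R / n%:R : R).
have cG : countable G by exact: card_image_le.
have nG : lam.-negligible G.
  exists G; split => //; first exact: countable_measurable.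
  exact: countable_lebesgue_measure0.
apply: negligibleS nG => s /= [s0 fs]; exists (cell n s) => //.
by move: fs; rewrite /frac => /subr0_eq <-; rewrite mulrC mulKf ?gt_eqF.
Qed.

(** Tonelli's theorem and [bridge] at each time [s] that is not on the grid, the
grid being a null set of times. *)
Lemma occupation_bridge n t A (U : set R) (K : R -> T -> R) :
  (0 < n)%N -> 0 <= t -> observations X n A -> measurable U ->
  measurable_fun setT (fun z : T * measurableTypeR R => K z.2 z.1) ->
  (forall s w, 0 <= K s w) ->
  (forall s w, 0 < s -> 0 < frac n s < 1 ->
     normal_prob
     (X ((cell n s)%:R / n%:R) w + frac n s *
        (X ((cell n s).+1%:R / n%:R) w - X ((cell n s)%:R / n%:R) w))
     (sigma / Num.sqrt n%:R * Num.sqrt (frac n s * (1 - frac n s))) U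
     = (K s w)%:E) ->
  (\int[P]_(w in A) \int[lam]_(s in `[0%R, t]) (\1_U (X s w))%:E =
   \int[P]_(w in A) \int[lam]_(s in `[0%R, t]) (K s w)%:E)%E.
Proof.
move=> n0 t0 oA mU mK K0 KE.
have nR0 : 0 < n%:R :> R by rewrite ltr0n.
have mA : measurable A by exact: observations_measurable oA.
pose J (z : T * measurableTypeR R) : \bar R := (\1_U (X (Num.max z.2 0) z.1))%:E.
have mJ : measurable_fun setT J.
  have m1 : measurable_fun setT (\1_U : _ -> R) by exact: measurable_indic.
  by apply/measurable_EFinP; exact: (measurableT_comp m1 measurable_path).
have J0 z : (0 <= J z)%E by rewrite lee_fin.
pose fK (z : T * measurableTypeR R) := (K z.2 z.1)%:E.
have mKE : measurable_fun setT fK by exact/measurable_EFinP.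
have fK0 z : (0 <= fK z)%E by rewrite lee_fin.
have mI : measurable `[0%R, t]%classic by exact: measurable_itv.
transitivity (\int[P]_(w in A) \int[lam]_(s in `[0%R, t]) J (w, s))%E.
  apply: eq_integral => w _; apply: eq_integral => s; rewrite inE/= in_itv/=.
  by move=> /andP[s0 _]; rewrite /J/= max_l.
refine (etrans (fubini_tonelli_in P lam mA mI mJ J0) _).
refine (etrans _ (esym (fubini_tonelli_in P lam mA mI mKE fK0))).
have maux (f : T * measurableTypeR R -> \bar R) : measurable_fun setT f ->
    (forall z, 0 <= f z)%E ->
    measurable_fun `[0%R, t]%classic (fun s => (\int[P]_(w in A) f (w, s))%E).
  move=> mf f0; apply: measurable_funTS.
  pose g (z : measurableTypeR R * T) := f (z.2, z.1).
  have mg : measurable_fun setT g.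
    by apply: (measurableT_comp mf); exact: measurable_fun_pair.
  exact: (measurable_integral_in P mA mg (fun z => f0 _)).
apply: ge0_ae_eq_integral.
- exact: mI.
- exact: (maux _ mJ J0).
- exact: (maux _ mKE fK0).
- by move=> s _; exact: integral_ge0.
- by move=> s _; exact: integral_ge0.
apply: negligibleS (grid_null n0) => s /= /not_implyP[].
rewrite in_itv/= => /andP[s0 st] ne; split => //.
apply: contrapT => /eqP fs0; apply: ne.
have /andP[f0 f1] := frac_itv n s0.
have f01 : 0 < frac n s < 1 by rewrite lt_neqAle eq_sym fs0 f0.
have sp : 0 < s.
  rewrite lt_neqAle s0 andbT; apply: contraNneq fs0 => <-.
  by rewrite /frac /cell mulr0 truncn0 subr0.
have js : (cell n s)%:R / n%:R < s < (cell n s).+1%:R / n%:R.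
  rewrite ltr_pdivrMr// ltr_pdivlMr// mulrC -subr_gt0 -/(frac n s).
  by case/andP: f01 => -> _ /=; exact: truncnS_gt.
transitivity (P (A `&` [set w | U (X s w)])).
  transitivity (\int[P]_(w in A) (\1_[set w | U (X s w)] w)%:E)%E.
    apply: eq_integral => w _; rewrite /J/= max_l// !indicE.
  rewrite integral_indic; [by rewrite setIC|exact: mA|].
  rewrite -[X in measurable X]setTI.
  by have := measurable_X s0; apply.
rewrite (bridge hB sigma0 n0 js oA mU); apply: eq_integral => w _.
exact: KE.
Qed.

End occupation.

Section occ_inst.
Context d (T : measurableType d) (R : realType) (P : probability T R).
Notation lam := (@lebesgue_measure R).
Variables (B : R -> T -> R) (hB : standard_brownian P B).
Variables (mu sigma : R) (sigma0 : 0 < sigma).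
Local Notation X := (linear_brownian mu sigma B).

Lemma cell_sd n s : (0 < n)%N -> 0 < frac n s < 1 ->
  0 < sigma / Num.sqrt n%:R * Num.sqrt (frac n s * (1 - frac n s)) /\
  (sigma / Num.sqrt n%:R * Num.sqrt (frac n s * (1 - frac n s)))^-1 =
  Num.sqrt n%:R / sigma * kap (frac n s).
Proof.
move=> n0 /andP[f0 f1]; have sn0 : 0 < Num.sqrt n%:R :> R by rewrite sqrtr_gt0 ltr0n.
have sf0 : 0 < Num.sqrt (frac n s * (1 - frac n s)).
  by rewrite sqrtr_gt0 mulr_gt0// subr_gt0.
split; first by rewrite mulr_gt0// divr_gt0.
by rewrite /kap; field; rewrite !gt_eqF.
Qed.

Lemma integral_indic_path t (U : set R) w : 0 <= t -> measurable U ->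
  (\int[lam]_(s in `[0%R, t]) \1_U (X s w))%R%:E =
  (\int[lam]_(s in `[0%R, t]) (\1_U (X s w))%:E)%E /\
  (\int[lam]_(s in `[0%R, t]) (\1_U (X s w))%:E <= t%:E)%E.
Proof.
move=> t0 mU.
have mXw : measurable_fun `[0, t]%classic (X ^~ w).
  have m2 : measurable_fun setT (fun s : R => X (Num.max s 0) w).
    exact: (measurableT_comp (measurable_path hB mu sigma) (pair1_measurable w)).
  have m3 : measurable_fun `[0, t]%classic (fun s : R => X (Num.max s 0) w).
    exact: measurable_funTS.
  apply: eq_measurable_fun m3 => s; rewrite inE/= in_itv/= => /andP[s0 _].
  by rewrite max_l.
have mf : measurable_fun `[0, t]%classic (fun s => (\1_U (X s w) : R)%:E).
  have m1 : measurable_fun setT (\1_U : R -> R) by exact: measurable_indic.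
  by apply/measurable_EFinP; exact: (measurableT_comp m1 mXw).
have Hle : (\int[lam]_(s in `[0%R, t]) (\1_U (X s w))%:E <= t%:E)%E.
  apply: (@le_trans _ _ (\int[lam]_(s in `[0%R, t]) 1%:E)%E).
    apply: ge0_le_integral => //.
    - by move=> s _; rewrite lee_fin.
  rewrite (_ : \int[lam]_(x in _) _ = 1%:E * lam `[0%R, t]%classic)%E; last first.
    by rewrite -integral_cst.
  by rewrite mul1e lebesgue_measure_itv/= lte_fin; case: ifP => _; rewrite ?oppr0 ?adde0 ?lee_fin.
split => //; rewrite /Rintegral fineK// ge0_fin_numE.
  exact: le_lt_trans Hle (ltry _).
by apply: integral_ge0 => s _; rewrite lee_fin.
Qed.

Lemma occupation_bridge_mean : is_bridge_mean P X sigma false Ph (occupation_time X).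
Proof.
move=> n t x A n0 t0 oA.
under eq_integral do
  rewrite /occupation_time (integral_indic_path _ t0 (measurable_itv _)).1.
apply: (@occupation_bridge _ _ _ P B hB mu sigma sigma0 n t A `]x, +oo[%classic
  (bdens false (@Ph R) n sigma x (fun k => X (k%:R / n%:R))) n0 t0 oA) => //.
- apply: measurable_bdens; [exact: measurable_Ph|move=> k].
  by apply: (measurable_X hB); rewrite divr_ge0.
- by move=> s w; apply: bdens_ge0 => //; [exact: Ph01|exact: ltW].
- move=> s w s0 fs; have [v0 vE] := cell_sd n0 fs.
  by rewrite normal_prob_ray// vE /bdens expr0 mul1r opprD addrA.
Qed.

(** The mass that the law of the process at time [s], given the observations, puts
on the interval of radius [e] around [x]. *)
Definition itv_dens n e x s w : R :=
  let b := Num.sqrt n%:R / sigma * kap (frac n s) in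
  let y := x - X ((cell n s)%:R / n%:R) w - frac n s *
    (X ((cell n s).+1%:R / n%:R) w - X ((cell n s)%:R / n%:R) w) in
  Ph (b * (y - e)) - Ph (b * (y + e)).

Lemma itv_dens_bounds n e x s w : 0 <= e ->
  0 <= itv_dens n e x s w <= Num.sqrt n%:R / sigma * kap (frac n s) * (2 * e).
Proof.
move=> e0; rewrite /itv_dens; set b := _ * kap _; set y := x - _ - _.
have b0 : 0 <= b by rewrite !mulr_ge0 ?kap_ge0 ?sqrtr_ge0 ?invr_ge0// ltW.
have H v : b * (y - e) <= v <= b * (y + e) -> 0 <= gphi v <= 1 by rewrite gphi01.
have ab : b * (y - e) <= b * (y + e) by apply: ler_wpM2l => //; lra.
have := PhB_bounds ab H; rewrite mul0r mul1r => /andP[-> H2] /=.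
by apply: le_trans H2 _; lra.
Qed.

Lemma measurable_itv_dens n e x :
  measurable_fun setT (fun z : T * measurableTypeR R => itv_dens n e x z.2 z.1).
Proof.
have mY k : measurable_fun setT (X (k%:R / n%:R)).
  by apply: (measurable_X hB); rewrite divr_ge0.
have := @measurable_bdens R false Ph (@measurable_Ph R) d T n sigma (x - e) _ mY.
have := @measurable_bdens R false Ph (@measurable_Ph R) d T n sigma (x + e) _ mY.
move=> m1 m2; apply: eq_measurable_fun (measurable_funB m2 m1) => z _.
rewrite /bdens /itv_dens /= !expr0 !mul1r; congr (Ph (_ * _) - Ph (_ * _)); ring.
Qed.

Lemma interval_bridge n t A e x : (0 < n)%N -> 0 <= t -> observations X n A -> 0 <= e ->
  (\int[P]_(w in A) \int[lam]_(s in `[0%R, t])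
     (\1_(`](x - e)%R, (x + e)%R[%classic : set R) (X s w))%:E =
   \int[P]_(w in A) \int[lam]_(s in `[0%R, t]) (itv_dens n e x s w)%:E)%E.
Proof.
move=> n0 t0 oA e0; apply: (@occupation_bridge _ _ _ P B hB mu sigma sigma0 n t A
  `](x - e), (x + e)[%classic (itv_dens n e x) n0 t0 oA) => //.
- exact: measurable_itv_dens.
- by move=> s w; have /andP[] := itv_dens_bounds n x s w e0.
- move=> s w s0 fs; have [v0 vE] := cell_sd n0 fs.
  rewrite normal_prob_itv//; last by lra.
  rewrite vE /itv_dens; congr (Ph (_ * _) - Ph (_ * _))%:E; ring.
Qed.

End occ_inst.

(** * The conditional mean of the local time *)

Section uniform_integrability.
Context d (T : measurableType d) (R : realType) (P : probability T R).

(** A bound on second moments makes the variables uniformly integrable.  Fatou's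
lemma gives one inequality; for the other, truncation at level [M] costs at most
[K / M], as y <= min y M + y^2 / M. *)
Lemma second_moment_limit (f_ : nat -> T -> R) (f : T -> R) (A : set T) (K : R)
    (b : \bar R) :
  measurable A -> (forall m, measurable_fun setT (f_ m)) -> measurable_fun setT f ->
  (forall m w, 0 <= f_ m w) ->
  (forall w, f_ m w @[m --> \oo] --> f w) ->
  (forall m, \int[P]_w (f_ m w ^+ 2)%:E <= K%:E)%E ->
  (\int[P]_(w in A) (f_ m w)%:E)%E @[m --> \oo] --> b ->
  (\int[P]_(w in A) (f w)%:E)%E = b.
Proof.
move=> mA mf_ mf f_0 f_f fK ib.
have f0 w : 0 <= f w.
  rewrite -(cvg_lim _ (f_f w))//; apply: limr_ge; first by apply/cvg_ex; exists (f w).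
  by apply: nearW => m; exact: f_0.
have mE (g : T -> R) : measurable_fun setT g -> measurable_fun A (EFin \o g).
  by move=> mg; apply/measurable_EFinP; exact: measurable_funTS.
apply/eqP; rewrite eq_le; apply/andP; split.
  have := @fatou _ T R P A mA (fun m => EFin \o f_ m) (fun m => mE _ (mf_ m))
    (fun m w _ => f_0 m w).
  rewrite (cvg_limn_einf_sup ib).1; apply: le_trans.
  apply: eq_leW; apply: eq_integral => w _.
  have fw : (EFin \o (f_ ^~ w)) m @[m --> \oo] --> (f w)%:E.
    by apply: cvg_EFin; [exact: nearW|exact: f_f].
  by rewrite (cvg_limn_einf_sup fw).1.
have K0 : 0 <= K.
  rewrite -lee_fin; apply: le_trans (fK 0%N); apply: integral_ge0 => w _.
  by rewrite lee_fin sqr_ge0.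
have main M : 0 < M -> (b <= \int[P]_(w in A) (f w)%:E + (K / M)%:E)%E.
  move=> M0.
  pose g_ m w := Num.min (f_ m w) M.
  have mg_ m : measurable_fun setT (g_ m) by apply: measurable_minr.
  have mg : measurable_fun setT (fun w => Num.min (f w) M) by apply: measurable_minr.
  have g_cvg : (\int[P]_(w in A) (g_ m w)%:E)%E @[m --> \oo] -->
      (\int[P]_(w in A) (Num.min (f w) M)%:E)%E.
    apply: (@dominated_cvg _ T R P A mA (fun m => EFin \o g_ m) _ (EFin \o cst M)).
    - by move=> m; exact: mE.
    - move=> w _; apply: cvg_EFin; first exact: nearW.
      apply: (@cvg_comp _ _ _ (f_ ^~ w) (fun y => Num.min y M) _ (nbhs (f w))); first exact: f_f.
      exact: (@continuous_min _ R id (cst M) (f w) (@cvg_id _ _) (@cvg_cst _ _ _ _ _)).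
    - by [].
    - exact: finite_measure_integrable_cst.
    - move=> m w _ /=; rewrite lee_fin ger0_norm ?ge_min ?lexx ?orbT//.
      by rewrite le_min f_0 ltW.
  have f_le m : (\int[P]_(w in A) (f_ m w)%:E <=
      \int[P]_(w in A) (g_ m w)%:E + (K / M)%:E)%E.
    have g0 w : 0 <= g_ m w by rewrite /g_ le_min f_0 ltW.
    apply: (@le_trans _ _ (\int[P]_(w in A) ((g_ m w)%:E + (M^-1 * f_ m w ^+ 2)%:E))%E).
      apply: ge0_le_integral => //.
      - by move=> w _; rewrite lee_fin f_0.
      - exact: mE.
      - apply: emeasurable_funD; apply: mE => //.
        by apply: measurable_funM => //; exact: measurable_funX.
      - move=> w _; rewrite -EFinD lee_fin /g_; have [fM|Mf] := leP (f_ m w) M.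
          by rewrite lerDl mulr_ge0 ?sqr_ge0 ?invr_ge0// ltW.
        rewrite expr2 mulrA (le_trans (_ : f_ m w <= M^-1 * f_ m w * f_ m w))//.
          by rewrite ler_peMl// mulrC ler_pdivlMr// mul1r ltW.
        by rewrite lerDr ltW.
    have mf2 : measurable_fun A (fun w => (M^-1 * f_ m w ^+ 2)%:E).
      by apply: mE; apply: measurable_funM => //; exact: measurable_funX.
    have mf2' : measurable_fun A (fun w => (f_ m w ^+ 2)%:E).
      by apply: mE; exact: measurable_funX.
    rewrite ge0_integralD//; last 3 first.
    - by move=> w _; rewrite lee_fin.
    - exact: mE.
    - by move=> w _; rewrite lee_fin mulr_ge0 ?sqr_ge0 ?invr_ge0// ltW.
    apply: leeD => //; under eq_integral do rewrite EFinM.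
    rewrite ge0_integralZl//; last 2 first.
    - by move=> w _; rewrite lee_fin sqr_ge0.
    - by rewrite lee_fin invr_ge0 ltW.
    rewrite mulrC EFinM; apply: lee_wpmul2l; first by rewrite lee_fin invr_ge0 ltW.
    apply: le_trans (fK m); apply: ge0_subset_integral => //.
      by apply/measurable_EFinP; exact: measurable_funX.
    by move=> w _; rewrite lee_fin sqr_ge0.
  apply: (@le_trans _ _ (\int[P]_(w in A) (Num.min (f w) M)%:E + (K / M)%:E)%E).
    have vc : (\int[P]_(w in A) (g_ m w)%:E + (K / M)%:E)%E @[m --> \oo] -->
      (\int[P]_(w in A) (Num.min (f w) M)%:E + (K / M)%:E)%E.
      by apply: cvgeD => //; [exact: fin_num_adde_defl|exact: cvg_cst].
    by apply: lee_cvg_to ib vc _; exact: nearW.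
  apply: leeD => //; apply: ge0_le_integral => //.
  - by move=> w _; rewrite lee_fin le_min f0 ltW.
  - exact: mE.
  - exact: mE.
  - by move=> w _; rewrite lee_fin ge_min lexx.
apply/lee_addgt0Pr => e e0.
have Ke : 0 < (K + 1) / e by rewrite divr_gt0// ltr_wpDl.
apply: le_trans (main _ Ke) _; rewrite leeD2l// lee_fin.
rewrite invf_div mulrCA -[leRHS]mulr1 ler_wpM2l ?(ltW e0)// ler_pdivrMr ?ltr_wpDl//.
by rewrite mul1r lerDl.
Qed.

End uniform_integrability.

Section second_moment.
Context d (T : measurableType d) (R : realType) (P : probability T R).
Notation lam := (@lebesgue_measure R).
Variables (B : R -> T -> R) (hB : standard_brownian P B).
Variables (mu sigma : R) (sigma0 : 0 < sigma).
Local Notation X := (linear_brownian mu sigma B).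

Lemma normal_prob_itv_le (m v x y : R) : 0 < v -> y <= x ->
  (normal_prob m v `]y, x[%classic <= (v^-1 * (x - y))%:E)%E.
Proof.
move=> v0 yx; rewrite normal_prob_itv// lee_fin.
have ab : v^-1 * (y - m) <= v^-1 * (x - m) by rewrite ler_pM2l ?invr_gt0// lerD2r.
have H u : v^-1 * (y - m) <= u <= v^-1 * (x - m) -> 0 <= gphi u <= 1.
  by rewrite gphi01.
have /andP[_ H2] := PhB_bounds ab H.
by apply: le_trans H2 _; rewrite mul1r -mulrBr; apply/ler_wpM2l; [rewrite invr_ge0 ltW|lra].
Qed.

Lemma measurable_window (x e v : R) : 0 <= v ->
  measurable [set w | x - e < X v w < x + e].
Proof.
move=> v0; have := measurable_X hB mu sigma v0 measurableT (measurable_itv `]x - e, x + e[).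
by rewrite setTI; congr measurable; apply/seteqP; split => w /=; rewrite in_itv.
Qed.

(** Both X s and X u are in the window only if the increment from 0 to s is in an
interval of length 2e / sigma and the increment from s to u in one of length
4e / sigma; these increments are independent, with densities at most [isq s] and
[isq (u - s)]. *)
Lemma two_point (e x s u : R) : 0 < e -> 0 < s -> s < u ->
  (P [set w | (x - e < X s w < x + e)%R /\ (x - e < X u w < x + e)%R] <=
   (8 * (e / sigma) ^+ 2 * (isq s * isq (u - s)))%:E)%E.
Proof.
move=> e0 s0 su; have [mB B0 _ prodB lawB] := hB.
pose t (i : nat) : R := if i is i'.+1 then if i' is _.+1 then u else s else 0.
have th : {homo t : i j / (i <= j)%N >-> i <= j}.
  apply: homo_leq => [y|y z y'|]; [exact: lexx|exact: le_trans|].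
  by case=> [|[|i]] /=; [exact: ltW|exact: ltW|exact: lexx].
pose a1 := (x - e - mu * s) / sigma; pose b1 := (x + e - mu * s) / sigma.
pose a2 := (- (2 * e) - mu * (u - s)) / sigma; pose b2 := (2 * e - mu * (u - s)) / sigma.
pose A (i : nat) : set R := if i is 0%N then `]a1, b1[%classic else `]a2, b2[%classic.
have mA i : measurable (A i) by case: i => [|i]; exact: measurable_itv.
have PE : P (\bigcap_(i in `I_2) [set w | A i (B (t i.+1) w - B (t i) w)]) =
    (normal_prob 0 (Num.sqrt (s - 0)) `]a1, b1[%classic *
     normal_prob 0 (Num.sqrt (u - s)) `]a2, b2[%classic)%E.
  rewrite (prodB 2%N t A (lexx 0) th mA) !big_ord_recl big_ord0 mule1.
  congr (_ * _)%E; first exact: (lawB 0 s _ (lexx 0) s0 (mA 0%N)).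
  exact: (lawB s u _ (ltW s0) su (mA 1%N)).
have incl : [set w | (x - e < X s w < x + e) /\ (x - e < X u w < x + e)] `<=`
    \bigcap_(i in `I_2) [set w | A i (B (t i.+1) w - B (t i) w)].
  move=> w /= [/andP[H1 H2] /andP[H3 H4]] [|[|//]] _ /=; rewrite in_itv/=.
    rewrite B0 subr0 ltr_pdivrMr// ltr_pdivlMr//; move: H1 H2; rewrite /linear_brownian.
    by move=> ? ?; apply/andP; split; lra.
  rewrite ltr_pdivrMr// ltr_pdivlMr//; move: H1 H2 H3 H4; rewrite /linear_brownian.
  by move=> ? ? ? ?; apply/andP; split; lra.
have mcap : measurable (\bigcap_(i in `I_2) [set w | A i (B (t i.+1) w - B (t i) w)]).
  apply: fin_bigcap_measurable => // i _.
  rewrite -[X in measurable X]setTI.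
  suff : measurable_fun setT (fun w => B (t i.+1) w - B (t i) w)
    by move=> /(_ measurableT _ (mA i)).
  apply: measurable_funB; apply: mB; case: i => [|[|i]] //=; rewrite ?ltW//; exact: lt_trans su.
apply: (@le_trans _ _ (P (\bigcap_(i in `I_2) [set w | A i (B (t i.+1) w - B (t i) w)]))).
  apply: le_measure => //; rewrite inE//.
  by apply: measurableI; apply: measurable_window; rewrite ltW// (lt_trans s0).
rewrite PE.
have sq (y : R) : 0 < y -> 0 < Num.sqrt y by rewrite sqrtr_gt0.
apply: (@le_trans _ _ ((isq s * (b1 - a1))%:E * (isq (u - s) * (b2 - a2))%:E)%E).
  apply: lee_pmul => //.
    rewrite subr0; apply: normal_prob_itv_le; first exact: sq.
    by rewrite ler_pM2r ?invr_gt0//; lra.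
  apply: normal_prob_itv_le; first by rewrite sq// subr_gt0.
  by rewrite ler_pM2r ?invr_gt0//; lra.
rewrite -EFinM lee_fin; apply: eq_leW.
by rewrite /a1 /b1 /a2 /b2; field; rewrite gt_eqF.
Qed.

Variables (t x : R) (t0 : 0 <= t).
Local Notation I := `[0%R, t]%classic.

(** Frozen at time 0 for negative times, as in [measurable_path]. *)
Definition in_window e (z : T * measurableTypeR R) : \bar R :=
  (\1_(`]x - e, x + e[%classic : set R) (X (Num.max z.2 0) z.1))%:E.

Lemma measurable_in_window e : measurable_fun setT (in_window e).
Proof.
have m1 : measurable_fun setT (\1_(`]x - e, x + e[%classic : set R) : R -> R).
  exact: measurable_indic.
apply/measurable_EFinP; exact: (measurableT_comp m1 (measurable_path hB mu sigma)).
Qed.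

(** A symmetric majorant of [two_point]: one of the two terms vanishes, according
to the order of the two times. *)
Definition two_point_kernel (z : measurableTypeR R * measurableTypeR R) : \bar R :=
  (isq z.1 * isq (z.2 - z.1) + isq z.2 * isq (z.1 - z.2))%:E.

Lemma measurable_isq_pair : measurable_fun setT
  (fun z : measurableTypeR R * measurableTypeR R => isq z.1 * isq (z.2 - z.1)).
Proof.
apply: measurable_funM.
  exact: (measurableT_comp (@measurable_isq R) (@measurable_fst _ _ _ _)).
apply: (measurableT_comp (@measurable_isq R)).
exact: (measurable_funB (@measurable_snd _ _ _ _) (@measurable_fst _ _ _ _)).
Qed.

Lemma measurable_two_point_kernel : measurable_fun setT two_point_kernel.
Proof.
have mswap : measurable_fun setT
    (fun z : measurableTypeR R * measurableTypeR R => (z.2, z.1)).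
  exact: (measurable_fun_pair (@measurable_snd _ _ _ _) (@measurable_fst _ _ _ _)).
have m2 := measurableT_comp measurable_isq_pair mswap.
apply/measurable_EFinP; exact: (measurable_funD measurable_isq_pair m2).
Qed.

Lemma integral_two_point_kernel :
  (\int[lam]_(s in I) \int[lam]_(u in I) two_point_kernel (s, u) <=
   (2 * (2 + t) ^+ 2)%:E)%E.
Proof.
pose k1 (z : measurableTypeR R * measurableTypeR R) : \bar R :=
  (isq z.1 * isq (z.2 - z.1))%:E.
have mI : measurable I by exact: measurable_itv.
have mk1 : measurable_fun setT k1.
  by apply/measurable_EFinP; exact: measurable_isq_pair.
have k10 z : (0 <= k1 z)%E by rewrite lee_fin mulr_ge0 ?isq_ge0.
pose k2 (z : measurableTypeR R * measurableTypeR R) : \bar R := k1 (z.2, z.1).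
have mk2 : measurable_fun setT k2.
  by apply: (measurableT_comp mk1); exact: measurable_fun_pair.
have k20 z : (0 <= k2 z)%E by exact: k10.
have t2 : 0 <= 2 + t by rewrite addr_ge0.
have K1 : (\int[lam]_(s in I) \int[lam]_(u in I) k1 (s, u) <= ((2 + t) ^+ 2)%:E)%E.
  apply: (@le_trans _ _ (\int[lam]_(s in I) ((isq s)%:E * (2 + t)%:E))%E).
    apply: ge0_le_integral => //.
    - by move=> s _; exact: integral_ge0.
    - by apply: measurable_funTS; exact: measurable_integral_in.
    - apply: emeasurable_funM => //.
      by apply/measurable_EFinP/measurable_funTS; exact: measurable_isq.
    - move=> s _; rewrite /k1/=; under eq_integral do rewrite EFinM.
      rewrite ge0_integralZl//; last 3 first.
      + apply/measurable_EFinP/measurable_funTS.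
        by apply: (measurableT_comp (@measurable_isq R)); exact: measurable_funB.
      + by move=> u _; rewrite lee_fin isq_ge0.
      + by rewrite lee_fin isq_ge0.
      apply: lee_wpmul2l; first by rewrite lee_fin isq_ge0.
      apply: (le_trans _ (@integral_isq R 1 (- s) t (normr1 _) t0)).
      apply: eq_leW.
      by apply: eq_integral => u _; rewrite mul1r.
  rewrite ge0_integralZr//; last 2 first.
  - by apply/measurable_EFinP/measurable_funTS; exact: measurable_isq.
  - by move=> u _; rewrite lee_fin isq_ge0.
  rewrite expr2 EFinM; apply: lee_wpmul2r; first by rewrite lee_fin.
  apply: (le_trans _ (@integral_isq R 1 0 t (normr1 _) t0)).
  apply: eq_leW.
  by apply: eq_integral => u _; rewrite mul1r addr0.
have K2 : (\int[lam]_(s in I) \int[lam]_(u in I) k2 (s, u) <= ((2 + t) ^+ 2)%:E)%E.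
  by rewrite (fubini_tonelli_in lam lam mI mI mk2 k20).
rewrite (_ : 2 * (2 + t) ^+ 2 = (2 + t) ^+ 2 + (2 + t) ^+ 2); last by ring.
rewrite EFinD; apply: (le_trans _ (leeD K1 K2)).
rewrite -ge0_integralD//; last 4 first.
- by move=> s _; exact: integral_ge0.
- by apply: measurable_funTS; exact: measurable_integral_in.
- by move=> s _; exact: integral_ge0.
- by apply: measurable_funTS; exact: measurable_integral_in.
apply: eq_leW; apply: eq_integral => s _.
rewrite -ge0_integralD//; last 2 first.
- by apply: measurable_funTS; apply: (measurableT_comp mk1); exact: measurable_fun_pair.
- by apply: measurable_funTS; apply: (measurableT_comp mk2); exact: measurable_fun_pair.
Qed.

(** The square of the time spent in the window is a double time integral, whose
expectation is bounded through [two_point].  The bound is of the order of e^2, so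
the approximations of the local time are bounded in mean square. *)
Lemma second_moment e : 0 < e ->
  (\int[P]_w ((\int[lam]_(s in I) in_window e (w, s)) *
              (\int[lam]_(s in I) in_window e (w, s))) <=
   (8 * (e / sigma) ^+ 2 * (2 * (2 + t) ^+ 2))%:E)%E.
Proof.
move=> e0; have mI : measurable I by exact: measurable_itv.
set J := in_window e.
have mJ : measurable_fun setT J := measurable_in_window e.
have J0 z : (0 <= J z)%E by rewrite lee_fin.
pose L w := (\int[lam]_(s in I) J (w, s))%E.
have mL : measurable_fun setT L by exact: measurable_integral_in.
have L0 w : (0 <= L w)%E by exact: integral_ge0.
have mJw w : measurable_fun setT (fun s => J (w, s)).
  by apply: (measurableT_comp mJ); exact: measurable_fun_pair.
have mJs s : measurable_fun setT (fun w => J (w, s)).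
  by apply: (measurableT_comp mJ); exact: measurable_fun_pair.
pose f1 (z : T * measurableTypeR R) := (J z * L z.1)%E.
have mf1 : measurable_fun setT f1.
  by apply: emeasurable_funM => //; exact: (measurableT_comp mL (@measurable_fst _ _ _ _)).
have f10 z : (0 <= f1 z)%E by rewrite mule_ge0.
pose f2 s (z : T * measurableTypeR R) := (J (z.1, s) * J z)%E.
have mf2 s : measurable_fun setT (f2 s).
  by apply: emeasurable_funM => //; exact: (measurableT_comp (mJs s) (@measurable_fst _ _ _ _)).
have f20 s z : (0 <= f2 s z)%E by rewrite mule_ge0.
pose p2 (z : measurableTypeR R * measurableTypeR R) := (\int[P]_w (J (w, z.1) * J (w, z.2)))%E.
have mp2 : measurable_fun setT p2.
  pose h (z : (measurableTypeR R * measurableTypeR R) * T) := (J (z.2, z.1.1) * J (z.2, z.1.2))%E.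
  have mh : measurable_fun setT h.
    apply: emeasurable_funM; apply: (measurableT_comp mJ); apply: measurable_fun_pair => //.
      by apply: measurableT_comp.
    by apply: measurableT_comp.
  have h0 z : (0 <= h z)%E by rewrite mule_ge0.
  exact: (measurable_fun_fubini_tonelli_F (m2 := P) h mh h0).
have p20 z : (0 <= p2 z)%E by apply: integral_ge0 => w _; rewrite mule_ge0.
have -> : (\int[P]_w (L w * L w) = \int[lam]_(s in I) \int[lam]_(u in I) p2 (s, u))%E.
  transitivity (\int[P]_(w in setT) \int[lam]_(s in I) f1 (w, s))%E.
    apply: eq_integral => w _; rewrite /f1/= ge0_integralZr//.
    exact: measurable_funTS.
  rewrite (fubini_tonelli_in P lam measurableT mI mf1 f10).
  apply: eq_integral => s _.
  transitivity (\int[P]_(w in setT) \int[lam]_(u in I) f2 s (w, u))%E.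
    apply: eq_integral => w _; rewrite /f1/= /f2/= ge0_integralZl//.
    exact: measurable_funTS.
  exact: (fubini_tonelli_in P lam measurableT mI (mf2 s) (f20 s)).
pose c : R := 8 * (e / sigma) ^+ 2.
have c0 : 0 <= c by rewrite mulr_ge0 ?sqr_ge0.
have mk := measurable_two_point_kernel.
have k0 z : (0 <= two_point_kernel z)%E.
  by rewrite lee_fin addr_ge0 ?mulr_ge0 ?isq_ge0.
have p2_le s u : 0 < s -> 0 < u -> s != u -> (p2 (s, u) <= c%:E * two_point_kernel (s, u))%E.
  wlog : s u / s < u.
    move=> W s0 u0 su; have [lt|lt|eq] := ltgtP s u; [exact: W| |by rewrite eq eqxx in su].
    have -> : p2 (s, u) = p2 (u, s) by apply: eq_integral => w _; rewrite muleC.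
    have -> : two_point_kernel (s, u) = two_point_kernel (u, s).
      by rewrite /two_point_kernel/= addrC.
    by apply: W => //; rewrite eq_sym.
  move=> su s0 u0 _.
  apply: (le_trans _ (le_trans (two_point x e0 s0 su) _)); last first.
    rewrite -EFinM lee_fin /c ler_wpM2l//= lerDl mulr_ge0 ?isq_ge0//.
  set S := [set w | _].
  have mS : measurable S by apply: measurableI; apply: measurable_window; exact: ltW.
  apply: eq_leW.
  transitivity (\int[P]_w (\1_S w)%:E)%E; last by rewrite integral_indic ?setIT.
  apply: eq_integral => w _.
  rewrite /J /in_window/= !max_l ?ltW// -EFinM; congr EFin.
  rewrite /S !indicE -natrM mulnb; congr (nat_of_bool _)%:R.
  apply/andP/idP; rewrite !inE/= !in_itv/=; first by case.
  by case.
have nn (v : R) : lam.-negligible [set v].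
  by exists [set v]; split => //; exact: lebesgue_measure_set1.
have ae1 : {ae lam, forall s, I s -> (\int[lam]_(u in I) p2 (s, u) <=
    \int[lam]_(u in I) (c%:E * two_point_kernel (s, u)))%E}.
  apply: negligibleS (nn 0) => s /= /not_implyP[]; rewrite in_itv/= => /andP[s0 st] H.
  apply: contrapT => sn0; apply: H.
  have sp : 0 < s by rewrite lt_neqAle s0 andbT eq_sym; exact/eqP.
  apply: ae_ge0_le_integral => //.
  - by apply: measurable_funTS; apply: (measurableT_comp mp2); exact: measurable_fun_pair.
  - by move=> u _; rewrite mule_ge0.
  - apply: measurable_funTS; apply: emeasurable_funM => //.
    by apply: (measurableT_comp mk); exact: measurable_fun_pair.
  have n1 : lam.-negligible ([set (0:R)] `|` [set s]).
    exact: (negligibleU (nn 0) (nn s)).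
  apply: negligibleS n1 => u /= /not_implyP[]; rewrite in_itv/= => /andP[u0 ut] H.
  apply: contrapT => /not_orP[un0 us]; apply: H; apply: p2_le => //.
    by rewrite lt_neqAle u0 andbT eq_sym; exact/eqP.
  by rewrite eq_sym; exact/eqP.
apply: (@le_trans _ _ (\int[lam]_(s in I) \int[lam]_(u in I) (c%:E * two_point_kernel (s, u)))%E).
  apply: ae_ge0_le_integral => //.
  - by move=> s _; exact: integral_ge0.
  - by apply: measurable_funTS; exact: measurable_integral_in.
  - by move=> s _; apply: integral_ge0 => u _; rewrite mule_ge0.
  - apply: measurable_funTS.
    apply: (@measurable_integral_in _ _ _ _ _ lam I (fun z => (c%:E * two_point_kernel z)%E)) => //.
      exact: emeasurable_funM.
    by move=> z; rewrite mule_ge0.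
rewrite (_ : (\int[lam]_(s in I) _)%E =
    (c%:E * \int[lam]_(s in I) \int[lam]_(u in I) two_point_kernel (s, u))%E).
  by rewrite [leRHS]EFinM; apply: lee_wpmul2l => //; exact: integral_two_point_kernel.
rewrite -ge0_integralZl//; last 2 first.
- by apply: measurable_funTS; exact: measurable_integral_in.
- by move=> s _; exact: integral_ge0.
apply: eq_integral => s _; rewrite ge0_integralZl//.
by apply: measurable_funTS; apply: (measurableT_comp mk); exact: measurable_fun_pair.
Qed.

End second_moment.

Section local_time.
Context d (T : measurableType d) (R : realType) (P : probability T R).
Notation lam := (@lebesgue_measure R).
Variables (B : R -> T -> R) (hB : standard_brownian P B).
Variables (mu sigma : R) (sigma0 : 0 < sigma).
Local Notation X := (linear_brownian mu sigma B).

Lemma integral_kap_cells n t : (0 < n)%N -> 0 <= t ->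
  (\int[lam]_(s in `[0%R, t]) (kap (frac n s))%:E <=
   (n%:R^-1 * ((cell n t).+1%:R * 6))%:E)%E.
Proof.
move=> n0 t0.
have mk (k : nat) : measurable_fun setT (fun r : R => (kap r)%:E).
  by apply/measurable_EFinP; exact: measurable_kap.
have k0 (k : nat) (r : R) : (0 <= (kap r)%:E)%E by rewrite lee_fin kap_ge0.
apply: le_trans (integral_cells_le n0 mk k0 t0) _.
rewrite EFinM; apply: lee_wpmul2l; first by rewrite lee_fin invr_ge0.
apply: (@le_trans _ _ (\sum_(i < (cell n t).+1) 6%:E)%E).
  by apply: lee_sum => i _; exact: integral_kap.
by rewrite sumEFin sumr_const card_ord -(mulr_natl (6 : R) _.+1).
Qed.

(** The density of the bridge is the derivative of its distribution function. *)
Lemma itv_dens_cvg n x s w :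
  (2 * m.+1%:R^-1)^-1 * itv_dens B mu sigma n m.+1%:R^-1 x s w @[m --> \oo] -->
  bdens true (@gphi R) n sigma x (fun k => X (k%:R / n%:R)) s w.
Proof.
rewrite /bdens /itv_dens /= expr1.
set b := _ * kap _; set y := x - _ - _.
have b0 : 0 <= b by rewrite !mulr_ge0 ?kap_ge0 ?sqrtr_ge0 ?invr_ge0// ltW.
apply/cvgrPdist_le => e e0; near=> m.
set h : R := m.+1%:R^-1; have h0 : 0 < h by rewrite invr_gt0.
pose c : R := 8 ^+ 4 * (b * h).
have H v : b * (y - h) <= v <= b * (y + h) -> gphi (b * y) - c <= gphi v <= gphi (b * y) + c.
  move=> /andP[v1 v2]; rewrite -ler_distlC.
  apply: le_trans (tame_lip _ _ (@tame_gphi R)) _; rewrite ler_pM2l ?exprn_gt0//.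
  by rewrite ler_norml; apply/andP; split; lra.
have bh : b * (y - h) <= b * (y + h) by apply: ler_wpM2l => //; lra.
have /andP[H1 H2] := PhB_bounds bh H.
have E : b * (y + h) - b * (y - h) = (2 * h) * b by ring.
rewrite E in H1 H2.
rewrite distrC ler_norml.
have bc : b * c <= e.
  have -> : b * c = (b * 8 ^+ 4 * b) * h by rewrite /c; ring.
  rewrite /h; near: m.
  have [z0|z0] := eqVneq (b * 8 ^+ 4 * b) 0.
    by apply: nearW => m; rewrite z0 mul0r ltW.
  have zp : 0 < b * 8 ^+ 4 * b.
    rewrite lt_neqAle eq_sym z0/=; apply: mulr_ge0 => //.
    by apply: mulr_ge0 => //; exact: exprn_ge0.
  have ez : 0 < e / (b * 8 ^+ 4 * b) by rewrite divr_gt0.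
  apply: filterS (near_infty_natSinv_lt (PosNum ez)) => m /= Hm.
  by rewrite mulrC -ler_pdivlMr// ltW.
have h2 : 0 < 2 * h by rewrite mulr_gt0.
set De := Ph _ - Ph _ in H1 H2 *; set g := gphi (b * y) in H1 H2 *.
have A1 : b * g - b * c <= (2 * h)^-1 * De.
  by rewrite ler_pdivlMl//; apply: le_trans H1; apply: eq_leW; ring.
have A2 : (2 * h)^-1 * De <= b * g + b * c.
  by rewrite ler_pdivrMl//; apply: (le_trans H2); apply: eq_leW; ring.
by apply/andP; split; lra.
Unshelve. all: by end_near. Qed.

Variables (L : R -> R -> T -> R) (hL : is_local_time P X L).

(** The limit of [interval_bridge] as the interval shrinks: on the left by
[second_moment_limit], on the right by dominated convergence, [kap] dominating. *)
Lemma local_time_bridge_mean : is_bridge_mean P X sigma true (@gphi R) L.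
Proof.
move=> n t x A n0 t0 oA.
have mA : measurable A by exact: (observations_measurable hB) oA.
have mI : measurable `[0%R, t]%classic by exact: measurable_itv.
have [mL [N [mN PN LN]]] := hL x t0.
pose h m : R := m.+1%:R^-1.
have h0 m : 0 < h m by rewrite invr_gt0.
pose ell m w : R := (2 * h m)^-1 *
  \int[lam]_(s in `[0, t]) \1_(`]x - h m, x + h m[%classic : set R) (X s w).
have ellE m w : (ell m w)%:E =
    ((2 * h m)^-1%:E * \int[lam]_(s in `[0%R, t]) in_window B mu sigma x (h m) (w, s))%E.
  rewrite EFinM (integral_indic_path hB mu sigma w t0 (measurable_itv _)).1.
  congr (_ * _)%E; apply: eq_integral => s; rewrite inE/= in_itv/= => /andP[s0 _].
  by rewrite /in_window/= max_l.
have mW m := measurable_in_window hB mu sigma x (h m).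
have W0 m z : (0 <= in_window B mu sigma x (h m) z)%E by rewrite lee_fin.
have mell m : measurable_fun setT (ell m).
  apply/measurable_EFinP.
  apply: (eq_measurable_fun (fun w => (2 * h m)^-1%:E *
    \int[lam]_(s in `[0%R, t]) in_window B mu sigma x (h m) (w, s))%E).
    by move=> w _; rewrite /= ellE.
  by apply: emeasurable_funM => //; exact: measurable_integral_in.
have ell0 m w : 0 <= ell m w.
  rewrite -lee_fin ellE; apply: mule_ge0; last exact: integral_ge0.
  by rewrite lee_fin invr_ge0 mulr_ge0// ltW.
have h_cvg : h m @[m --> \oo] --> 0^'+.
  move=> U [/= e e0 HU].
  apply: filterS (near_infty_natSinv_lt (PosNum e0)) => m Hm; apply: HU => //=.
  by rewrite sub0r normrN gtr0_norm.
have ell_cvg w : ~ N w -> ell m w @[m --> \oo] --> L t x w.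
  move=> Nw; have : ~ ~ ((2 * e)^-1 * (\int[lam]_(s in `[0, t])
      \1_(`]x - e, x + e[%classic : set R) (X s w)) @[e --> 0^'+] --> L t x w).
    by move=> H; apply: Nw; exact: LN.
  by move=> /contrapT H; apply: cvg_comp h_cvg H.
(* the approximations converge off the null set N only; cutting them there
   leaves their integrals unchanged *)
pose f_ m w := ell m w * \1_(~` N) w.
pose f w := L t x w * \1_(~` N) w.
have mNC : measurable (~` N) by exact: measurableC.
have mf_ m : measurable_fun setT (f_ m).
  by apply: measurable_funM => //; exact: measurable_indic.
have mf : measurable_fun setT f.
  by apply: measurable_funM => //; exact: measurable_indic.
have ae_ind (g : T -> R) : ae_eq P A (EFin \o g) (fun w => (g w * \1_(~` N) w)%:E).
  exists N; split => // w /= /not_implyP[_] H; apply: contrapT => Nw; apply: H.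
  by rewrite indicE mem_set// mulr1.
have mAE (g : T -> R) : measurable_fun setT g -> measurable_fun A (EFin \o g).
  by move=> mg; apply/measurable_EFinP; exact: measurable_funTS.
refine (etrans (@ae_eq_integral _ _ _ P A (EFin \o f) (EFin \o L t x)
  mA (mAE _ mL) (mAE _ mf) (ae_ind (L t x))) _).
apply: (@second_moment_limit _ _ _ P f_ f A
  ((2 * h 0)^-1 ^+ 2 * (8 * (h 0 / sigma) ^+ 2 * (2 * (2 + t) ^+ 2)))) => //.
- by move=> m w; rewrite mulr_ge0.
- move=> w; rewrite /f_ /f indicE; have [wN|wN] := boolP (w \in ~` N).
    under eq_fun do rewrite mulr1; rewrite mulr1; apply: ell_cvg.
    by rewrite inE in wN.
  by under eq_fun do rewrite mulr0; rewrite mulr0; exact: cvg_cst.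
- move=> m.
  have -> : (2 * h 0)^-1 ^+ 2 * (8 * (h 0 / sigma) ^+ 2 * (2 * (2 + t) ^+ 2)) =
      (2 * h m)^-1 ^+ 2 * (8 * (h m / sigma) ^+ 2 * (2 * (2 + t) ^+ 2)).
    by field; rewrite !gt_eqF.
  apply: (@le_trans _ _ (\int[P]_w (ell m w ^+ 2)%:E)%E).
    apply: ge0_le_integral => //.
    - by move=> w _; rewrite lee_fin sqr_ge0.
    - by apply/measurable_EFinP; exact: measurable_funX.
    - by apply/measurable_EFinP; exact: measurable_funX.
    - move=> w _; have f0 : 0 <= f_ m w by apply: mulr_ge0.
      rewrite lee_fin; apply: lerXn2r; rewrite ?nnegrE//.
      by rewrite /f_ ler_piMr// indicE; case: (_ \in _).
  have E w : (ell m w ^+ 2)%:E = (((2 * h m)^-1 ^+ 2)%:E *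
      (\int[lam]_(s in `[0%R, t]) in_window B mu sigma x (h m) (w, s) *
       \int[lam]_(s in `[0%R, t]) in_window B mu sigma x (h m) (w, s)))%E.
    by rewrite [in LHS]expr2 EFinM ellE muleACA -EFinM -expr2.
  under eq_integral do rewrite E.
  have mLL : measurable_fun setT
      (fun w => \int[lam]_(s in `[0%R, t]) in_window B mu sigma x (h m) (w, s))%E.
    exact: measurable_integral_in.
  have LL0 w : (0 <= \int[lam]_(s in `[0%R, t]) in_window B mu sigma x (h m) (w, s))%E.
    exact: integral_ge0.
  rewrite ge0_integralZl//; last 3 first.
  - exact: emeasurable_funM.
  - by move=> w _; rewrite mule_ge0.
  - by rewrite lee_fin sqr_ge0.
  rewrite [leRHS]EFinM; apply: lee_wpmul2l; first by rewrite lee_fin sqr_ge0.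
  exact: (second_moment hB mu sigma0 x t0 (h0 m)).
pose D m s w := (2 * h m)^-1 * itv_dens B mu sigma n (h m) x s w.
have D_ge0 m s w : 0 <= D m s w.
  apply: mulr_ge0; first by rewrite invr_ge0 mulr_ge0// ltW.
  by have /andP[] := itv_dens_bounds B mu sigma0 n x s w (ltW (h0 m)).
have mD m : measurable_fun setT (fun z : T * measurableTypeR R => (D m z.2 z.1)%:E).
  apply/measurable_EFinP; apply: measurable_funM => //.
  exact: (measurable_itv_dens hB mu sigma).
have D0 m (z : T * measurableTypeR R) : (0 <= (D m z.2 z.1)%:E)%E by rewrite lee_fin.
have mDw m w : measurable_fun setT (fun s => (D m s w)%:E).
  exact: (measurableT_comp (mD m) (pair1_measurable w)).
have intD m : (\int[P]_(w in A) (f_ m w)%:E =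
    \int[P]_(w in A) \int[lam]_(s in `[0%R, t]) (D m s w)%:E)%E.
  refine (etrans (esym (@ae_eq_integral _ _ _ P A (EFin \o f_ m) (EFin \o ell m)
    mA (mAE _ (mell m)) (mAE _ (mf_ m)) (ae_ind (ell m)))) _).
  transitivity ((2 * h m)^-1%:E * \int[P]_(w in A) \int[lam]_(s in `[0%R, t])
     (\1_(`](x - h m)%R, (x + h m)%R[%classic : set R) (X s w))%:E)%E.
    transitivity (\int[P]_(w in A) ((2 * h m)^-1%:E *
        \int[lam]_(s in `[0%R, t]) in_window B mu sigma x (h m) (w, s)))%E.
      by apply: eq_integral => w _; exact: ellE.
    have mWI := measurable_integral_in lam mI (mW m) (W0 m).
    have WI0 w : (0 <= \int[lam]_(s in `[0%R, t]) in_window B mu sigma x (h m) (w, s))%E.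
      exact: integral_ge0.
    refine (etrans (ge0_integralZl P mA (measurable_funTS mWI) (fun w _ => WI0 w) _) _).
      by rewrite lee_fin invr_ge0 mulr_ge0// ltW.
    refine (congr1 (mule _) _); apply: eq_integral => w _.
    apply: eq_integral => s; rewrite inE/= in_itv/= => /andP[s0 _].
    by rewrite /in_window /= max_l.
  have IB := interval_bridge hB sigma0 x n0 t0 oA (ltW (h0 m)).
  refine (etrans (congr1 (mule _) IB) _).
  have c0 : 0 <= (2 * h m)^-1 by rewrite invr_ge0 mulr_ge0// ltW.
  pose V (z : T * measurableTypeR R) : \bar R := (itv_dens B mu sigma n (h m) x z.2 z.1)%:E.
  have mV : measurable_fun setT V.
    by apply/measurable_EFinP; exact: (measurable_itv_dens hB mu sigma).
  have V0 z : (0 <= V z)%E.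
    by rewrite lee_fin; have /andP[] := itv_dens_bounds B mu sigma0 n x z.2 z.1 (ltW (h0 m)).
  have mVw w : measurable_fun `[0%R, t]%classic (fun s => V (w, s)).
    by apply: measurable_funTS; exact: (measurableT_comp mV (pair1_measurable w)).
  have mVI := measurable_integral_in lam mI mV V0.
  have VI0 w : (0 <= \int[lam]_(s in `[0%R, t]) V (w, s))%E by exact: integral_ge0.
  refine (etrans (esym (ge0_integralZl P mA (measurable_funTS mVI) (fun w _ => VI0 w) _)) _).
    by rewrite lee_fin.
  apply: eq_integral => w _.
  refine (etrans (esym (ge0_integralZl lam mI (mVw w) (fun s _ => V0 _) _)) _).
    by rewrite lee_fin.
  by apply: eq_integral => s _; rewrite /D EFinM.
pose b s := Num.sqrt n%:R / sigma * kap (frac n s).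
have b_ge0 s : 0 <= b s.
  by rewrite !mulr_ge0 ?kap_ge0 ?sqrtr_ge0 ?invr_ge0// ltW.
have D_le m s w : D m s w <= b s.
  have /andP[_ H] := itv_dens_bounds B mu sigma0 n x s w (ltW (h0 m)).
  by rewrite /D mulrC ler_pdivrMr ?mulr_gt0.
have mb : measurable_fun setT (fun s => (b s)%:E).
  apply/measurable_EFinP; apply: measurable_funM => //.
  exact: (measurableT_comp measurable_kap (measurable_frac n)).
pose C : R := Num.sqrt n%:R / sigma * (n%:R^-1 * ((cell n t).+1%:R * 6)).
have bC : (\int[lam]_(s in `[0%R, t]) (b s)%:E <= C%:E)%E.
  rewrite /b /C; under eq_integral do rewrite EFinM.
  have c0 : 0 <= Num.sqrt n%:R / sigma by rewrite divr_ge0 ?sqrtr_ge0// ltW.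
  rewrite ge0_integralZl//; last 2 first.
  - apply/measurable_EFinP/measurable_funTS.
    exact: (measurableT_comp measurable_kap (measurable_frac n)).
  - by move=> s _; rewrite lee_fin kap_ge0.
  rewrite [leRHS]EFinM; apply: lee_wpmul2l; first by rewrite lee_fin.
  exact: integral_kap_cells.
under eq_fun do rewrite intD.
apply: (@dominated_cvg _ T R P A mA _ _ (EFin \o cst C)).
- by move=> m; apply: measurable_funTS; exact: (measurable_integral_in lam mI (mD m) (D0 m)).
- move=> w _.
  apply: (@dominated_cvg _ _ R lam `[0%R, t]%classic mI (fun m s => (D m s w)%:E) _ (EFin \o b)).
  + by move=> m; apply: measurable_funTS; exact: mDw.
  + move=> s _; apply: cvg_EFin; first exact: nearW.
    exact: itv_dens_cvg.
  + by [].
  + apply/integrableP; split; first exact: measurable_funTS.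
    under eq_integral do rewrite gee0_abs ?lee_fin//.
    exact: le_lt_trans bC (ltry _).
  + by move=> m s _; rewrite /= lee_fin ger0_norm.
- by [].
- exact: finite_measure_integrable_cst.
- move=> m w _; rewrite gee0_abs; last by apply: integral_ge0 => s _; rewrite lee_fin.
  apply: le_trans bC; apply: ge0_le_integral => //.
  + by move=> s _; rewrite lee_fin.
  + by apply: measurable_funTS; exact: mDw.
  + exact: measurable_funTS.
  + by move=> s _; rewrite lee_fin.
Qed.

End local_time.

(** * Continuous versions of the conditional means *)

Section unique.
Context d (T : measurableType d) (R : realType) (P : probability T R).
Variable G : set (set T).
Hypothesis Gm : <<s G >> `<=` measurable.
Local Notation TG := (g_sigma_algebraType G).

(** The event where [Z1] exceeds [Z2] is in the sigma-algebra, and the difference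
integrates to 0 over it. *)
Lemma cond_exp_le (Z1 Z2 : T -> R) :
  measurable_fun setT (Z1 : TG -> R) -> measurable_fun setT (Z2 : TG -> R) ->
  P.-integrable setT (EFin \o Z1) -> P.-integrable setT (EFin \o Z2) ->
  (forall A, <<s G >> A ->
     (\int[P]_(w in A) (Z1 w)%:E = \int[P]_(w in A) (Z2 w)%:E)%E) ->
  {ae P, forall w, Z1 w <= Z2 w}.
Proof.
move=> m1 m2 i1 i2 E.
pose A : set T := [set w | 0 < Z1 w - Z2 w].
have mA : <<s G >> A.
  have := measurable_funB m1 m2 measurableT (measurable_itv `]0, +oo[).
  rewrite setTI; congr (measurable _).
  by apply/seteqP; split => w /=; rewrite in_itv/= andbT.
have mAT : measurable A by exact: Gm.
have i1A : P.-integrable A (EFin \o Z1) by exact: integrableS i1.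
have i2A : P.-integrable A (EFin \o Z2) by exact: integrableS i2.
have iB := integrableB mAT i1A i2A.
have I0 : (\int[P]_(w in A) ((EFin \o Z1) w - (EFin \o Z2) w) = 0)%E.
  rewrite integralB// /= E//; apply: subee.
  exact: integrable_fin_num.
have I1 : (\int[P]_(w in A) `|(EFin \o Z1) w - (EFin \o Z2) w| = 0)%E.
  rewrite -[RHS]I0; apply: eq_integral => w; rewrite inE => Aw.
  by rewrite gee0_abs// -EFinB lee_fin ltW.
have mB := measurable_int _ iB.
have [N [mN PN HN]] := (ae_eq_integral_abs P mAT mB).1 I1.
exists N; split => // w /= /negP; rewrite -ltNge => lt.
apply: HN => /= H; have Aw : A w by rewrite /A/= subr_gt0.
by have := H Aw; rewrite -EFinB => -[] /eqP; rewrite gt_eqF.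
Qed.

Lemma cond_exp_unique (Z1 Z2 : T -> R) :
  measurable_fun setT (Z1 : TG -> R) -> measurable_fun setT (Z2 : TG -> R) ->
  P.-integrable setT (EFin \o Z1) -> P.-integrable setT (EFin \o Z2) ->
  (forall A, <<s G >> A ->
     (\int[P]_(w in A) (Z1 w)%:E = \int[P]_(w in A) (Z2 w)%:E)%E) ->
  {ae P, forall w, Z1 w = Z2 w}.
Proof.
move=> m1 m2 i1 i2 E.
have H1 := cond_exp_le m1 m2 i1 i2 E.
have H2 := cond_exp_le m2 m1 i2 i1 (fun A GA => esym (E A GA)).
by apply: filterS2 H1 H2 => w le1 le2; apply: le_anti; rewrite le1.
Qed.

End unique.

Section kern_facts.
Context {R : realType}.
Notation lam := (@lebesgue_measure R).
Variables (p : bool) (H : R -> R).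
Hypotheses (cH : continuous H) (H01 : forall u, 0 <= H u <= 1).

Let mH : measurable_fun setT H. Proof. exact: continuous_measurable_fun. Qed.

Lemma kern0 a z : kern p H 0 a z = 0.
Proof. by rewrite /kern set_itv1 Rintegral_set1. Qed.

(** Continuity under the integral sign, with 1 + kap dominating. *)
Lemma kern_continuous s a : s <= 1 -> continuous (kern p H s a).
Proof.
move=> s1 z.
pose f (z r : R) : R := kap r ^+ p * H (kap r * (a - r * z)).
have H0 u : 0 <= H u by case/andP: (H01 u).
have mf y : measurable_fun setT (f y).
  apply: eq_measurable_fun (measurable_kern_integrand p mH 1 a y) => r _.
  by rewrite /f mul1r.
have f0 y r : 0 <= f y r by rewrite mulr_ge0 ?exprn_ge0 ?kap_ge0.
have f_le y r : f y r <= 1 + kap r.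
  rewrite (le_trans _ (exprb_le p (kap_ge0 r)))//.
  by rewrite ler_piMr ?exprn_ge0 ?kap_ge0//; case/andP: (H01 (kap r * (a - r * y))).
have mk : measurable_fun setT (fun r : R => 1 + kap r).
  by apply: measurable_funD => //; exact: measurable_kap.
have ik : lam.-integrable `[0, s]%classic (EFin \o (fun r => 1 + kap r)).
  apply: (@integrableS _ _ _ lam `[0, 1]%classic) => //.
    by apply: subset_itvl; rewrite bnd_simp.
  apply/integrableP; split; first exact/measurable_EFinP/measurable_funTS.
  under eq_integral do rewrite gee0_abs ?lee_fin ?addr_ge0 ?kap_ge0//.
  exact: le_lt_trans integral_kap1 (ltry _).
have := @continuity_under_integral R _ _ lam f `[0, s]%classic (measurable_itv _)
  (z - 1) (z + 1) _ _ (fun r => 1 + kap r) ik _ z.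
apply.
- move=> y _; apply: (le_integrable _ _ _ ik) => //.
    by apply/measurable_EFinP/measurable_funTS; exact: mf.
  by move=> r _; rewrite /= lee_fin !ger0_norm// addr_ge0// kap_ge0.
- apply: aeW => r _ y _.
  apply: cvgM; first exact: cvg_cst.
  apply: (@cvg_comp _ _ _ (fun l => kap r * (a - r * l)) H
    _ (nbhs (kap r * (a - r * y)))); last exact: cH.
  apply: cvgM; first exact: cvg_cst.
  by apply: cvgB; [exact: cvg_cst|apply: cvgM; [exact: cvg_cst|exact: cvg_id]].
- by move=> y _; apply: aeW => r _; rewrite ger0_norm.
- by rewrite inE/= in_itv/=; apply/andP; split; lra.
Qed.

End kern_facts.

Section identify.
Context d (T : measurableType d) (R : realType) (P : probability T R).
Notation lam := (@lebesgue_measure R).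
Variables (B : R -> T -> R) (hB : standard_brownian P B).
Variables (mu sigma : R) (sigma0 : 0 < sigma).
Local Notation X := (linear_brownian mu sigma B).
Variables (p : bool) (H : R -> R).
Hypotheses (cH : continuous H) (H01 : forall u, 0 <= H u <= 1).
Variables (Y : R -> R -> T -> R) (hY : is_bridge_mean P X sigma p H Y).

Let mH : measurable_fun setT H. Proof. exact: continuous_measurable_fun. Qed.

(** The estimator computed with scale [c]: the conditional mean when c = sigma, the
plug-in estimator when c is the estimate of sigma. *)
Definition bmean (n : nat) (c x t : R) (w : T) : R :=
  n%:R^-1 * (Num.sqrt n%:R / c) ^+ p * increment_sum (kern p H) X n c x t w.

Local Notation Xg n := (fun k : nat => X (k%:R / n%:R)).

Lemma bmeanE n c x t w : (0 < n)%N -> 0 < c -> 0 <= t ->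
  (bmean n c x t w)%:E = (\int[lam]_(s in `[0%R, t]) (bdens p H n c x (Xg n) s w)%:E)%E.
Proof. by move=> n0 c0 t0; rewrite (integral_bdens _ mH H01). Qed.

Definition obs_gen n : set (set T) :=
  [set A | exists i U, measurable U /\ A = X (i.+1%:R / n%:R) @^-1` U].

Lemma measurable_grid_obs n k :
  measurable_fun setT (X (k%:R / n%:R) : g_sigma_algebraType (obs_gen n) -> R).
Proof.
case: k => [|k].
  have [_ B0 _ _ _] := hB.
  apply: (eq_measurable_fun (cst (0 : R))); last exact: measurable_cst.
  by move=> w _; rewrite /linear_brownian mul0r B0 !mulr0 addr0.
move=> _ U mU; rewrite setTI; apply: sub_sigma_algebra.
by exists k, U.
Qed.

Lemma measurable_bmean_obs n c x t : (0 < n)%N -> 0 < c -> 0 <= t ->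
  measurable_fun setT (bmean n c x t : g_sigma_algebraType (obs_gen n) -> R).
Proof.
move=> n0 c0 t0; apply/measurable_EFinP.
pose f (z : g_sigma_algebraType (obs_gen n) * measurableTypeR R) :=
  (bdens p H n c x (Xg n) z.2 z.1)%:E.
have mf : measurable_fun setT f.
  apply/measurable_EFinP.
  exact: (measurable_bdens p mH n c x (@measurable_grid_obs n)).
have f0 z : (0 <= f z)%E by rewrite lee_fin bdens_ge0// ltW.
have := measurable_integral_in lam (measurable_itv `[0, t]) mf f0.
by apply: eq_measurable_fun => w _; rewrite /= bmeanE.
Qed.

Lemma bmean_ge0 n c x t w : (0 < n)%N -> 0 < c -> 0 <= t -> 0 <= bmean n c x t w.
Proof.
move=> n0 c0 t0; rewrite -lee_fin bmeanE//; apply: integral_ge0 => s _.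
by rewrite lee_fin bdens_ge0// ltW.
Qed.

(** The integral over the whole space inherits finiteness from [Y], by the bridge
formula. *)
Lemma bmean_cond_exp n x t : (0 < n)%N -> 0 <= t ->
  P.-integrable setT (EFin \o Y t x) ->
  P.-integrable setT (EFin \o bmean n sigma x t) /\
  forall A, observations X n A ->
    (\int[P]_(w in A) (bmean n sigma x t w)%:E = \int[P]_(w in A) (Y t x w)%:E)%E.
Proof.
move=> n0 t0 iY.
have E A : observations X n A ->
    (\int[P]_(w in A) (bmean n sigma x t w)%:E = \int[P]_(w in A) (Y t x w)%:E)%E.
  move=> oA; refine (etrans _ (esym (hY x n0 t0 oA))); apply: eq_integral => w _; exact: bmeanE.
split => //; apply/integrableP; split.
  apply/measurable_EFinP.
  have := measurable_bmean_obs x n0 sigma0 t0 => m1.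
  apply: (measurableT_comp m1); exact: (measurable_id_sub (observations_measurable hB (n := n))).
under eq_integral do rewrite gee0_abs ?lee_fin ?bmean_ge0//.
rewrite E; last first.
  by have := @measurableT _ (g_sigma_algebraType (obs_gen n)).
have := integrable_fin_num measurableT iY.
by move/fin_numPlt => /andP[].
Qed.

Lemma bmean_continuous n c x t w : (0 < n)%N -> 0 < c -> 0 <= t ->
  {within `[0, t], continuous (fun s => bmean n c x s w)}.
Proof.
move=> n0 c0 t0.
have mY k : measurable_fun setT (Xg n k).
  by apply: (measurable_X hB); rewrite divr_ge0.
have mf : measurable_fun setT (fun s => bdens p H n c x (Xg n) s w).
  exact: (measurableT_comp (measurable_bdens p mH n c x mY) (pair1_measurable w)).
have f0 s : 0 <= bdens p H n c x (Xg n) s w by rewrite bdens_ge0// ltW.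
have i1 : lam.-integrable `[0, t]%classic (EFin \o (fun s => bdens p H n c x (Xg n) s w)).
  apply/integrableP; split; first exact/measurable_EFinP/measurable_funTS.
  under eq_integral do rewrite gee0_abs ?lee_fin//.
  by rewrite -bmeanE// ltry.
have := parameterized_integral_continuous t0 i1.
apply: subspace_eq_continuous => s; rewrite inE/= in_itv/= => /andP[s0 _].
by apply: EFin_inj; rewrite bmeanE// /parameterized_integral /Rintegral fineK// -bmeanE.
Qed.

Lemma within_continuous_grid (f : R -> R) t : 0 <= t ->
  {within `[0, t], continuous f} ->
  f ((cell m.+1 t)%:R / m.+1%:R) @[m --> \oo] --> f t.
Proof.
move=> t0 /subspace_continuousP /(_ t).
have tI : `[0, t]%classic t by rewrite /= in_itv/= t0 lexx.
move=> /(_ tI) cf; apply: cvg_comp cf => U /= [e /= e0 HU].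
apply: filterS (near_infty_natSinv_lt (PosNum e0)) => m Hm.
have m0 : 0 < m.+1%:R :> R by [].
have /andP[H1 H2] := frac_itv m.+1 t0.
have E : t - (cell m.+1 t)%:R / m.+1%:R = frac m.+1 t / m.+1%:R.
  by rewrite /frac; field; rewrite gt_eqF.
have E0 : 0 <= frac m.+1 t / m.+1%:R by rewrite divr_ge0.
apply: HU => /=; last by rewrite in_itv/= divr_ge0//= -subr_ge0 E.
rewrite E ger0_norm//; apply: le_lt_trans Hm.
by rewrite ler_piMl ?invr_ge0// ltW.
Qed.

(** At each time the two sides are versions of the same conditional expectation.
They agree almost surely at all rational times, and both are continuous in time. *)
Lemma cond_mean_process_eq n x (Z : R -> T -> R) : (0 < n)%N ->
  is_cond_mean_process P X n (fun t => Y t x) Z ->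
  {ae P, forall w, forall t, 0 <= t -> Z t w = bmean n sigma x t w}.
Proof.
move=> n0 [ceZ cZ].
have Et t : 0 <= t -> {ae P, forall w, Z t w = bmean n sigma x t w}.
  move=> t0; have [iY iZ mZ eZ] := ceZ t t0.
  have [ib eb] := bmean_cond_exp n0 t0 iY.
  apply: (@cond_exp_unique _ _ _ P (obs_gen n)) => //.
  - exact: (observations_measurable hB).
  - by move=> _ U mU; rewrite setTI; exact: mZ.
  - exact: measurable_bmean_obs.
  - by move=> A oA; rewrite eZ// eb.
have Eall : {ae P, forall w, forall m k : nat,
    Z (k%:R / m.+1%:R) w = bmean n sigma x (k%:R / m.+1%:R) w}.
  by apply/ae_foralln => m; apply/ae_foralln => k; apply: Et; rewrite divr_ge0.
apply: filterS2 cZ Eall => w cZw Ew t t0.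
have c1 : {within `[0, t], continuous (fun s => Z s w)}.
  by apply: continuous_subspaceW cZw; apply: subset_itvl; rewrite bnd_simp.
have c2 := @bmean_continuous n sigma x t w n0 sigma0 t0.
have l1 := within_continuous_grid t0 c1.
have l2 := within_continuous_grid t0 c2.
rewrite -(cvg_lim _ l1)// -(cvg_lim _ l2)//.
by congr (limn _); apply/funext => m; exact: Ew.
Qed.

End identify.

(** * The functions g and G *)

Lemma linear_brownian01 (R : realType) (T : Type) (W : R -> T -> R) :
  linear_brownian 0 1 W = W.
Proof.
by apply/funext => t; apply/funext => w; rewrite /linear_brownian mul0r add0r mul1r.
Qed.

Section kernel_identification.
Context d (T : measurableType d) (R : realType) (P : probability T R).
Variables (W : R -> T -> R) (hW : standard_brownian P W).
Variables (p : bool) (H : R -> R).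
Hypotheses (cH : continuous H) (H01 : forall u, 0 <= H u <= 1).
Variables (Y : R -> R -> T -> R).
Hypothesis hY : is_bridge_mean P (linear_brownian 0 1 W) 1 p H Y.

(** With one observation at time 1 only the incomplete cell contributes, except
when s = 1. *)
Lemma bmean_unit_interval s x w : 0 <= s <= 1 ->
  bmean W 0 1 p H 1 1 x s w = kern p H s x (W 1 w).
Proof.
move=> /andP[s0 s1]; have [_ W0 _ _ _] := hW.
rewrite /bmean sqrtr1 divr1 expr1n invr1 !mul1r linear_brownian01 /increment_sum.
rewrite mul1r sqrtr1 divr1.
move: s1; rewrite le_eqVlt => /predU1P[->|s1].
  rewrite truncn1 big_ord_recl big_ord0 subrr kern0 !addr0 mul0r divr1 W0 !subr0.
  by rewrite !mul1r.
have -> : Num.truncn s = 0%N by apply/truncn0Pn; rewrite -ltNge.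
by rewrite big_ord0 add0r subr0 mul0r divr1 W0 !subr0 !mul1r.
Qed.

Lemma gphi_gt_on (z e : R) : exists2 lo : R, 0 < lo &
  forall v, z - e <= v <= z + e -> lo <= gphi v.
Proof.
pose M := `|z| + `|e|.
exists (gphi M).
  by rewrite gphiE mulr_gt0 ?expR_gt0// invr_gt0 sqrtr_gt0 pmulrn_lgt0// pi_gt0.
move=> v /andP[v1 v2]; rewrite !gphiE.
apply: ler_wpM2l; first by rewrite invr_ge0 sqrtr_ge0.
rewrite ler_expR lerN2 ler_pM2r ?invr_gt0//.
have vM : `|v| <= `|M|.
  rewrite [leRHS]ger0_norm ?addr_ge0// ler_norml.
  have := ler_norm z; have := ler_norm (- z); have := ler_norm e; rewrite /M normrN.
  by move=> ? ? ?; apply/andP; split; lra.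
by rewrite -(real_normK (num_real v)) -(real_normK (num_real M)) lerXn2r ?nnegrE.
Qed.

(** For n = 1 the observations contain W 1, so that [h s a] and [kern] agree almost
surely at W 1.  Both are continuous and W 1 charges every interval, hence they
agree everywhere. *)
Lemma cond_mean_at_1_kern h : is_cond_mean_at_1 P W Y h ->
  forall s a z, 0 <= s <= 1 -> h s a z = kern p H s a z.
Proof.
move=> hh s a z s01; have /andP[s0 s1] := s01.
have [ch [iY iZ mZ eZ]] := hh s a s01.
(* generates the sigma-algebra of W 1, inside that of the observations for n = 1 *)
pose G : set (set T) := [set A | exists (_ : unit) U, measurable U /\ A = W 1 @^-1` U].
have EX : linear_brownian 0 1 W (1%:R / 1%:R) = W 1.
  by rewrite linear_brownian01 divr1.
have Gobs : G `<=` obs_gen W 0 1 1.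
  by move=> _ [_ [U [mU ->]]]; exists 0%N, U; rewrite EX.
have sGobs := @sub_sigma_algebra2 _ setT _ _ Gobs.
have Gm : <<s G >> `<=` measurable.
  by move=> A /sGobs; exact: (observations_measurable hW).
have [ib eb] := bmean_cond_exp hW ltr01 cH H01 hY (ltn0Sn 0) s0 iY.
have ck := @kern_continuous R p H cH H01 s a s1.
have mW1 : measurable_fun setT (W 1 : g_sigma_algebraType G -> R).
  move=> _ U mU; rewrite setTI; apply: sub_sigma_algebra; by exists tt, U.
have bE w : bmean W 0 1 p H 1 1 a s w = kern p H s a (W 1 w) by exact: bmean_unit_interval.
have ae_eq : {ae P, forall w, h s a (W 1 w) = kern p H s a (W 1 w)}.
  apply: (@cond_exp_unique _ _ _ P G Gm) => //.
  - by move=> _ U mU; rewrite setTI; exact: mZ.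
  - apply: (measurableT_comp _ mW1); exact: continuous_measurable_fun.
  - apply: eq_integrable ib => // w _; by rewrite /= bE.
  - move=> A GA; rewrite eZ//; rewrite -eb; last exact: sGobs.
    by apply: eq_integral => w _; rewrite bE.
apply: contrapT => ne.
pose D y := h s a y - kern p H s a y.
have Dz : D z != 0 by rewrite subr_eq0; exact/eqP.
have cD : {for z, continuous D} by apply: cvgB; [exact: ch|exact: ck].
have nD : \forall y \near z, D y != 0.
  exact: (cvgr_neq0 _ cD Dz).
have [e /= e0 He] := nD.
have [N [mN PN HN]] := ae_eq.
have sub : [set w | `]z - e, z + e[%classic (W 1 w - W 0 w)] `<=` N.
  have [_ W0 _ _ _] := hW.
  move=> w /=; rewrite W0 subr0 in_itv/= => /andP[w1 w2].
  apply: HN => /= E; have := He (W 1 w); rewrite /= /D E subrr eqxx.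
  have B : `|z - W 1 w| < e by rewrite ltr_norml; apply/andP; split; lra.
  by move/(_ B).
have [_ _ _ _ lawW] := hW.
have mI : measurable `]z - e, z + e[%classic by exact: measurable_itv.
have PE := lawW 0 1 `]z - e, z + e[%classic (lexx _) ltr01 mI.
have [lo lo0 Hlo] := gphi_gt_on z e.
have : (0 < P [set w | `]z - e, z + e[%classic (W 1 w - W 0 w)]%R)%E.
  rewrite PE subr0 sqrtr1 normal_prob_itv//; last by lra.
  rewrite lte_fin invr1 !mul1r !subr0.
  have le : z - e <= z + e by lra.
  have Hb v : z - e <= v <= z + e -> lo <= gphi v <= 1.
    by move=> Hv; rewrite Hlo// gphi_le1.
  have /andP[H1 _] := PhB_bounds le Hb.
  by apply: lt_le_trans H1; rewrite mulr_gt0//; lra.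
apply/negP; rewrite -leNgt -PN; apply: le_measure => //; rewrite inE//.
have [mB _ _ _ _] := hW.
rewrite -[X in measurable X]setTI.
suff : measurable_fun setT (fun w => W 1 w - W 0 w) by apply.
by apply: measurable_funB; exact: mB.
Qed.

End kernel_identification.

(** * Sensitivity of the estimators to the scale *)

Section smoothing.
Context {R : realType}.
Variables (p : bool) (H : R -> R).

Variables (K : R) (K0 : 0 <= K) (tH : tame p H K).
Hypotheses (H01 : forall u, 0 <= H u <= 1).

Lemma tame_dist m a b : 0 <= m -> m <= `|a| -> m <= `|b| -> 0 <= a * b ->
  `|H a - H b| <= K * `|b - a| / (1 + m ^+ 2) ^+ 2.
Proof.
move=> m0; wlog ab : a b / a <= b.
  move=> W ma mb s; have [|/ltW ba] := leP a b; first by move=> ab; exact: W.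
  by rewrite distrC (distrC b); apply: W => //; rewrite mulrC.
move=> ma mb s; rewrite (ger0_norm (_ : 0 <= b - a)) ?subr_ge0//.
apply: tH.1 => // v /andP[av vb].
have [a0|a0] := leP 0 a.
  by rewrite (ger0_norm a0) in ma; rewrite ger0_norm; lra.
have [b0|b0] := ltP 0 b; first by nra.
by rewrite (ler0_norm b0) in mb; rewrite ler0_norm; lra.
Qed.

Variables (sigma : R) (sigma0 : 0 < sigma).

(** Collects the coefficients of [scale_dist]: 4 K / sigma comes from the increment
of H when p is false; when p is true it becomes 4 K / sigma^2, to which the
variation of the prefactor adds 2 K / sigma^2; the last factor turns the distance
|u| / (2 sigma) from the origin into |u|. *)
Definition smooth_const : R := (4 * K / sigma + 6 * K / sigma ^+ 2) * (1 + 4 * sigma ^+ 2).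

Lemma smooth_const_ge0 : 0 <= smooth_const.
Proof.
apply: mulr_ge0; last by rewrite addr_ge0// mulr_ge0// sqr_ge0.
by rewrite addr_ge0// divr_ge0 ?mulr_ge0 ?exprn_ge0// ltW.
Qed.

(** For c between sigma / 2 and 3 sigma / 2, the points u / sigma and u / c are on
the same side of the origin, at distance at least |u| / (2 sigma) from it, and
they differ by at most 2 |u| |sigma - c| / sigma^2.  One power of the decay
absorbs |u|. *)
Lemma scale_dist c u : `|sigma - c| <= sigma / 2 ->
  `|sigma^-1 ^+ p * H (u / sigma) - c^-1 ^+ p * H (u / c)| <=
  smooth_const * `|sigma - c| / (1 + u ^+ 2).
Proof.
move=> sc; have /andP[c1 c2] : sigma / 2 <= c <= 3 * sigma / 2.
  by move: sc; rewrite ler_norml => /andP[? ?]; apply/andP; split; lra.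
have c0 : 0 < c by apply: lt_le_trans c1; rewrite divr_gt0.
(* the distance from the origin of both u / sigma and u / c is at least m *)
pose m := `|u| / (2 * sigma).
have m0 : 0 <= m by rewrite divr_ge0// mulr_ge0// ltW.
have uE : `|u| = 2 * sigma * m by rewrite /m; field; rewrite gt_eqF.
have ma : m <= `|u / sigma|.
  rewrite normrM normfV (gtr0_norm sigma0) /m ler_wpM2l// lef_pV2 ?posrE ?mulr_gt0//.
  by lra.
have mb : m <= `|u / c|.
  rewrite normrM normfV (gtr0_norm c0) /m ler_wpM2l// lef_pV2 ?posrE ?mulr_gt0//.
  by lra.
have sgn : 0 <= (u / sigma) * (u / c).
  by rewrite mulrACA -expr2 mulr_ge0 ?sqr_ge0// mulr_ge0// invr_ge0 ltW.
have cinv : c^-1 <= 2 / sigma.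
  by rewrite -invf_div lef_pV2 ?posrE// divr_gt0.
set e := `|sigma - c|; have e0 : 0 <= e by exact: normr_ge0.
have m2 : 0 <= m ^+ 2 by exact: sqr_ge0.
have p1 : 0 < 1 + m ^+ 2 by lra.
have D1 : `|sigma^-1 - c^-1| <= 2 * e / sigma ^+ 2.
  have -> : sigma^-1 - c^-1 = (c - sigma) * (sigma^-1 * c^-1).
    by field; rewrite !gt_eqF.
  rewrite normrM distrC -/e (ger0_norm (_ : 0 <= sigma^-1 * c^-1)); last first.
    by rewrite mulr_ge0// invr_ge0 ltW.
  rewrite (_ : 2 * e / sigma ^+ 2 = e * (sigma^-1 * (2 / sigma))); last first.
    by field; rewrite gt_eqF.
  by apply: ler_wpM2l => //; apply: ler_wpM2l => //; rewrite invr_ge0 ltW.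
have D2 : `|H (u / sigma) - H (u / c)| <= 4 * K / sigma * e / (1 + m ^+ 2).
  apply: le_trans (tame_dist m0 ma mb sgn) _.
  have -> : `|u / c - u / sigma| = 2 * sigma * m * `|sigma^-1 - c^-1|.
    by rewrite -mulrBr normrM uE distrC.
  apply: (@le_trans _ _ (K * (2 * sigma * m * (2 * e / sigma ^+ 2)) / (1 + m ^+ 2) ^+ 2)).
    apply: ler_wpM2r; first by rewrite invr_ge0 exprn_ge0// ltW.
    by apply: ler_wpM2l => //; apply: ler_wpM2l => //;
       apply: mulr_ge0 => //; apply: mulr_ge0 => //; exact: ltW.
  have -> : K * (2 * sigma * m * (2 * e / sigma ^+ 2)) / (1 + m ^+ 2) ^+ 2 =
      4 * K / sigma * e / (1 + m ^+ 2) * (m / (1 + m ^+ 2)).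
    by field; rewrite !gt_eqF.
  rewrite ler_piMr//; last by rewrite ler_pdivrMr// mul1r; nra.
  by rewrite divr_ge0 ?(ltW p1)// mulr_ge0// divr_ge0 ?mulr_ge0// ltW.
have key : `|sigma^-1 ^+ p * H (u / sigma) - c^-1 ^+ p * H (u / c)| <=
    (4 * K / sigma + 6 * K / sigma ^+ 2) * e / (1 + m ^+ 2).
  case Ep : p; rewrite ?expr1 ?expr0 ?mul1r.
    have -> : sigma^-1 * H (u / sigma) - c^-1 * H (u / c) =
       sigma^-1 * (H (u / sigma) - H (u / c)) + (sigma^-1 - c^-1) * H (u / c) by ring.
    apply: le_trans (ler_normD _ _) _; rewrite !normrM.
    have HK := tH.2 Ep (u / c).
    have Hm : H (u / c) <= K / (1 + m ^+ 2).
      apply: le_trans HK _; apply: ler_wpM2l => //.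
      rewrite lef_pV2 ?posrE// ?lerD2l; last by rewrite ltr_pwDl// sqr_ge0.
      by rewrite -(real_normK (num_real (u / c))) lerXn2r ?nnegrE.
    have H0 : 0 <= H (u / c) by case/andP: (H01 (u / c)).
    rewrite (ger0_norm H0) (ger0_norm (_ : 0 <= sigma^-1)) ?invr_ge0 ?(ltW sigma0)//.
    apply: (@le_trans _ _ (sigma^-1 * (4 * K / sigma * e / (1 + m ^+ 2)) +
        2 * e / sigma ^+ 2 * (K / (1 + m ^+ 2)))).
      apply: lerD; first by apply: ler_wpM2l => //; rewrite invr_ge0 ltW.
      exact: ler_pM.
    have -> : sigma^-1 * (4 * K / sigma * e / (1 + m ^+ 2))
        + 2 * e / sigma ^+ 2 * (K / (1 + m ^+ 2))
       = (6 * K / sigma ^+ 2) * e / (1 + m ^+ 2).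
      by field; rewrite !gt_eqF.
    apply: ler_wpM2r; first by rewrite invr_ge0 ltW.
    by apply: ler_wpM2r => //; rewrite lerDr divr_ge0 ?mulr_ge0// ltW.
  apply: le_trans D2 _; apply: ler_wpM2r; first by rewrite invr_ge0 ltW.
  apply: ler_wpM2r => //; rewrite lerDl divr_ge0 ?mulr_ge0 ?exprn_ge0// ltW//.
apply: le_trans key _.
rewrite /smooth_const; set A := 4 * K / sigma + 6 * K / sigma ^+ 2.
have A0 : 0 <= A.
  by rewrite addr_ge0// divr_ge0 ?mulr_ge0 ?exprn_ge0// ltW.
rewrite [leRHS](_ : _ = A * e * ((1 + 4 * sigma ^+ 2) / (1 + u ^+ 2))); last first.
  by rewrite -/e; ring.
apply: ler_wpM2l; first exact: mulr_ge0.
have u2 : u ^+ 2 = 4 * sigma ^+ 2 * m ^+ 2.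
  by rewrite -(real_normK (num_real u)) uE; ring.
have s2 : 0 <= sigma ^+ 2 by exact: sqr_ge0.
rewrite ler_pdivlMr; last by rewrite u2; nra.
rewrite mulrC ler_pdivrMr// u2; nra.
Qed.

End smoothing.

Section discretised.
Context {R : realType}.
Notation lam := (@lebesgue_measure R).

(** Bounds the effect of the scale on cell [k] through the observations at its two
ends only. *)
Definition cell_bound (T : Type) (n : nat) (x : R) (Y : nat -> T -> R) (k : nat)
    (w : T) : R :=
  Num.sqrt n%:R * (1 + n%:R * (Y k.+1 w - Y k w) ^+ 2) /
  (1 + n%:R * (x - Y k w) ^+ 2).

Lemma cell_bound_ge0 (T : Type) n x (Y : nat -> T -> R) k w :
  0 <= cell_bound n x Y k w.
Proof.
have h z : 0 <= 1 + n%:R * z ^+ 2 :> R by rewrite addr_ge0// mulr_ge0// sqr_ge0.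
by rewrite /cell_bound divr_ge0// mulr_ge0// sqrtr_ge0.
Qed.

(** Replaces the distance from the mean of the bridge to the level, [v], by the
distance from the left end of the cell, [y], at the price of the increment
[D]. *)
Lemma quadratic_shift (N v D r y : R) : 0 <= N -> 0 <= r <= 1 -> y = v + r * D ->
  (1 + N * y ^+ 2) <= 2 * (1 + N * v ^+ 2) * (1 + N * D ^+ 2).
Proof.
move=> N0 /andP[r0 r1] ->.
have D2 : 0 <= N * D ^+ 2 by rewrite mulr_ge0// sqr_ge0.
have v2 : 0 <= N * v ^+ 2 by rewrite mulr_ge0// sqr_ge0.
have rD : (r * D) ^+ 2 <= D ^+ 2.
  by rewrite exprMn ler_piMl ?sqr_ge0// expr_le1.
have h : (v + r * D) ^+ 2 <= 2 * v ^+ 2 + 2 * D ^+ 2.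
  have : 0 <= (v - r * D) ^+ 2 by exact: sqr_ge0.
  nra.
have := ler_wpM2l N0 h; have : 0 <= (N * v ^+ 2) * (N * D ^+ 2) by exact: mulr_ge0.
lra.
Qed.

Variables (p : bool) (H : R -> R) (K : R).
Hypotheses (K0 : 0 <= K) (tH : tame p H K) (cH : continuous H).
Hypothesis H01 : forall u, 0 <= H u <= 1.
Variables (sigma : R) (sigma0 : 0 < sigma).

(** [scale_dist] at u = sqrt n * kap r * v, with v the distance from the level to the
mean of the bridge.  As kap r is at least 1 inside a cell, it can be dropped from
the denominator, and put in the numerator when p is false. *)
Lemma bdens_dist (T : Type) n c x (Y : nat -> T -> R) s w :
  (0 < n)%N -> 0 <= s -> `|sigma - c| <= sigma / 2 ->
  Num.sqrt n%:R ^+ (~~ p) * `|bdens p H n sigma x Y s w - bdens p H n c x Y s w| <=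
  smooth_const K sigma * `|sigma - c| *
    (2 * kap (frac n s) * cell_bound n x Y (cell n s) w).
Proof.
move=> n0 s0 sc; rewrite /bdens /cell_bound.
set r := frac n s; set k := cell n s; set q := Num.sqrt n%:R.
set v := x - Y k w - r * (Y k.+1 w - Y k w).
have q0 : 0 <= q by exact: sqrtr_ge0.
have C0 := smooth_const_ge0 K0 sigma0.
have k0 := kap_ge0 r.
pose u := q * kap r * v.
have E c' : (q / c' * kap r) ^+ p * H (q / c' * kap r * v) =
    (q * kap r) ^+ p * (c'^-1 ^+ p * H (u / c')).
  rewrite mulrA -exprMn; congr (_ ^+ _ * H _); first by ring.
  by rewrite /u; ring.
rewrite !E -mulrBr normrM ger0_norm; last by rewrite exprn_ge0// mulr_ge0.
have RHS0 : 0 <= smooth_const K sigma * `|sigma - c| *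
    (2 * kap r * (q * (1 + n%:R * (Y k.+1 w - Y k w) ^+ 2) / (1 + n%:R * (x - Y k w) ^+ 2))).
  apply: mulr_ge0; first exact: mulr_ge0.
  by apply: mulr_ge0; [exact: mulr_ge0|exact: cell_bound_ge0].
have /andP[r0 r1] := frac_itv n s0; rewrite -/r in r0 r1.
move: r0; rewrite le_eqVlt => /predU1P[r0|r0].
  (* at a grid point both sides vanish, by the convention kap 0 = 0 *)
  have kr : kap r = 0 by rewrite /kap -r0 mul0r sqrtr0 invr0.
  apply: le_trans RHS0; apply: eq_leW.
  rewrite /u kr mulr0 !mul0r.
  by case: (p); rewrite ?expr1 ?mul0r ?mulr0// !expr0 !mul1r subrr normr0 mulr0.
have k1 : 1 <= kap r by apply: kap_ge1; rewrite r0.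
have qk : q ^+ (~~ p) * (q * kap r) ^+ p <= q * kap r.
  by case: (p); rewrite ?expr1 ?expr0 ?mul1r ?mulr1// ler_peMr.
rewrite [leLHS]mulrA.
apply: (@le_trans _ _ (q * kap r * (smooth_const K sigma * `|sigma - c| / (1 + u ^+ 2)))).
  apply: ler_pM => //; last exact: scale_dist.
  by apply: mulr_ge0; apply: exprn_ge0 => //; exact: mulr_ge0.
have N0 : 0 <= n%:R :> R by [].
have Ey : x - Y k w = v + r * (Y k.+1 w - Y k w) by rewrite /v; ring.
have r01 : 0 <= r <= 1 by rewrite !ltW.
have shift := quadratic_shift N0 r01 Ey.
set D := 1 + n%:R * (Y k.+1 w - Y k w) ^+ 2 in shift *.
set y := 1 + n%:R * (x - Y k w) ^+ 2 in shift *.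
have pos (z : R) : 1 <= 1 + n%:R * z ^+ 2 by rewrite lerDl mulr_ge0// sqr_ge0.
have y1 : 1 <= y by exact: pos.
have D1 : 1 <= D by exact: pos.
have v1 := pos v.
have vu : 1 + n%:R * v ^+ 2 <= 1 + u ^+ 2.
  rewrite lerD2l /u exprMn ler_wpM2r ?sqr_ge0//.
  rewrite exprMn sqr_sqrtr// ler_peMr//; exact: exprn_ege1.
have -> : smooth_const K sigma * `|sigma - c| * (2 * kap r * (q * D / y)) =
   q * kap r * (smooth_const K sigma * `|sigma - c| * (2 * D / y)) by ring.
apply: ler_wpM2l; first exact: mulr_ge0.
apply: ler_wpM2l; first exact: mulr_ge0.
rewrite ler_pdivlMr; last by lra.
rewrite mulrC ler_pdivrMr; last by lra.
apply: le_trans shift _; rewrite mulrAC; apply: ler_wpM2l => //.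
by rewrite mulr_ge0//; lra.
Qed.

(** 12 is twice the bound on the integral of [kap]. *)
Definition cell_sum (T : Type) (n : nat) (x tmax : R) (Y : nat -> T -> R) (w : T) : R :=
  n%:R^-1 * \sum_(k < (cell n tmax).+1) 12 * cell_bound n x Y k w.

(** Stated in both directions, for integrals of nonnegative functions, so that no
subtraction of integrals is needed. *)
Lemma integral_bdens_le (d : measure_display) (T : measurableType d) n c x
    (Y : nat -> T -> R) t tmax w a b :
  (0 < n)%N -> (forall k, measurable_fun setT (Y k)) ->
  0 <= t <= tmax -> 0 < c -> `|sigma - c| <= sigma / 2 ->
  (a, b) = (sigma, c) \/ (a, b) = (c, sigma) ->
  ((Num.sqrt n%:R ^+ (~~ p))%:E * \int[lam]_(s in `[0%R, t]) (bdens p H n a x Y s w)%:E <=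
   (Num.sqrt n%:R ^+ (~~ p))%:E * (\int[lam]_(s in `[0%R, t]) (bdens p H n b x Y s w)%:E) +
   (smooth_const K sigma * `|sigma - c| * cell_sum n x tmax Y w)%:E)%E.
Proof.
move=> n0 mY /andP[t0 tt] c0 sc ab.
have mH : measurable_fun setT H by exact: continuous_measurable_fun.
have mI : measurable (`[0%R, t]%classic : set (measurableTypeR R)) by exact: measurable_itv.
set q := Num.sqrt n%:R ^+ (~~ p).
have q0 : 0 <= q by rewrite exprn_ge0// sqrtr_ge0.
set C := smooth_const K sigma * `|sigma - c|.
have C0 : 0 <= C by rewrite mulr_ge0// smooth_const_ge0.
have [a0 b0] : 0 < a /\ 0 < b by case: ab => -[-> ->].
have bd0 c' s : 0 < c' -> (0 <= (bdens p H n c' x Y s w)%:E)%E.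
  by move=> h; rewrite lee_fin bdens_ge0// ltW.
have mbd c' : measurable_fun setT (fun s : measurableTypeR R => (bdens p H n c' x Y s w)%:E).
  apply/measurable_EFinP.
  exact: (measurableT_comp (measurable_bdens p mH n c' x mY) (pair1_measurable w)).
pose f k r := (C * (2 * kap r * cell_bound n x Y k w))%:E.
have mf k : measurable_fun setT (f k).
  apply/measurable_EFinP; apply: measurable_funM => //.
  by apply: measurable_funM => //; apply: measurable_funM => //; exact: measurable_kap.
have f0 k r : (0 <= f k r)%E.
  rewrite lee_fin; apply: mulr_ge0 => //; apply: mulr_ge0; last exact: cell_bound_ge0.
  by rewrite mulr_ge0// kap_ge0.
have mF : measurable_fun setT (fun s : measurableTypeR R => f (cell n s) (frac n s)).
  exact: measurable_cells.
have fcell : (\int[lam]_(s in `[0%R, t]) f (cell n s) (frac n s) <=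
    (C * cell_sum n x tmax Y w)%:E)%E.
  apply: le_trans (integral_cells_le n0 mf f0 t0) _.
  apply: (@le_trans _ _ (n%:R^-1%:E *
      \sum_(k < (cell n t).+1) (C * (12 * cell_bound n x Y k w))%:E)%E).
    apply: lee_wpmul2l; first by rewrite lee_fin invr_ge0.
    apply: lee_sum => k _.
    have -> : C * (12 * cell_bound n x Y k w) = (C * (2 * cell_bound n x Y k w)) * 6 by ring.
    have E0 : 0 <= C * (2 * cell_bound n x Y k w).
      by apply: mulr_ge0 => //; apply: mulr_ge0 => //; exact: cell_bound_ge0.
    have -> : (\int[lam]_(r in `[0%R, 1%R]) f k r =
        \int[lam]_(r in `[0%R, 1%R]) ((C * (2 * cell_bound n x Y k w))%:E * (kap r)%:E))%E.
      by apply: eq_integral => r _; rewrite /f -EFinM; congr EFin; ring.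
    rewrite [leRHS]EFinM.
    refine (le_trans _ (lee_wpmul2l _ (@integral_kap R))); last by rewrite lee_fin.
    apply: eq_leW.
    refine (ge0_integralZl lam _ _ _ _) => //.
    - by apply/measurable_EFinP; apply: measurable_funTS; exact: measurable_kap.
    - by move=> r _; rewrite lee_fin kap_ge0.
  rewrite sumEFin -EFinM lee_fin /cell_sum mulrCA -mulr_sumr.
  apply: ler_wpM2l; first by rewrite invr_ge0.
  apply: ler_wpM2l => //.
  have le : (cell n t <= cell n tmax)%N.
    by rewrite /cell le_truncn// ler_wpM2l.
  rewrite -(big_mkord xpredT (fun k => 12 * cell_bound n x Y k w)).
  rewrite -(big_mkord xpredT (fun k => 12 * cell_bound n x Y k w)).
  rewrite (@big_cat_nat _ _ _ (cell n t).+1 0 (cell n tmax).+1)//= lerDl.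
  by apply: sumr_ge0 => k _; rewrite mulr_ge0// cell_bound_ge0.
apply: le_trans (leeD2l _ fcell).
have Zl c' : 0 < c' -> (q%:E * \int[lam]_(s in `[0%R, t]) (bdens p H n c' x Y s w)%:E =
    \int[lam]_(s in `[0%R, t]) (q%:E * (bdens p H n c' x Y s w)%:E))%E.
  move=> h; apply/esym; refine (ge0_integralZl lam _ _ _ _) => //.
  - exact: measurable_funTS.
  - by move=> s _; exact: bd0.
rewrite !Zl//.
have mq c' : measurable_fun setT
    (fun s : measurableTypeR R => (q%:E * (bdens p H n c' x Y s w)%:E)%E).
  exact: measurable_funeM.
have q00 c' s : 0 < c' -> (0 <= q%:E * (bdens p H n c' x Y s w)%:E)%E.
  by move=> h; rewrite mule_ge0 ?lee_fin ?bdens_ge0// ltW.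
rewrite -ge0_integralD//; last 3 first.
- by move=> s _; exact: q00.
- exact: measurable_funTS.
- exact: measurable_funTS.
apply: ge0_le_integral => //.
- by move=> s _; exact: q00.
- exact: measurable_funTS.
- by apply: measurable_funTS; apply: emeasurable_funD.
move=> s /=; rewrite in_itv/= => /andP[s0 _].
rewrite -!EFinM /f -EFinD lee_fin.
have := @bdens_dist T n c x Y s w n0 s0 sc; rewrite -/q -/C.
set e := C * _; set A := bdens _ _ _ sigma _ _ _ _; set A' := bdens _ _ _ c _ _ _ _.
rewrite -{1}(ger0_norm q0) -normrM mulrBr ler_norml => /andP[h1 h2].
by case: ab => -[-> ->]; rewrite -/A -/A'; lra.
Qed.

End discretised.

Section plugin_distance.
Context d (T : measurableType d) (R : realType) (P : probability T R).
Variables (B : R -> T -> R) (hB : standard_brownian P B).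
Variables (mu sigma : R) (sigma0 : 0 < sigma).
Local Notation X := (linear_brownian mu sigma B).
Variables (p : bool) (H : R -> R) (K : R).
Hypotheses (K0 : 0 <= K) (tH : tame p H K) (cH : continuous H).
Hypothesis H01 : forall u, 0 <= H u <= 1.

Lemma bmean_dist n c x t tmax w : (0 < n)%N -> 0 <= t <= tmax -> 0 < c ->
  `|sigma - c| <= sigma / 2 ->
  Num.sqrt n%:R ^+ (~~ p) *
    `|bmean B mu sigma p H n sigma x t w - bmean B mu sigma p H n c x t w| <=
  smooth_const K sigma * `|sigma - c| *
    cell_sum n x tmax (fun k => X (k%:R / n%:R)) w.
Proof.
move=> n0 t01 c0 sc; have /andP[t0 _] := t01.
have mY k : measurable_fun setT (X (k%:R / n%:R)).
  by apply: (measurable_X hB); rewrite divr_ge0.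
have q0 : 0 <= Num.sqrt n%:R ^+ (~~ p) :> R by rewrite exprn_ge0// sqrtr_ge0.
have h1 := integral_bdens_le K0 tH cH H01 sigma0 x w n0 mY t01 c0 sc (or_introl erefl).
have h2 := integral_bdens_le K0 tH cH H01 sigma0 x w n0 mY t01 c0 sc (or_intror erefl).
rewrite -!(bmeanE B mu sigma p cH H01)// in h1 h2.
rewrite -!EFinM -EFinD lee_fin in h1.
rewrite -!EFinM -EFinD lee_fin in h2.
rewrite -{1}(ger0_norm q0) -normrM mulrBr ler_norml; apply/andP; split; lra.
Qed.

End plugin_distance.

(** * The mean of the sensitivity bound *)

Section moments.
Context {R : realType}.
Notation lam := (@lebesgue_measure R).

Lemma integral_cauchy : (\int[lam]_u ((1 + u ^+ 2)^-1)%:E = pi%:E)%E.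
Proof.
have pos (u : R) : 0 < 1 + u ^+ 2 by rewrite ltr_pwDl// sqr_ge0.
rewrite ge0_symfun_integralT.
- rewrite [X in (_ * X)%E](_ : _ = (pi / 2)%:E).
    by rewrite -EFinM; congr EFin; field.
  rewrite -integral0y_oneDsqr; congr integral.
  by apply/seteqP; split => u /=; rewrite in_itv/= andbT.
- by move=> u; rewrite invr_ge0 ltW.
- move=> u; apply: cvgV; first by rewrite gt_eqF.
  by apply: cvgD; [exact: cvg_cst|exact: exprn_continuous].
- by move=> u /=; rewrite sqrrN.
Qed.

Lemma measurable_cauchy : measurable_fun [set: R] (fun u : R => (1 + u ^+ 2)^-1).
Proof.
apply: (measurableT_comp (@measurable_inv R)).
by apply: measurable_funD => //; exact: measurable_funX.
Qed.

Lemma integral_cauchy_affine (a b : R) : 0 < a ->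
  (\int[lam]_v ((1 + (a * v + b) ^+ 2)^-1)%:E = (pi / a)%:E)%E.
Proof.
move=> a0.
have m : measurable_fun [set: R] (fun u : R => ((1 + u ^+ 2)^-1)%:E : \bar R).
  by apply/measurable_EFinP; exact: measurable_cauchy.
have nn (u : R) : setT u -> (0 <= ((1 + u ^+ 2)^-1)%:E :> \bar R)%E.
  by move=> _; rewrite lee_fin invr_ge0 addr_ge0// sqr_ge0.
have := @ge0_integral_affine R a b setT _ (lt0r_neq0 a0) measurableT m nn.
rewrite preimage_setT => ->; rewrite integral_cauchy -EFinM; congr EFin.
by rewrite gtr0_norm// mulrC.
Qed.

Lemma quartic_decay (K y : R) : 0 <= K -> 0 <= y ->
  y * (K / (1 + y) ^+ 4) <= K * (1 + y)^-1.
Proof.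
move=> K0 y0; have p1 : 0 < 1 + y by lra.
rewrite mulrCA; apply: ler_wpM2l => //.
rewrite ler_pdivrMr; last exact: exprn_gt0.
rewrite (exprS _ 3) mulrA mulVf ?gt_eqF// mul1r exprS.
have : 1 <= (1 + y) ^+ 2 by rewrite exprn_ege1//; lra.
nra.
Qed.

Lemma normal_second_moment (v : R) : 0 < v ->
  (\int[normal_prob 0 v]_u ((u / v) ^+ 2)%:E <= (8 ^+ 4 * pi)%:E)%E.
Proof.
move=> v0.
have m2 : measurable_fun [set: R] (fun u : R => u ^+ 2) by exact: measurable_funX.
have mv : measurable_fun [set: measurableTypeR R]
    (fun u : measurableTypeR R => ((u / v) ^+ 2)%:E : \bar R).
  by apply/measurable_EFinP; apply: measurable_funX; exact: measurable_funM.
have nn u : (0 <= ((u / v) ^+ 2)%:E :> \bar R)%E by rewrite lee_fin sqr_ge0.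
rewrite (normal_integral 0 v mv nn).
pose f u : R := u ^+ 2 * gphi u.
have mf : measurable_fun [set: R] (fun u => (f u)%:E : \bar R).
  by apply/measurable_EFinP; apply: measurable_funM => //; exact: measurable_gphi.
have f0 (u : R) : (0 <= (f u)%:E)%E by rewrite lee_fin mulr_ge0 ?sqr_ge0// gphi_ge0.
have mc : measurable_fun [set: R] (fun u : R => ((1 + u ^+ 2)^-1)%:E : \bar R).
  by apply/measurable_EFinP; exact: measurable_cauchy.
have c0 (u : R) : (0 <= ((1 + u ^+ 2)^-1)%:E :> \bar R)%E.
  by rewrite lee_fin invr_ge0 addr_ge0// sqr_ge0.
have vi0 : 0 < v^-1 by rewrite invr_gt0.
have Ef : (\int[lam]_u (((u / v) ^+ 2)%:E * (normal_pdf 0 v u)%:E) = \int[lam]_u (f u)%:E)%E.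
  have Haff := @ge0_integral_affine R v^-1 0 setT _ (lt0r_neq0 vi0)
    measurableT mf (fun u _ => f0 u).
  rewrite preimage_setT (gtr0_norm vi0) invrK in Haff.
  have Hz : (\int[lam]_u (v^-1%:E * (f (v^-1 * u + 0))%:E) = \int[lam]_u (f u)%:E)%E.
    refine (etrans (ge0_integralZl lam measurableT _ (fun u _ => f0 _) _) _).
    - by apply: (measurableT_comp mf); apply: measurable_funD => //; exact: measurable_funM.
    - by rewrite lee_fin ltW.
    - by rewrite Haff muleA -EFinM mulVf ?gt_eqF// mul1e.
  rewrite -Hz; apply: eq_integral => u _.
  rewrite normal_pdf_scale// subr0 addr0 -!EFinM /f; congr EFin; rewrite [v^-1 * u]mulrC; ring.
rewrite Ef.
apply: (@le_trans _ _ (\int[lam]_u ((8 ^+ 4)%:E * ((1 + u ^+ 2)^-1)%:E))%E).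
  apply: ge0_le_integral => //.
  - exact: measurable_funeM.
  - move=> u _; rewrite -EFinM lee_fin /f.
    have u2 : 0 <= u ^+ 2 by exact: sqr_ge0.
    apply: le_trans (ler_wpM2l u2 (gphi_decay u)) _.
    by apply: quartic_decay => //; exact: exprn_ge0.
refine (le_trans _ (_ : (8 ^+ 4)%:E * \int[lam]_u ((1 + u ^+ 2)^-1)%:E <= _)%E).
  apply: eq_leW.
  by refine (ge0_integralZl lam measurableT mc (fun u _ => c0 u) _); rewrite lee_fin exprn_ge0.
by rewrite integral_cauchy EFinM.
Qed.

(** The density of the normal law is at most 1 / v. *)
Lemma normal_cauchy_le (a b v : R) : 0 < a -> 0 < v ->
  (\int[normal_prob 0 v]_u ((1 + (a * u + b) ^+ 2)^-1)%:E <= (pi / (a * v))%:E)%E.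
Proof.
move=> a0 v0.
have mc : measurable_fun [set: measurableTypeR R]
    (fun u : measurableTypeR R => ((1 + (a * u + b) ^+ 2)^-1)%:E : \bar R).
  apply/measurable_EFinP; apply: (measurableT_comp (@measurable_cauchy)).
  by apply: measurable_funD => //; exact: measurable_funM.
have c0 u : (0 <= ((1 + (a * u + b) ^+ 2)^-1)%:E :> \bar R)%E.
  by rewrite lee_fin invr_ge0 addr_ge0// sqr_ge0.
rewrite (normal_integral 0 v mc c0).
apply: (@le_trans _ _ (\int[lam]_u (v^-1%:E * ((1 + (a * u + b) ^+ 2)^-1)%:E))%E).
  apply: ge0_le_integral => //.
  - by move=> u _; rewrite mule_ge0// lee_fin normal_pdf_ge0.
  - apply: emeasurable_funM => //; apply/measurable_EFinP; exact: measurable_normal_pdf.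
  - exact: measurable_funeM.
  - move=> u _; rewrite muleC; apply: lee_wpmul2r => //.
    rewrite lee_fin normal_pdf_scale// ler_piMr ?gphi_le1// invr_ge0 ltW//.
refine (le_trans _ (_ : v^-1%:E * \int[lam]_u ((1 + (a * u + b) ^+ 2)^-1)%:E <= _)%E).
  apply: eq_leW.
  by refine (ge0_integralZl lam measurableT mc (fun u _ => c0 u) _); rewrite lee_fin invr_ge0 ltW.
rewrite integral_cauchy_affine// -EFinM lee_fin; apply: eq_leW.
by field; rewrite !gt_eqF.
Qed.

(** Telescoping: 1 / sqrt (K + 1) is at most 2 (sqrt (K + 1) - sqrt K). *)
Lemma sum_isq_le K : \sum_(k < K.+1) isq (k%:R : R) <= 2 * Num.sqrt K%:R.
Proof.
elim: K => [|K IH]; first by rewrite big_ord_recl big_ord0 /isq sqrtr0 invr0 addr0 mulr0.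
rewrite big_ord_recr/=; apply: le_trans (lerD IH (lexx _)) _.
set a := Num.sqrt K%:R; set b := Num.sqrt K.+1%:R.
have a0 : 0 <= a by exact: sqrtr_ge0.
have b0 : 0 < b by rewrite sqrtr_gt0.
have ab : a <= b by rewrite ler_wsqrtr// ler_nat.
have a2 : a ^+ 2 = K%:R by rewrite sqr_sqrtr.
have b2 : b ^+ 2 = K%:R + 1 by rewrite sqr_sqrtr// natr1.
rewrite /isq -/b.
have -> : b^-1 = (b ^+ 2 - a ^+ 2) / b by rewrite b2 a2 addrAC subrr add0r mul1r.
have : (b ^+ 2 - a ^+ 2) / b <= 2 * (b - a).
  by rewrite ler_pdivrMr//; nra.
lra.
Qed.

End moments.

Section increment_freezing.
Context d (T : measurableType d) (R : realType) (P : probability T R).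
Variables (B : R -> T -> R) (hB : standard_brownian P B).
Variables (t : nat -> R) (t0 : 0 <= t 0%N) (tle : {homo t : i j / (i <= j)%N >-> i <= j}).

Lemma increment_freezing m
    (f : g_sigma_algebraType (cylinder B t [set m]) * measurableTypeR R -> \bar R) :
  t m < t m.+1 -> measurable_fun setT f -> (forall z, 0 <= f z)%E ->
  (\int[P]_w f (w, incr B t m w) =
   \int[P]_w \int[normal_prob 0 (Num.sqrt (t m.+1 - t m))]_v f (w, v))%E.
Proof.
move=> tm mf f0; have [_ _ _ _ lawB] := hB.
have tm0 : 0 <= t m by apply: le_trans t0 _; exact: tle.
have ind E C : <<s cylinder B t [set m] >> E -> measurable C ->
    P (E `&` incr B t m @^-1` C) =
    (P E * normal_prob 0 (Num.sqrt (t m.+1 - t m)) C)%E.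
  move=> sE mC; rewrite (cylinder_indep hB t0 tle sE mC); congr (_ * _)%E.
  exact: lawB.
exact: (@freezing _ _ _ P _ (scylinder_measurable hB t0 tle (M := [set m]))
  _ (normal_prob 0 (Num.sqrt (t m.+1 - t m))) f (measurable_incr hB t0 tle m) ind mf f0).
Qed.

End increment_freezing.

Section cell_means.
Context d (T : measurableType d) (R : realType) (P : probability T R).
Variables (B : R -> T -> R) (hB : standard_brownian P B).
Variables (mu sigma : R) (sigma0 : 0 < sigma).
Local Notation X := (linear_brownian mu sigma B).
Variables (n : nat) (n0 : (0 < n)%N) (x : R).
Local Notation Y := (fun k : nat => X (k%:R / n%:R)).

Let nR : 0 < n%:R :> R. Proof. by rewrite ltr0n. Qed.

Section one_cell.
Variable k : nat.

(** Separates the path before the cell [k] from the increment over it. *)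
Definition one_cell_grid (i : nat) : R :=
  if i == 0%N then 0 else if i == 1%N then k%:R / n%:R else k.+1%:R / n%:R.
Local Notation t := one_cell_grid.

Lemma one_cell_grid_homo : {homo t : i j / (i <= j)%N >-> i <= j}.
Proof.
move=> [|[|i]] [|[|j]] //= _; rewrite /t/= ?divr_ge0//.
by rewrite ler_wpM2r ?invr_ge0// ler_nat.
Qed.

Let t00 : 0 <= t 0%N. Proof. by []. Qed.

Lemma incr_one_cell0 w : incr B t 0 w = B (k%:R / n%:R) w.
Proof. by rewrite /incr /t/=; have [_ -> _ _ _] := hB; rewrite subr0. Qed.

Definition start_weight (v : R) : R := (1 + n%:R * (x - mu * (k%:R / n%:R) - sigma * v) ^+ 2)^-1.

Lemma start_weight_ge0 v : 0 <= start_weight v.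
Proof. by rewrite invr_ge0 addr_ge0// mulr_ge0// sqr_ge0. Qed.

Lemma start_weight_le1 v : start_weight v <= 1.
Proof.
have h : 1 <= 1 + n%:R * (x - mu * (k%:R / n%:R) - sigma * v) ^+ 2.
  by rewrite lerDl mulr_ge0// sqr_ge0.
by rewrite invf_le1//; apply: lt_le_trans h.
Qed.

Lemma measurable_start_weight : measurable_fun [set: R] start_weight.
Proof.
apply: (measurableT_comp (@measurable_inv R)).
apply: measurable_funD => //; apply: measurable_funM => //; apply: measurable_funX.
by apply: measurable_funB => //; exact: measurable_funM.
Qed.

(** The density of the Brownian motion at time k/n is at most sqrt (n / k), and
[start_weight] integrates to pi / (sigma sqrt n).  At k = 0 the bound 1 is
used. *)
Lemma start_weight_mean :
  (\int[P]_w (start_weight (B (k%:R / n%:R) w))%:E <=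
   ((k == 0%N)%:R + pi / sigma * isq k%:R)%:E)%E.
Proof.
have [mB _ _ _ _] := hB.
have mw : measurable_fun setT (fun w => (start_weight (B (k%:R / n%:R) w))%:E).
  apply/measurable_EFinP; apply: (measurableT_comp measurable_start_weight).
  by apply: mB; rewrite divr_ge0.
have [k0|kn0] := eqVneq k 0%N.
  have -> : 1%:R + pi / sigma * isq k%:R = 1 :> R.
    by rewrite k0 /isq sqrtr0 invr0 mulr0 addr0.
  apply: (@le_trans _ _ (\int[P]_w (1%:E : \bar R))%E).
    apply: ge0_le_integral => //; first by move=> w _; rewrite lee_fin start_weight_ge0.
    by move=> w _; rewrite lee_fin start_weight_le1.
  by rewrite integral_prob_cst.
rewrite add0r; have kR : 0 < k%:R :> R by rewrite ltr0n lt0n.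
pose f (z : g_sigma_algebraType (cylinder B t [set 0%N]) * measurableTypeR R) :=
  (start_weight z.2)%:E.
have mf : measurable_fun setT f.
  apply/measurable_EFinP; apply: (measurableT_comp measurable_start_weight).
  exact: measurable_snd.
have f0 z : (0 <= f z)%E by rewrite lee_fin start_weight_ge0.
have tt : t 0%N < t 1%N by rewrite /t/= divr_gt0.
have := increment_freezing hB t00 one_cell_grid_homo tt mf f0.
rewrite /f /=; under eq_integral do rewrite incr_one_cell0.
move=> ->; rewrite integral_prob_cst.
rewrite {1}/t {1}/t /= subr0.
have sn0 : 0 < Num.sqrt n%:R :> R by rewrite sqrtr_gt0.
have sk0 : 0 < Num.sqrt k%:R :> R by rewrite sqrtr_gt0.
have v0 : 0 < Num.sqrt (k%:R / n%:R) :> R by rewrite sqrtr_gt0 divr_gt0.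
have vE : Num.sqrt (k%:R / n%:R) = Num.sqrt k%:R / Num.sqrt n%:R :> R.
  by rewrite sqrtrM// sqrtrV.
have a0 : 0 < Num.sqrt n%:R * sigma by rewrite mulr_gt0.
have := normal_cauchy_le (- (Num.sqrt n%:R * (x - mu * (k%:R / n%:R)))) a0 v0.
have -> : pi / (Num.sqrt n%:R * sigma * Num.sqrt (k%:R / n%:R)) = pi / sigma * isq k%:R.
  by rewrite vE /isq; field; rewrite !gt_eqF.
apply: le_trans; apply: eq_leW.
apply: eq_integral => v _; congr EFin; rewrite /start_weight; congr (_^-1); congr (1 + _).
rewrite -[X in X * _ = _](@sqr_sqrtr R n%:R)// -exprMn -[LHS]sqrrN; congr (_ ^+ 2).
by ring.
Qed.

Definition cell_const : R := 1 + 2 * mu ^+ 2 + 2 * sigma ^+ 2 * (8 ^+ 4 * pi).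

Lemma cell_const_ge0 : 0 <= cell_const.
Proof.
rewrite /cell_const !addr_ge0// mulr_ge0 ?sqr_ge0//.
  by rewrite mulr_ge0 ?sqr_ge0.
by rewrite mulr_ge0 ?pi_ge0// exprn_ge0.
Qed.

(** The rescaled increment has a second moment bounded uniformly in [n]. *)
Lemma step_mean :
  (\int[normal_prob 0 (Num.sqrt n%:R^-1)]_u (1 + n%:R * (mu / n%:R + sigma * u) ^+ 2)%:E <=
   cell_const%:E)%E.
Proof.
set v := Num.sqrt n%:R^-1.
have v0 : 0 < v by rewrite sqrtr_gt0 invr_gt0.
have v2 : v ^+ 2 = n%:R^-1 by rewrite sqr_sqrtr// invr_ge0.
pose b1 : R := 1 + 2 * mu ^+ 2; pose b2 : R := 2 * sigma ^+ 2.
have b10 : 0 <= b1 by rewrite addr_ge0// mulr_ge0// sqr_ge0.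
have b20 : 0 <= b2 by rewrite mulr_ge0// sqr_ge0.
have m2 : measurable_fun [set: measurableTypeR R]
    (fun u : measurableTypeR R => ((u / v) ^+ 2)%:E : \bar R).
  by apply/measurable_EFinP; apply: measurable_funX; exact: measurable_funM.
have nn u : (0 <= ((u / v) ^+ 2)%:E :> \bar R)%E by rewrite lee_fin sqr_ge0.
apply: (@le_trans _ _ (\int[normal_prob 0 v]_u (b1%:E + b2%:E * ((u / v) ^+ 2)%:E))%E).
  apply: ge0_le_integral => //.
  - by move=> u _; rewrite lee_fin addr_ge0// mulr_ge0// sqr_ge0.
  - apply/measurable_EFinP; apply: measurable_funD => //; apply: measurable_funM => //.
    by apply: measurable_funX; apply: measurable_funD => //; exact: measurable_funM.
  - by apply: emeasurable_funD => //; exact: measurable_funeM.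
  - move=> u _; rewrite -EFinM -EFinD lee_fin /b1 -addrA lerD2l.
    have -> : (u / v) ^+ 2 = n%:R * u ^+ 2 by rewrite expr_div_n v2 invrK mulrC.
    have h : (mu / n%:R + sigma * u) ^+ 2 <= 2 * (mu / n%:R) ^+ 2 + 2 * (sigma * u) ^+ 2.
      have : 0 <= (mu / n%:R - sigma * u) ^+ 2 by exact: sqr_ge0.
      by rewrite !expr2; lra.
    apply: le_trans (ler_wpM2l (ltW nR) h) _; rewrite mulrDr; apply: lerD.
      have -> : n%:R * (2 * (mu / n%:R) ^+ 2) = 2 * mu ^+ 2 * n%:R^-1.
        by field; rewrite gt_eqF.
      apply: ler_piMr; first by rewrite mulr_ge0// sqr_ge0.
      by rewrite invf_le1// ler1n.
    by rewrite /b2 exprMn; apply: eq_leW; ring.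
rewrite ge0_integralD//; last 2 first.
- by move=> u _; rewrite mule_ge0.
- exact: measurable_funeM.
rewrite integral_prob_cst.
rewrite /cell_const -/b1 -/b2 [leRHS]EFinD.
apply: leeD2l; rewrite [leRHS]EFinM.
refine (le_trans _ (lee_wpmul2l _ (normal_second_moment v0))); last by rewrite lee_fin.
apply: eq_leW.
by refine (ge0_integralZl _ measurableT m2 (fun u _ => nn u) _); rewrite lee_fin.
Qed.

(** The increment over the cell is independent of its starting point, so the mean
factors, by [increment_freezing]. *)
Lemma cell_bound_mean :
  (\int[P]_w (cell_bound n x Y k w)%:E <=
   (Num.sqrt n%:R * cell_const * ((k == 0%N)%:R + pi / sigma * isq k%:R))%:E)%E.
Proof.
have [mB _ _ _ _] := hB.
pose TG := g_sigma_algebraType (cylinder B t [set 1%N]).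
pose q : R := Num.sqrt n%:R.
have q0 : 0 <= q by exact: sqrtr_ge0.
pose g u : R := 1 + n%:R * (mu / n%:R + sigma * u) ^+ 2.
have g0 u : 0 <= g u by rewrite addr_ge0// mulr_ge0// sqr_ge0.
have mg : measurable_fun [set: R] g.
  apply: measurable_funD => //; apply: measurable_funM => //.
  by apply: measurable_funX; apply: measurable_funD => //; exact: measurable_funM.
(* the starting point, frozen, times the contribution of the increment *)
pose f (z : TG * measurableTypeR R) : \bar R :=
  ((q * start_weight (incr B t 0 z.1))%:E * (g z.2)%:E)%E.
have c0 w : (0 <= (q * start_weight (incr B t 0 w))%:E)%E.
  by rewrite lee_fin mulr_ge0// start_weight_ge0.
have m0 : measurable_fun setT (incr B t 0 : TG -> R).
  by apply: measurable_incr_cylinder => /= /eqP.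
have mf : measurable_fun setT f.
  apply: emeasurable_funM; apply/measurable_EFinP.
    apply: measurable_funM => //.
    apply: (measurableT_comp measurable_start_weight).
    exact: (measurableT_comp m0 (@measurable_fst _ _ _ _)).
  exact: (measurableT_comp mg (@measurable_snd _ _ _ _)).
have f0 z : (0 <= f z)%E by rewrite mule_ge0// lee_fin.
have tt : t 1%N < t 2%N by rewrite /t/= ltr_pM2r ?invr_gt0// ltr_nat.
have Efz := increment_freezing hB t00 one_cell_grid_homo tt mf f0.
have -> : (\int[P]_w (cell_bound n x Y k w)%:E = \int[P]_w f (w, incr B t 1%N w))%E.
  apply: eq_integral => w _; rewrite /f/= -EFinM; congr EFin.
  rewrite incr_one_cell0 /cell_bound /start_weight /g /incr /t/= /linear_brownian -/q.
  have -> : x - (mu * (k%:R / n%:R) + sigma * B (k%:R / n%:R) w) =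
     x - mu * (k%:R / n%:R) - sigma * B (k%:R / n%:R) w by ring.
  have -> : mu * (k.+1%:R / n%:R) + sigma * B (k.+1%:R / n%:R) w -
      (mu * (k%:R / n%:R) + sigma * B (k%:R / n%:R) w) =
      mu / n%:R + sigma * (B (k.+1%:R / n%:R) w - B (k%:R / n%:R) w).
    by rewrite -natr1; field; rewrite gt_eqF.
  by rewrite mulrAC.
rewrite Efz.
have -> : t 2%N - t 1%N = n%:R^-1.
  by rewrite /t/= -natr1; field; rewrite gt_eqF.
have mw : measurable_fun setT (fun w => (start_weight (B (k%:R / n%:R) w))%:E).
  apply/measurable_EFinP; apply: (measurableT_comp measurable_start_weight).
  by apply: mB; rewrite divr_ge0.
have w0 w : (0 <= (start_weight (B (k%:R / n%:R) w))%:E)%E.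
  by rewrite lee_fin start_weight_ge0.
have qc : 0 <= q * cell_const by rewrite mulr_ge0// cell_const_ge0.
apply: (@le_trans _ _ (\int[P]_w ((q * cell_const)%:E * (start_weight (B (k%:R / n%:R) w))%:E))%E).
  apply: ge0_le_integral => //.
  - by move=> w _; exact: integral_ge0.
  - have idm : measurable_fun setT (id : T -> TG).
      move=> _ A mA; rewrite setTI preimage_id.
      exact: (scylinder_measurable hB t00 one_cell_grid_homo mA).
    have mF := measurable_fun_fubini_tonelli_F
      (m2 := normal_prob 0 (Num.sqrt n%:R^-1)) f mf f0.
    exact: (measurableT_comp mF idm).
  - exact: measurable_funeM.
  move=> w _; rewrite /f /=.
  rewrite (_ : integral _ _ _ = (q * start_weight (incr B t 0 w))%:E *
     \int[normal_prob 0 (Num.sqrt n%:R^-1)]_u (g u)%:E)%E; last first.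
    refine (ge0_integralZl _ measurableT _ _ _) => //.
    - by apply/measurable_EFinP.
    - by move=> u _; rewrite lee_fin.
  rewrite -[leRHS]EFinM mulrAC [leRHS]EFinM -incr_one_cell0.
  apply: lee_wpmul2l => //; exact: step_mean.
rewrite [leRHS]EFinM.
refine (le_trans _ (lee_wpmul2l _ start_weight_mean)); last by rewrite lee_fin.
apply: eq_leW.
by refine (ge0_integralZl _ measurableT mw (fun u _ => w0 u) _); rewrite lee_fin.
Qed.

Lemma measurable_cell_bound : measurable_fun setT (cell_bound n x Y k).
Proof.
have mY i : measurable_fun setT (Y i) by apply: (measurable_X hB); rewrite divr_ge0.
apply: measurable_funM.
  apply: measurable_funM => //; apply: measurable_funD => //; apply: measurable_funM => //.
  by apply: measurable_funX; exact: measurable_funB.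
apply: (measurableT_comp (@measurable_inv R)); apply: measurable_funD => //.
by apply: measurable_funM => //; apply: measurable_funX; exact: measurable_funB.
Qed.

End one_cell.

Lemma measurable_cell_sum tmax : measurable_fun setT (cell_sum n x tmax Y).
Proof.
apply: measurable_funM => //; apply: measurable_sum => k.
by apply: measurable_funM => //; exact: measurable_cell_bound.
Qed.

Lemma cell_sum_ge0 tmax w : 0 <= cell_sum n x tmax Y w.
Proof.
rewrite mulr_ge0 ?invr_ge0// sumr_ge0// => k _.
by rewrite mulr_ge0// cell_bound_ge0.
Qed.

Definition cell_sum_const (tmax : R) : R :=
  12 * cell_const * (1 + 2 * (pi / sigma) * Num.sqrt tmax).

(** There are about n * tmax cells, so that the sum of the inverse square roots is of
order sqrt (n * tmax); the factor sqrt n of [cell_bound] and the average over n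
make up for it. *)
Lemma cell_sum_mean tmax : 0 <= tmax ->
  (\int[P]_w (cell_sum n x tmax Y w)%:E <= (cell_sum_const tmax)%:E)%E.
Proof.
move=> T0; pose c : R := n%:R^-1 * 12; have c0 : 0 <= c by rewrite mulr_ge0// invr_ge0.
have mc k : measurable_fun setT (fun w => (cell_bound n x Y k w)%:E).
  by apply/measurable_EFinP; exact: measurable_cell_bound.
have b0 k w : (0 <= (cell_bound n x Y k w)%:E)%E by rewrite lee_fin cell_bound_ge0.
have -> : (\int[P]_w (cell_sum n x tmax Y w)%:E =
   \int[P]_w \sum_(k < (cell n tmax).+1) (c%:E * (cell_bound n x Y k w)%:E))%E.
  apply: eq_integral => w _; rewrite /cell_sum mulr_sumr -sumEFin.
  by apply: eq_bigr => k _; rewrite mulrA.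
rewrite ge0_integral_sum//; last 2 first.
- by move=> k; exact: measurable_funeM.
- by move=> k w _; rewrite mule_ge0// lee_fin.
set K := cell n tmax.
pose e (k : nat) : R := (k == 0%N)%:R + pi / sigma * isq k%:R.
apply: (@le_trans _ _ (\sum_(k < K.+1) (c * (Num.sqrt n%:R * cell_const * e k))%:E)%E).
  apply: lee_sum => k _.
  rewrite (_ : integral _ _ _ = c%:E * \int[P]_w (cell_bound n x Y k w)%:E)%E; last first.
    by refine (ge0_integralZl _ measurableT (mc k) (fun w _ => b0 k w) _); rewrite lee_fin.
  by rewrite [leRHS]EFinM; apply: lee_wpmul2l; [rewrite lee_fin|exact: cell_bound_mean].
rewrite sumEFin lee_fin -mulr_sumr -mulr_sumr.
have ps : 0 <= pi / sigma by rewrite divr_ge0 ?pi_ge0// ltW.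
have s : \sum_(k < K.+1) e k <= 1 + 2 * (pi / sigma) * Num.sqrt K%:R.
  rewrite big_split/= -mulr_sumr; apply: lerD.
    rewrite big_ord_recl big1 ?addr0// => i _; by rewrite lift0.
  rewrite [leRHS](_ : _ = pi / sigma * (2 * Num.sqrt K%:R)); last by ring.
  by apply: ler_wpM2l => //; exact: sum_isq_le.
have K1 : Num.sqrt K%:R <= Num.sqrt n%:R * Num.sqrt tmax.
  rewrite -sqrtrM// ler_wsqrtr// /K /cell.
  by have /andP[] := truncn_itv (mulr_ge0 (ltW nR) T0).
have q1 : 1 <= Num.sqrt n%:R :> R by rewrite -[leLHS]sqrtr1 ler_wsqrtr// ler1n.
have q2 : Num.sqrt n%:R ^+ 2 = n%:R :> R by rewrite sqr_sqrtr.
have s2 : \sum_(k < K.+1) e k <= Num.sqrt n%:R * (1 + 2 * (pi / sigma) * Num.sqrt tmax).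
  apply: le_trans s _; rewrite mulrDr mulr1; apply: lerD => //.
  rewrite [leRHS](_ : _ = 2 * (pi / sigma) * (Num.sqrt n%:R * Num.sqrt tmax)); last by ring.
  by apply: ler_wpM2l => //; rewrite mulr_ge0.
have M0 := cell_const_ge0.
rewrite /c /cell_sum_const.
apply: (@le_trans _ _ (n%:R^-1 * 12 * (Num.sqrt n%:R * cell_const *
   (Num.sqrt n%:R * (1 + 2 * (pi / sigma) * Num.sqrt tmax))))).
  by apply: ler_wpM2l => //; apply: ler_wpM2l => //; rewrite mulr_ge0.
apply: eq_leW.
transitivity (12 * cell_const * (1 + 2 * (pi / sigma) * Num.sqrt tmax) *
   (Num.sqrt n%:R ^+ 2 / n%:R)); first by ring.
by rewrite q2 mulfV ?gt_eqF// mulr1.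
Qed.

End cell_means.

(** * Convergence in outer probability *)

Section outer_probability.
Context d (T : measurableType d) (R : realType) (P : probability T R).

Lemma cvg_mu_ext0 (S : nat -> set T) : (forall del : R, 0 < del ->
    \forall n \near \oo, (mu_ext P (S n) <= del%:E)%E) ->
  mu_ext P (S n) @[n --> \oo] --> 0%E.
Proof.
move=> H; have pos n : (0 <= mu_ext P (S n))%E by exact: mu_ext_ge0.
apply/fine_cvgP; split.
  near=> n; rewrite ge0_fin_numE//.
  suff h : (mu_ext P (S n) <= 1%:E)%E by exact: le_lt_trans h (ltry _).
  by near: n; exact: H.
apply/cvgr0Pnorm_le => del del0; near=> n.
have h : (mu_ext P (S n) <= del%:E)%E by near: n; exact: H.
have fin : mu_ext P (S n) \is a fin_num.
  by rewrite ge0_fin_numE//; exact: le_lt_trans h (ltry _).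
rewrite /= ger0_norm; last exact: fine_ge0.
by rewrite -lee_fin fineK.
Unshelve. all: by end_near.
Qed.

Lemma near_mu_ext_le (S : nat -> set T) (del : R) : 0 < del ->
  mu_ext P (S n) @[n --> \oo] --> 0%E ->
  \forall n \near \oo, (mu_ext P (S n) <= del%:E)%E.
Proof.
move=> del0 /fine_cvgP[finS /cvgr0Pnorm_le H].
near=> n; have fin : mu_ext P (S n) \is a fin_num by near: n.
have : `|fine (mu_ext P (S n))| <= del by near: n; exact: H.
rewrite ger0_norm; last by apply: fine_ge0; exact: mu_ext_ge0.
by rewrite -[X in _ -> is_true X]/(_ <= _)%E -lee_fin fineK.
Unshelve. all: by end_near.
Qed.

Lemma sup_dist_le (tmax a e : R) (f g : R -> R) : 0 < a -> 0 <= e ->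
  (forall t, 0 <= t <= tmax -> a * `|f t - g t| <= e) ->
  (a%:E * sup_dist tmax f g <= e%:E)%E.
Proof.
move=> a0 e0 H.
have h : (sup_dist tmax f g <= (e / a)%:E)%E.
  apply: ge_ereal_sup => y [t]; rewrite /= in_itv/= => tt <-.
  by rewrite lee_fin ler_pdivlMr// mulrC; exact: H.
apply: le_trans (lee_wpmul2l _ h) _; first by rewrite lee_fin ltW.
by rewrite -EFinM mulrC divfK// gt_eqF.
Qed.

End outer_probability.

Section estimator_limit.
Context d (T : measurableType d) (R : realType) (P : probability T R).
Variables (B : R -> T -> R) (hB : standard_brownian P B).
Variables (mu sigma : R) (sigma0 : 0 < sigma).
Local Notation X := (linear_brownian mu sigma B).
Variables (p : bool) (H : R -> R) (K : R).
Hypotheses (K0 : 0 <= K) (tH : tame p H K) (cH : continuous H).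
Hypothesis H01 : forall u, 0 <= H u <= 1.
Variables (Y : R -> R -> T -> R) (hY : is_bridge_mean P X sigma p H Y).
Variables (sigma_ : nat -> T -> R) (sigma__gt0 : forall n w, 0 < sigma_ n w).
Hypothesis hsigma_ : cvg0_in_probability P
       (fun n w => (n%:R `^ (1 / 4) * `|sigma - sigma_ n w|)%:E).
Variables (x tmax : R) (tmax_gt0 : 0 < tmax).
Variables (Zhat Ztilde : nat -> R -> T -> R) (a : nat -> R).
Hypothesis hZhat : forall n, (0 < n)%N ->
       is_cond_mean_process P X n (fun t => Y t x) (Zhat n).
Hypothesis hZtilde : forall n t w, (0 < n)%N -> 0 <= t ->
  Ztilde n t w = bmean B mu sigma p H n (sigma_ n w) x t w.
Hypothesis hrate : forall n, (0 < n)%N ->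
  a n = n%:R `^ (1 / 4) * Num.sqrt n%:R ^+ (~~ p).

(** Outside the null set of [cond_mean_process_eq], the error is controlled by
[bmean_dist] as soon as n^(1/4) |sigma - sigma_n| is at most [eta] and [cell_sum]
is below [A].  Markov's inequality makes the second event likely, uniformly in
[n], and the first one becomes likely by the assumption on the estimator. *)
Lemma plugin_error_limit : cvg0_in_probability P (fun n w =>
  ((a n)%:E * sup_dist tmax (fun t => Zhat n t w) (fun t => Ztilde n t w))%E).
Proof.
move=> e e0; apply: cvg_mu_ext0 => del del0.
set C := smooth_const K sigma; have C0 : 0 <= C by exact: smooth_const_ge0.
pose M := cell_sum_const mu sigma tmax.
have M0 : 0 <= M.
  have h := cell_sum_mean hB mu sigma0 (ltn0Sn 0) x (ltW tmax_gt0).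
  rewrite -lee_fin; apply: le_trans h; apply: integral_ge0 => w _.
  by rewrite lee_fin cell_sum_ge0.
(* A makes the probability in the Markov bound less than del / 2 *)
pose A := (M + 1) * 2 / del.
have A0 : 0 < A by rewrite divr_gt0// mulr_gt0// ltr_wpDl.
(* eta keeps the estimate in the range of scale_dist and the error below e *)
pose eta := Num.min (sigma / 2) (e / (C * A + 1)).
have CA0 : 0 < C * A + 1 by rewrite ltr_wpDl// mulr_ge0// ltW.
have eta0 : 0 < eta by rewrite lt_min !divr_gt0.
have eta1 : eta <= sigma / 2 by rewrite ge_min lexx.
have eta2 : C * eta * A <= e.
  have : eta <= e / (C * A + 1) by rewrite ge_min lexx orbT.
  rewrite ler_pdivlMr// mulrDr mulr1 => h.
  by rewrite mulrAC mulrC; apply: le_trans h; rewrite lerDl ltW.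
have half0 : 0 < del / 2 by rewrite divr_gt0.
near=> n.
have n0 : (0 < n)%N by near: n; exact: nbhs_infty_gt.
have nR : 0 < n%:R :> R by rewrite ltr0n.
set S := [set w | _].
pose V := cell_sum n x tmax (fun k => X (k%:R / n%:R)).
pose E1 := [set w | (eta%:E < (n%:R `^ (1 / 4) * `|sigma - sigma_ n w|)%:E)%E].
pose E2 := [set w | (A%:E <= `|(V w)%:E|)%E].
have [N [mN PN HN]] := cond_mean_process_eq hB sigma0 cH H01 hY n0 (hZhat n0).
have mV : measurable_fun setT V by exact: (measurable_cell_sum hB).
have mE2 : measurable E2.
  rewrite -[E2]setTI; apply: emeasurable_fun_c_infty => //.
  by apply: measurableT_comp => //; exact/measurable_EFinP.
have Ssub : S `<=` N `|` (E1 `|` E2).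
  move=> w Sw; apply: contrapT => /not_orP[Nw /not_orP[E1w E2w]].
  have Zw : forall t, 0 <= t -> Zhat n t w = bmean B mu sigma p H n sigma x t w.
    by apply: contrapT => h; apply: Nw; exact: HN.
  have q0 : 0 < n%:R `^ (1 / 4) :> R by rewrite powR_gt0.
  have q1 : 1 <= n%:R `^ (1 / 4) :> R.
    by rewrite -[leLHS](powRr0 n%:R); apply: ler_powR; [rewrite ler1n|rewrite divr_ge0].
  have s1 : n%:R `^ (1 / 4) * `|sigma - sigma_ n w| <= eta.
    by rewrite leNgt; apply/negP => h; apply: E1w; rewrite /E1/= lte_fin.
  (* here 1 <= n^(1/4) *)
  have s2 : `|sigma - sigma_ n w| <= sigma / 2.
    by apply: le_trans eta1; apply: le_trans s1; rewrite ler_peMl.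
  have V0 : 0 <= V w by exact: cell_sum_ge0.
  have VA : V w <= A.
    rewrite leNgt; apply/negP => h; apply: E2w.
    by rewrite /E2/= lee_fin (ger0_norm V0) ltW.
  have an0 : 0 < a n by rewrite hrate// mulr_gt0// exprn_gt0// sqrtr_gt0.
  move: Sw; rewrite /S/=; apply/negP; rewrite -leNgt.
  apply: sup_dist_le => //; first exact: ltW.
  move=> t tt; have /andP[t0 _] := tt.
  rewrite Zw// hZtilde// hrate// -mulrA.
  have h := bmean_dist hB mu sigma0 K0 tH cH H01 x w n0 tt (sigma__gt0 n w) s2.
  apply: le_trans (ler_wpM2l (ltW q0) h) _; rewrite -/C -/(V w).
  apply: le_trans eta2.
  rewrite [leLHS](_ : _ = C * (n%:R `^ (1 / 4) * `|sigma - sigma_ n w|) * V w); last by ring.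
  apply: ler_pM => //; last exact: ler_wpM2l.
  by apply: mulr_ge0 => //; apply: mulr_ge0 => //; exact: ltW.
have PE2 : (mu_ext P E2 <= (del / 2)%:E)%E.
  rewrite measurable_mu_extE//.
  have := le_integral_abse P measurableT (g := EFin \o V) (a := A).
  rewrite setTI => /(_ _ A0) h.
  have mVE : measurable_fun setT (EFin \o V) by exact/measurable_EFinP.
  have h2 : (A%:E * P E2 <= M%:E)%E.
    apply: le_trans (h mVE) _.
    under eq_integral do rewrite /= ger0_norm ?cell_sum_ge0//.
    by apply: cell_sum_mean => //; exact: ltW.
  have f : P E2 \is a fin_num by exact: fin_num_measure.
  rewrite -(fineK f) -EFinM lee_fin in h2.
  suff h4 : fine (P E2) <= del / 2 by rewrite -lee_fin fineK in h4.
  have h3 : fine (P E2) <= A^-1 * M by rewrite ler_pdivlMl.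
  apply: le_trans h3 _; rewrite ler_pdivrMl// mulrC /A.
  have -> : del / 2 * ((M + 1) * 2 / del) = M + 1 by field; rewrite gt_eqF.
  by rewrite lerDl.
have PE1 : (mu_ext P E1 <= (del / 2)%:E)%E.
  rewrite /E1; near: n; apply: near_mu_ext_le => //; exact: hsigma_.
have P0 : mu_ext P N = 0%E by rewrite measurable_mu_extE.
apply: le_trans (le_mu_ext P Ssub) _.
apply: (@le_trans _ _ (mu_ext P N + mu_ext P (E1 `|` E2))%E).
  exact: (outer_measureU2 (mu_ext P)).
rewrite P0 add0e.
apply: (@le_trans _ _ (mu_ext P E1 + mu_ext P E2)%E).
  exact: (outer_measureU2 (mu_ext P)).
have -> : del = del / 2 + del / 2 by field.
by rewrite EFinD; exact: leeD.
Unshelve. all: by end_near.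
Qed.

End estimator_limit.

Lemma increment_sum_kern (R : realType) (T : Type) (h h' : R -> R -> R -> R)
    (X : R -> T -> R) n c x t w : 0 <= t ->
  (forall s a z, 0 <= s <= 1 -> h s a z = h' s a z) ->
  increment_sum h X n c x t w = increment_sum h' X n c x t w.
Proof.
move=> t0 hh; rewrite /increment_sum; congr (_ + _).
  by apply: eq_bigr => i _; apply: hh; rewrite ler01 lexx.
by apply: hh; have /andP[? ?] := frac_itv n t0; apply/andP; split; [|exact: ltW].
Qed.

Theorem proposition2 (R : realType)
    (* the observed process *)
    (d : measure_display) (T : measurableType d) (P : probability T R)
    (B : R -> T -> R) (hB : standard_brownian P B)
    (mu sigma : R) (sigma_gt0 : 0 < sigma)
    (X : R -> T -> R) (hX : X = linear_brownian mu sigma B)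
    (L : R -> R -> T -> R) (hL : is_local_time P X L)
    (* the standard Brownian motion under E^0, and g, G *)
    (d0 : measure_display) (T0 : measurableType d0) (P0 : probability T0 R)
    (W : R -> T0 -> R) (hW : standard_brownian P0 W)
    (L0 : R -> R -> T0 -> R) (hL0 : is_local_time P0 W L0)
    (g G : R -> R -> R -> R)
    (hg : is_cond_mean_at_1 P0 W L0 g)
    (hG : is_cond_mean_at_1 P0 W (occupation_time W) G)
    (* the estimator of sigma *)
    (sigma_ : nat -> T -> R)
    (msigma_ : forall n, measurable_fun setT (sigma_ n))
    (sigma__gt0 : forall n w, 0 < sigma_ n w)
    (hsigma_ : cvg0_in_probability P
       (fun n w => (n%:R `^ (1 / 4) * `|sigma - sigma_ n w|)%:E))
    (x tmax : R) (tmax_gt0 : 0 < tmax)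
    (* the conditional mean estimators *)
    (Lhat Ohat : nat -> R -> T -> R)
    (hLhat : forall n, (0 < n)%N ->
       is_cond_mean_process P X n (fun t => L t x) (Lhat n))
    (hOhat : forall n, (0 < n)%N ->
       is_cond_mean_process P X n (fun t => occupation_time X t x) (Ohat n)) :
  cvg0_in_probability P (fun n w =>
    ((n%:R `^ (1 / 4))%:E *
     sup_dist tmax (fun t => Lhat n t w)
       (fun t => plugin_local_time g X sigma_ n x t w))%E)
  /\
  cvg0_in_probability P (fun n w =>
    ((n%:R `^ (3 / 4))%:E *
     sup_dist tmax (fun t => Ohat n t w)
       (fun t => plugin_occupation_time G X sigma_ n x t w))%E).
Proof.
subst X.
have K0 : 0 <= 8 ^+ 4 :> R by exact: exprn_ge0.
have hL0' : is_local_time P0 (linear_brownian 0 1 W) L0 by rewrite linear_brownian01.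
have bL0 := local_time_bridge_mean hW ltr01 hL0'.
have bO0 : is_bridge_mean P0 (linear_brownian 0 1 W) 1 false (@Ph R) (occupation_time W).
  by rewrite -[in occupation_time _](linear_brownian01 W); exact: (occupation_bridge_mean hW).
have gE := cond_mean_at_1_kern hW (@continuous_gphi R) (@gphi01 R) bL0 hg.
have GE := cond_mean_at_1_kern hW (@continuous_Ph R) (@Ph01 R) bO0 hG.
split.
  apply: (plugin_error_limit hB sigma_gt0 K0 (@tame_gphi R) (@continuous_gphi R)
    (@gphi01 R) (local_time_bridge_mean hB sigma_gt0 hL) sigma__gt0 hsigma_ tmax_gt0 hLhat).
    move=> n t w n0 t0; rewrite /plugin_local_time /bmean.
    rewrite (increment_sum_kern _ _ _ _ _ t0 gE) expr1; congr (_ * _).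
    have q0 : 0 < Num.sqrt n%:R :> R by rewrite sqrtr_gt0 ltr0n.
    have q2 : n%:R = Num.sqrt n%:R * Num.sqrt n%:R :> R by rewrite -expr2 sqr_sqrtr.
    by rewrite [X in X^-1 * (_ / _)]q2; field; rewrite !gt_eqF.
  by move=> n n0; rewrite expr0 mulr1.
apply: (plugin_error_limit hB sigma_gt0 K0 (@tame_Ph R) (@continuous_Ph R)
  (@Ph01 R) (occupation_bridge_mean hB sigma_gt0) sigma__gt0 hsigma_ tmax_gt0 hOhat).
  move=> n t w n0 t0; rewrite /plugin_occupation_time /bmean.
  by rewrite (increment_sum_kern _ _ _ _ _ t0 GE) expr0 mulr1.
move=> n n0; rewrite expr1 -powR12_sqrt// -powRD; last first.
  by apply/implyP => _; rewrite pnatr_eq0 -lt0n.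
by congr (_ `^ _); field.
Qed.
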